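(* Let $m$ be a non-negative integer. The function $\tilde{\Phi}^{[m]}(\tau,z_1,z_2,t)$ defined in the context has the following properties ($\tau,z_1,z_2,t\in\mathbb{C}$, $\operatorname{Im}\tau>0$): (a) $\tilde{\Phi}^{[m]}\left(-\frac1\tau,\frac{z_1}\tau,\frac{z_2}\tau,t-\frac{z_1z_2}{\tau}\right)=\tau\,\tilde{\Phi}^{[m]}(\tau,z_1,z_2,t)$. (b) $\tilde{\Phi}^{[m]}(\tau,z_1+a,z_2+b,t)=\tilde{\Phi}^{[m]}(\tau,z_1,z_2,t)$ if $a,b\in\mathbb{Z}$. (c) $\tilde{\Phi}^{[m]}(\tau,-z_1,-z_2,t)=-\tilde{\Phi}^{[m]}(\tau,z_1,z_2,t)$ and $\tilde{\Phi}^{[m]}(\tau,z_2,z_1,t)=\tilde{\Phi}^{[m]}(\tau,z_1,z_2,t)$. (d) $\tilde{\Phi}^{[m]}(\tau+1,z_1,z_2,t)=\tilde{\Phi}^{[m]}(\tau,z_1,z_2,t)$. (e) $\tilde{\Phi}^{[m]}(\tau,z_1+j\tau,z_2+k\tau,t)=q^{-(m+1)jk}e^{-2\pi i(m+1)(kz_1+jz_2)}\,\tilde{\Phi}^{[m]}(\tau,z_1,z_2,t)$ if $j,k\in\mathbb{Z}$.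
   Context: Notation: $q=e^{2\pi i\tau}$, $q^s=e^{2\pi i s\tau}$. For a positive integer $k$ and $j\in\mathbb{Z}/2k\mathbb{Z}$, $\Theta_{j,k}(\tau,z)=\sum_{n\in\mathbb{Z}+\frac{j}{2k}}q^{kn^2}e^{2\pi i knz}$. For an integer $m\ge0$ let $$\Phi^{[m]}(\tau,z_1,z_2,t)=e^{2\pi i(m+1)t}\sum_{j\in\mathbb{Z}}\left(\frac{e^{2\pi ij(m+1)(z_1+z_2)}q^{j^2(m+1)}}{1-e^{2\pi iz_1}q^j}-\frac{e^{-2\pi ij(m+1)(z_1+z_2)}q^{j^2(m+1)}}{1-e^{-2\pi iz_2}q^j}\right).$$ Let $E(x)=2\int_0^xe^{-\pi w^2}dw$ and, for a positive integer $k$ and $j\in\mathbb{Z}$, let $$R_{k;j}(\tau,v)=\sum_{n\in\mathbb{Z},\,n\equiv j\bmod 2k}\left(\operatorname{sign}\left(n+\tfrac12\right)-E\left(\left(n+2k\frac{\operatorname{Im}v}{\operatorname{Im}\tau}\right)\left(\frac{\operatorname{Im}\tau}{k}\right)^{1/2}\right)\right)e^{-\frac{\pi in^2}{2k}\tau-2\pi inv}$$ (it depends only on $j\bmod 2k$). Put $$\Phi^{[m]}_{\rm add}(\tau,z_1,z_2,t)=-\tfrac12e^{2\pi i(m+1)t}\sum_{j\in\mathbb{Z}/(2m+2)\mathbb{Z}}R_{m+1;j}\left(\tau,\tfrac{z_1-z_2}2\right)(\Theta_{j,m+1}-\Theta_{-j,m+1})(\tau,z_1+z_2),$$ $$\tilde{\Phi}^{[m]}=\Phi^{[m]}+\Phi^{[m]}_{\rm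 add}.$$ Identities are understood at points where both sides are defined (away from the poles of $\Phi^{[m]}$). *)

(* Defs.v *)
From Stdlib Require Export Reals ZArith.
From Coquelicot Require Export Coquelicot.

Open Scope R_scope.
Open Scope C_scope.

Definition Cexp (z : C) : C :=
  (exp (Re z) * cos (Im z), exp (Re z) * sin (Im z))%R.

(** [e2pi z] is [exp (2 pi i z)]; [qpow tau s] is [q^s = exp (2 pi i s tau)]. *)
Definition e2pi (z : C) : C := Cexp (RtoC (2 * PI) * Ci * z).
Definition qpow (tau : C) (s : R) : C := e2pi (RtoC s * tau).

Definition CSeries (a : nat -> C) : C :=
  (Series (fun n => Re (a n)), Series (fun n => Im (a n))).

(** The sum over all integers, split as [n >= 0] and [n <= -1]. All the sums
    below converge absolutely when [0 < Im tau] (for [Phi], off its poles), so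
    the order of summation is immaterial. *)
Definition sumZ (f : Z -> C) : C :=
  CSeries (fun n => f (Z.of_nat n)) + CSeries (fun n => f (- Z.of_nat (S n))%Z).

(** The index [n] in [Z + j/2k] is written [p + j/2k] with [p : Z].
    Here and in [Rkj] the integer [k] is meant to be positive. *)
Definition Theta (j : Z) (k : nat) (tau z : C) : C :=
  sumZ (fun p =>
    let n := (IZR p + IZR j / (2 * INR k))%R in
    qpow tau (INR k * n ^ 2) * e2pi (RtoC (INR k * n) * z)).

Definition Phi (m : nat) (tau z1 z2 t : C) : C :=
  let M := INR (m + 1) in
  e2pi (RtoC M * t) *
  sumZ (fun j =>
    e2pi (RtoC (IZR j * M) * (z1 + z2)) * qpow tau (IZR j ^ 2 * M)
      / (RtoC 1 - e2pi z1 * qpow tau (IZR j))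
    - e2pi (- (RtoC (IZR j * M) * (z1 + z2))) * qpow tau (IZR j ^ 2 * M)
      / (RtoC 1 - e2pi (- z2) * qpow tau (IZR j))).

(** No denominator occurring in [Phi] vanishes at [(tau, z1, z2)]. *)
Definition Phi_defined (tau z1 z2 : C) : Prop :=
  forall j : Z,
    RtoC 1 - e2pi z1 * qpow tau (IZR j) <> RtoC 0 /\
    RtoC 1 - e2pi (- z2) * qpow tau (IZR j) <> RtoC 0.

Definition E (x : R) : R :=
  (2 * RInt (fun w => exp (- PI * w ^ 2)) 0 x)%R.

(** The integers [n] congruent to [j] mod [2k] are written [j + 2kp] with
    [p : Z]. *)
Definition Rkj (k : nat) (j : Z) (tau v : C) : C :=
  sumZ (fun p =>
    let n := IZR (j + 2 * Z.of_nat k * p) in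
    RtoC (sign (n + 1 / 2)
          - E ((n + 2 * INR k * (Im v / Im tau)) * sqrt (Im tau / INR k)))
    * Cexp (- (RtoC (PI * n ^ 2 / (2 * INR k)) * Ci * tau)
            - RtoC (2 * PI * n) * Ci * v)).

(** [Z/(2m+2)Z] is represented by [0, ..., 2m+1]; [sum_n f N] has the [N+1]
    terms [f 0, ..., f N]. *)
Definition Phi_add (m : nat) (tau z1 z2 t : C) : C :=
  RtoC (- (1 / 2)) * e2pi (RtoC (INR (m + 1)) * t) *
  sum_n (fun i : nat =>
    let j := Z.of_nat i in
    Rkj (m + 1) j tau ((z1 - z2) / RtoC 2)
    * (Theta j (m + 1) tau (z1 + z2) - Theta (- j) (m + 1) tau (z1 + z2)))
  (2 * m + 1).

Definition Phi_tilde (m : nat) (tau z1 z2 t : C) : C :=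
  Phi m tau z1 z2 t + Phi_add m tau z1 z2 t.

(* Main.v *)
(** Dropping factors [e2pi (M t)] with [M = m + 1], write Phi-tilde as [A(z1,z2) - A(-z2,-z1)],
    where [A] is an Appell sum plus half the sum of the [R_j Theta_{-j}].  With
    [W = z1 + p tau + a] and [s = Im z2 / Im tau], [A] is, up to a theta constant [Theta_0(z1 + z2)]
    that cancels in the difference, [- 1 / (2 pi i)] times the absolutely convergent lattice sum
      [sum_{p,a} exp (2 pi i M (p z2 - s W) - pi M |W|^2 / Im tau) / W],
    for which (a)-(e) are reindexings by linear maps and translations of the lattice.

    To get the lattice sum, expand [R_j Theta_{-j}] and collect, for each [p], the series
    [1/(1-X) + 1/2 sum_n (E((n-c)k) - sign(n+1/2)) X^n] with [X = e2pi (z1 + p tau)].  Times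
    [1 - X] it telescopes to [int_0^1 sum_n k exp(-pi k^2 (n-c-u)^2) X^n du]; Poisson summation
    of the Gaussian under the integral produces the sum over [a].  Poisson summation itself
    follows from uniqueness of Fourier coefficients of continuous functions. *)

Require Import Defs.
From Stdlib Require Import Lra Lia List Permutation Classical ClassicalEpsilon FunctionalExtensionality.
Import ListNotations.
Local Open Scope R_scope.

(** * Unordered summation *)

(** The obstacle is the order of summation. The double series is regrouped by rows, by columns, by
    residue classes and by unimodular maps of the index plane, while the definitions use one-sided
    [Series]. Everything therefore runs through unordered absolutely convergent sums, which
    [is_sum_Z] ties to [sumZ]. The width [sqrt (Im tau / M)] and the centre [2 M Im v / Im tau] are
    read off the argument of [E] in [Rkj]. With exactly these values the holomorphic Gaussian
    produced by Poisson summation, times the weight [q^(M p^2)], turns into a Gaussian in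
    [|W|^2 / Im tau], a quantity attached to the lattice and not to its basis. A cross term
    [e2pi (- M p a)] is left over, and it is 1 because [M] is an integer. The factor [1 / W] comes
    from integrating [e2pi (u W)] over [0 <= u <= 1]. The theta constant comes from [n = 0], where
    [sign (n + 1/2)] fails to be odd. Real Fourier analysis is done with cosines of arbitrary phase,
    so that the phases 0 and [- PI / 2] give the real and imaginary parts together. *)

Lemma classic_eq_dec {I : Type} (x y : I) : {x = y} + {x <> y}.
Proof. apply excluded_middle_informative. Qed.

Definition rsum {I : Type} (f : I -> R) (l : list I) : R :=
  fold_right (fun i s => f i + s) 0 l.

Lemma rsum_app {I} (f : I -> R) l l' : rsum f (l ++ l') = rsum f l + rsum f l'.
Proof. induction l as [|i l IH]; simpl; [lra|]. rewrite IH. lra. Qed.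

Lemma rsum_plus {I} (f g : I -> R) l :
  rsum (fun i => f i + g i) l = rsum f l + rsum g l.
Proof. induction l as [|i l IH]; simpl; [lra|]. rewrite IH. lra. Qed.

Lemma rsum_scal {I} (f : I -> R) c l : rsum (fun i => c * f i) l = c * rsum f l.
Proof. induction l as [|i l IH]; simpl; [lra|]. rewrite IH. lra. Qed.

Lemma rsum_map {I J} (f : I -> R) (e : J -> I) l : rsum f (map e l) = rsum (fun j => f (e j)) l.
Proof. induction l as [|i l IH]; simpl; [lra|]. rewrite IH. lra. Qed.

Lemma rsum_le {I} (f g : I -> R) l : (forall i, f i <= g i) -> rsum f l <= rsum g l.
Proof. intros H. induction l as [|i l IH]; simpl; [lra|]. specialize (H i). lra. Qed.

Lemma rsum_nonneg {I} (f : I -> R) l : (forall i, 0 <= f i) -> 0 <= rsum f l.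
Proof. intros H. induction l as [|i l IH]; simpl; [lra|]. specialize (H i). lra. Qed.

Lemma rsum_perm {I} (f : I -> R) l l' : Permutation l l' -> rsum f l = rsum f l'.
Proof. induction 1; simpl; lra. Qed.

Lemma rsum_abs {I} (f g : I -> R) l : (forall i, Rabs (f i) <= g i) -> Rabs (rsum f l) <= rsum g l.
Proof.
  intros H. induction l as [|i l IH]; simpl; [rewrite Rabs_R0; lra|].
  eapply Rle_trans; [apply Rabs_triang|]. specialize (H i). lra.
Qed.

Lemma NoDup_incl_split {I} (l l' : list I) : NoDup l -> NoDup l' -> incl l l' ->
  exists r, NoDup r /\ Permutation l' (l ++ r).
Proof.
  intros Hl Hl' Hi.
  exists (filter (fun x => if in_dec classic_eq_dec x l then false else true) l').
  split; [now apply NoDup_filter|].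
  apply NoDup_Permutation; trivial.
  - apply NoDup_app; [easy|now apply NoDup_filter|].
    intros x Hx Hx'. apply filter_In in Hx' as [_ Hx'].
    destruct (in_dec classic_eq_dec x l); easy.
  - intros x. rewrite in_app_iff, filter_In.
    destruct (in_dec classic_eq_dec x l); intuition.
Qed.

Lemma rsum_incl {I} (f : I -> R) l l' : (forall i, 0 <= f i) -> NoDup l -> NoDup l' ->
  incl l l' -> rsum f l <= rsum f l'.
Proof.
  intros Hf Hl Hl' Hi. destruct (NoDup_incl_split l l' Hl Hl' Hi) as [r [_ Hr]].
  rewrite (rsum_perm f _ _ Hr), rsum_app. pose proof (rsum_nonneg f r Hf). lra.
Qed.

Definition sum_bound {I} (a : I -> R) (B : R) : Prop :=
  forall l, NoDup l -> rsum a l <= B.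

Definition psum {I} (a : I -> R) (A : R) : Prop :=
  (forall i, 0 <= a i) /\ sum_bound a A /\ (forall B, sum_bound a B -> A <= B).

(** Absolute summability, as a difference of two nonnegative summable families. These are arbitrary,
    not the positive and negative parts of [f], so sums, scalings and Fubini reduce at once to the
    nonnegative case; uniqueness then compares [A + B'] with [A' + B]. *)
Definition is_sum {I} (f : I -> R) (s : R) : Prop :=
  exists a b A B, psum a A /\ psum b B /\ (forall i, f i = a i - b i) /\ s = A - B.

Definition nodup_app {I} (l l' : list I) := nodup classic_eq_dec (l ++ l').

Lemma nodup_app_NoDup {I} (l l' : list I) : NoDup (nodup_app l l').
Proof. apply NoDup_nodup. Qed.

Lemma nodup_app_l {I} (l l' : list I) : incl l (nodup_app l l').
Proof. intros x Hx. apply nodup_In, in_app_iff. now left. Qed.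

Lemma nodup_app_r {I} (l l' : list I) : incl l' (nodup_app l l').
Proof. intros x Hx. apply nodup_In, in_app_iff. now right. Qed.

Lemma psum_unique {I} (a : I -> R) A B : psum a A -> psum a B -> A = B.
Proof. intros [_ [H1 H2]] [_ [H3 H4]]. apply Rle_antisym; auto. Qed.

Lemma psum_approx {I} (a : I -> R) A eps : psum a A -> 0 < eps ->
  exists l0, NoDup l0 /\ forall l, NoDup l -> incl l0 l -> A - eps < rsum a l <= A.
Proof.
  intros [H0 [H1 H2]] He.
  destruct (classic (exists l0, NoDup l0 /\ A - eps < rsum a l0)) as [[l0 [Hn Hl]]|Hno].
  - exists l0. split; [easy|]. intros l Hl1 Hl2. split; [|now apply H1].
    pose proof (rsum_incl a l0 l H0 Hn Hl1 Hl2). lra.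
  - assert (A <= A - eps); [|lra].
    apply H2. intros l Hl. apply Rnot_lt_le. intros Hc. apply Hno. now exists l.
Qed.

Lemma ex_psum {I} (a : I -> R) B : (forall i, 0 <= a i) -> sum_bound a B -> exists A, psum a A.
Proof.
  intros H0 HB.
  destruct (completeness (fun r => exists l, NoDup l /\ r = rsum a l)) as [A [HA1 HA2]].
  - exists B. intros r [l [Hl ->]]. now apply HB.
  - exists 0, nil. split; [constructor|easy].
  - exists A. split; [easy|]. split.
    + intros l Hl. apply HA1. now exists l.
    + intros B' HB'. apply HA2. intros r [l [Hl ->]]. now apply HB'.
Qed.

Lemma ex_psum_le {I} (a b : I -> R) B : (forall i, 0 <= a i <= b i) -> psum b B -> exists A, psum a A.
Proof.
  intros H [_ [HB _]]. apply (ex_psum a B); [apply H|].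
  intros l Hl. eapply Rle_trans; [|now apply (HB l)]. apply rsum_le. apply H.
Qed.

Lemma psum_ext {I} (a b : I -> R) A : (forall i, a i = b i) -> psum a A -> psum b A.
Proof. intros H. now replace b with a by now apply functional_extensionality. Qed.

Lemma psum_plus {I} (a b : I -> R) A B : psum a A -> psum b B -> psum (fun i => a i + b i) (A + B).
Proof.
  intros Ha Hb. pose proof Ha as [Ha0 [Ha1 Ha2]]. pose proof Hb as [Hb0 [Hb1 Hb2]].
  split; [|split].
  - intros i. specialize (Ha0 i). specialize (Hb0 i). lra.
  - intros l Hl. rewrite rsum_plus. specialize (Ha1 l Hl). specialize (Hb1 l Hl). lra.
  - intros C HC. apply Rnot_lt_le. intros Hlt.
    destruct (psum_approx a A ((A + B - C) / 2) Ha) as [l1 [Hl1 H1]]; [lra|].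
    destruct (psum_approx b B ((A + B - C) / 2) Hb) as [l2 [Hl2 H2]]; [lra|].
    specialize (HC _ (nodup_app_NoDup l1 l2)). rewrite rsum_plus in HC.
    specialize (H1 _ (nodup_app_NoDup l1 l2) (nodup_app_l l1 l2)).
    specialize (H2 _ (nodup_app_NoDup l1 l2) (nodup_app_r l1 l2)). lra.
Qed.

Lemma psum_scal {I} (a : I -> R) A c : 0 <= c -> psum a A -> psum (fun i => c * a i) (c * A).
Proof.
  intros Hc [H0 [H1 H2]]. split; [|split].
  - intros i. apply Rmult_le_pos; auto.
  - intros l Hl. rewrite rsum_scal. apply Rmult_le_compat_l; auto.
  - intros B HB. destruct Hc as [Hc|<-].
    + rewrite Rmult_comm. apply Rle_div_r; [easy|]. apply H2. intros l Hl.
      apply Rle_div_r; [easy|]. specialize (HB l Hl). rewrite rsum_scal in HB. lra.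
    + specialize (HB nil (NoDup_nil _)). simpl in HB. lra.
Qed.

Lemma psum_inj {I J} (a : I -> R) A (e : J -> I) :
  (forall j j', e j = e j' -> j = j') ->
  (forall i, a i <> 0 -> exists j, e j = i) ->
  (psum a A <-> psum (fun j => a (e j)) A).
Proof.
  intros Hinj Hsupp.
  assert (Hb : forall B, sum_bound a B <-> sum_bound (fun j => a (e j)) B).
  { intros B. split; intros HB l Hl.
    - rewrite <- rsum_map. apply HB. apply FinFun.Injective_map_NoDup; easy.
    - assert (exists l', NoDup l' /\ rsum a l = rsum (fun j => a (e j)) l'
                         /\ forall j, In j l' -> In (e j) l) as [l' [H1 [-> _]]].
      { clear HB B. induction Hl as [|i l Hi Hl IH].
        - exists nil. repeat split; [constructor|easy].
        - destruct IH as [l' [H1 [H2 H3]]].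
          destruct (Req_dec (a i) 0) as [H|H].
          + exists l'. simpl. repeat split; [easy|lra|]. auto.
          + destruct (Hsupp i H) as [j <-]. exists (j :: l'). repeat split.
            * constructor; [|easy]. intros Hj. now apply Hi, H3.
            * simpl. now rewrite H2.
            * intros j' [<-|Hj]; [now left|]. right. auto. }
      now apply HB. }
  split; intros [H0 [H1 H2]]; (split; [|split]).
  - intros j. apply H0.
  - now apply Hb.
  - intros B HB. now apply H2, Hb.
  - intros i. destruct (Req_dec (a i) 0) as [H|H]; [lra|].
    destruct (Hsupp i H) as [j <-]. apply H0.
  - now apply Hb.
  - intros B HB. now apply H2, Hb.
Qed.

Lemma rsum_list_prod {I J} (f : I * J -> R) l l' :
  rsum f (list_prod l l') = rsum (fun i => rsum (fun j => f (i, j)) l') l.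
Proof.
  induction l as [|i l IH]; simpl; [easy|].
  rewrite rsum_app, IH, rsum_map. reflexivity.
Qed.

Lemma NoDup_list_prod {I J} (l : list I) (l' : list J) :
  NoDup l -> NoDup l' -> NoDup (list_prod l l').
Proof.
  intros Hl Hl'. induction Hl as [|i l Hi Hl IH]; simpl; [constructor|].
  apply NoDup_app.
  - apply FinFun.Injective_map_NoDup; [|easy]. intros x y H. now inversion H.
  - easy.
  - intros [x y] H1 H2. apply in_map_iff in H1 as [z [Hz _]]. inversion Hz; subst.
    apply in_prod_iff in H2. easy.
Qed.

Lemma incl_list_prod {I J} (l : list (I * J)) :
  incl l (list_prod (nodup classic_eq_dec (map fst l)) (nodup classic_eq_dec (map snd l))).
Proof.
  intros [i j] H. apply in_prod_iff. split; apply nodup_In.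
  - now apply (in_map fst) in H.
  - now apply (in_map snd) in H.
Qed.

(** Finitely many rows are approximated through one common finite set of columns, with an error of
    [eps] per row; the resulting rectangle is a finite sum of [f], hence at most [s]. Conversely
    every finite set of pairs lies in a rectangle. *)
Lemma psum_fubini {I J} (f : I * J -> R) s : psum f s ->
  exists g, (forall i, psum (fun j => f (i, j)) (g i)) /\ psum g s.
Proof.
  intros Hf. pose proof Hf as [H0 [H1 H2]].
  assert (Hi : forall i, exists A, psum (fun j => f (i, j)) A).
  { intros i. apply (ex_psum _ s); [easy|]. intros l Hl.
    rewrite <- (rsum_map f (fun j => (i, j))). apply H1.
    apply FinFun.Injective_map_NoDup; [|easy]. intros x y H. now inversion H. }
  set (g := fun i => proj1_sig (constructive_indefinite_description _ (Hi i))).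
  assert (Hg : forall i, psum (fun j => f (i, j)) (g i)).
  { intros i. unfold g. now destruct (constructive_indefinite_description _ (Hi i)). }
  exists g. split; [easy|]. split; [|split].
  - intros i. destruct (Hg i) as [_ [H _]]. apply (H nil). constructor.
  - intros l Hl.
    assert (Ha : forall eps, 0 < eps -> exists l', NoDup l' /\
       rsum g l <= rsum (fun i => rsum (fun j => f (i, j)) l') l + INR (length l) * eps).
    { intros eps He. clear Hl. induction l as [|i l IH].
      - exists nil. split; [constructor|]. simpl. lra.
      - destruct IH as [l1 [Hl1 H3]].
        destruct (psum_approx _ _ eps (Hg i) He) as [l2 [Hl2 H4]].
        exists (nodup_app l1 l2). split; [apply nodup_app_NoDup|].
        specialize (H4 _ (nodup_app_NoDup l1 l2) (nodup_app_r l1 l2)).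
        assert (rsum (fun i => rsum (fun j => f (i, j)) l1) l
                <= rsum (fun i => rsum (fun j => f (i, j)) (nodup_app l1 l2)) l).
        { apply rsum_le. intros i'. apply rsum_incl; trivial.
          - apply nodup_app_NoDup. - apply nodup_app_l. }
        change (length (i :: l)) with (S (length l)). rewrite S_INR. simpl rsum. lra. }
    apply Rnot_lt_le. intros Hlt. set (d := rsum g l - s).
    assert (0 < d / (INR (length l) + 1)).
    { apply Rdiv_lt_0_compat; [unfold d; lra|]. pose proof (pos_INR (length l)). lra. }
    destruct (Ha _ H) as [l' [Hl' H3]].
    pose proof (H1 _ (NoDup_list_prod l l' Hl Hl')) as H4. rewrite rsum_list_prod in H4.
    pose proof (pos_INR (length l)).
    assert (INR (length l) * (d / (INR (length l) + 1)) = d - d / (INR (length l) + 1)) by (field; lra).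
    unfold d in *. lra.
  - intros B HB. apply H2. intros L HL.
    set (l := nodup classic_eq_dec (map fst L)). set (l' := nodup classic_eq_dec (map snd L)).
    apply Rle_trans with (rsum f (list_prod l l')).
    + apply rsum_incl; trivial. apply NoDup_list_prod; apply NoDup_nodup. apply incl_list_prod.
    + rewrite rsum_list_prod. eapply Rle_trans; [|apply (HB l), NoDup_nodup].
      apply rsum_le. intros i. apply (Hg i). apply NoDup_nodup.
Qed.

Lemma ex_psum_prod {I J} (a : I -> R) (b : J -> R) A B : psum a A -> psum b B ->
  exists C, psum (fun ij : I * J => a (fst ij) * b (snd ij)) C.
Proof.
  intros [Ha0 [Ha1 _]] [Hb0 [Hb1 _]]. apply (ex_psum _ (A * B)).
  - intros [i j]. apply Rmult_le_pos; auto.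
  - intros L HL.
    set (l := nodup classic_eq_dec (map fst L)). set (l' := nodup classic_eq_dec (map snd L)).
    eapply Rle_trans; [apply (rsum_incl _ L (list_prod l l'))|].
    + intros [i j]. apply Rmult_le_pos; auto.
    + easy.
    + apply NoDup_list_prod; apply NoDup_nodup.
    + apply incl_list_prod.
    + rewrite rsum_list_prod.
      replace (rsum _ l) with (rsum b l' * rsum a l).
      * rewrite Rmult_comm. apply Rmult_le_compat; try (now apply rsum_nonneg).
        apply Ha1, NoDup_nodup. apply Hb1, NoDup_nodup.
      * rewrite <- rsum_scal. f_equal. apply functional_extensionality. intros i. simpl.
        rewrite rsum_scal. ring.
Qed.

Lemma psum_is_sum {I} (a : I -> R) A : psum a A -> is_sum a A.
Proof.
  intros H. exists a, (fun i => 0 * a i), A, (0 * A). repeat split; try apply H.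
  - intros i. lra.
  - intros l Hl. rewrite rsum_scal. lra.
  - intros B HB. specialize (HB nil (NoDup_nil _)). simpl in HB. lra.
  - intros i. lra.
  - lra.
Qed.

Lemma is_sum_zero {I} : is_sum (fun _ : I => 0) 0.
Proof.
  apply psum_is_sum. split; [intros; lra|]. split.
  - intros l _. induction l; simpl; lra.
  - intros B HB. apply (HB nil). constructor.
Qed.

Lemma is_sum_unique {I} (f : I -> R) s t : is_sum f s -> is_sum f t -> s = t.
Proof.
  intros [a [b [A [B [Ha [Hb [Hf ->]]]]]]] [a' [b' [A' [B' [Ha' [Hb' [Hf' ->]]]]]]].
  assert (A + B' = A' + B); [|lra].
  apply (psum_unique (fun i => a i + b' i)); [now apply psum_plus|].
  apply psum_ext with (fun i => a' i + b i); [|now apply psum_plus].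
  intros i. specialize (Hf i). specialize (Hf' i). lra.
Qed.

Lemma is_sum_ext {I} (f g : I -> R) s : (forall i, f i = g i) -> is_sum f s -> is_sum g s.
Proof. intros H. now replace g with f by now apply functional_extensionality. Qed.

Lemma is_sum_plus {I} (f g : I -> R) s t :
  is_sum f s -> is_sum g t -> is_sum (fun i => f i + g i) (s + t).
Proof.
  intros [a [b [A [B [Ha [Hb [Hf ->]]]]]]] [a' [b' [A' [B' [Ha' [Hb' [Hf' ->]]]]]]].
  exists (fun i => a i + a' i), (fun i => b i + b' i), (A + A'), (B + B').
  split; [now apply psum_plus|]. split; [now apply psum_plus|].
  split; [|lra]. intros i. rewrite Hf, Hf'. lra.
Qed.

Lemma is_sum_opp {I} (f : I -> R) s : is_sum f s -> is_sum (fun i => - f i) (- s).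
Proof.
  intros [a [b [A [B [Ha [Hb [Hf ->]]]]]]]. exists b, a, B, A.
  repeat split; try apply Ha; try apply Hb; [|lra]. intros i. rewrite Hf. lra.
Qed.

Lemma is_sum_scal {I} (f : I -> R) s c : is_sum f s -> is_sum (fun i => c * f i) (c * s).
Proof.
  assert (H : forall c s, 0 <= c -> is_sum f s -> is_sum (fun i => c * f i) (c * s)).
  { clear. intros c s Hc [a [b [A [B [Ha [Hb [Hf ->]]]]]]].
    exists (fun i => c * a i), (fun i => c * b i), (c * A), (c * B).
    split; [now apply psum_scal|]. split; [now apply psum_scal|].
    split; [|lra]. intros i. rewrite Hf. lra. }
  intros Hf. destruct (Rle_dec 0 c) as [Hc|Hc]; [now apply H|].
  replace (c * s) with (- ((- c) * s)) by lra.
  apply is_sum_ext with (fun i => - (- c * f i)); [intros; lra|].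
  apply is_sum_opp, H; [lra|easy].
Qed.

Lemma is_sum_inj {I J} (f : I -> R) s (e : J -> I) :
  (forall j j', e j = e j' -> j = j') ->
  (forall i, f i <> 0 -> exists j, e j = i) ->
  (is_sum (fun j => f (e j)) s -> is_sum f s).
Proof.
  intros Hinj Hsupp [a [b [A [B [Ha [Hb [Hf ->]]]]]]].
  set (ext := fun (a : J -> R) i => match excluded_middle_informative (exists j, e j = i) with
     | left H => a (proj1_sig (constructive_indefinite_description _ H)) | right _ => 0 end).
  assert (He : forall a j, ext a (e j) = a j).
  { intros a' j. unfold ext. destruct (excluded_middle_informative _) as [H|H].
    - destruct (constructive_indefinite_description _ H) as [j' Hj']. simpl. f_equal. auto.
    - exfalso. apply H. now exists j. }
  assert (Hn : forall a i, ~ (exists j, e j = i) -> ext a i = 0).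
  { intros a' i Hi. unfold ext. now destruct (excluded_middle_informative _). }
  assert (Hx : forall a A, psum a A -> psum (ext a) A).
  { intros a' A' H. apply (psum_inj (ext a') A' e Hinj).
    - intros i Hi. apply NNPP. intros Hc. now apply Hi, Hn.
    - revert H. apply psum_ext. intros j. now rewrite He. }
  exists (ext a), (ext b), A, B. split; [now apply Hx|]. split; [now apply Hx|]. split; [|easy].
  intros i. destruct (classic (exists j, e j = i)) as [[j <-]|H].
  - now rewrite !He.
  - rewrite !Hn, Rminus_0_r by easy. apply NNPP. intros Hc.
    now apply H, Hsupp.
Qed.

Lemma is_sum_bij {I J} (f : I -> R) s (e : J -> I) (e' : I -> J) :
  (forall j, e' (e j) = j) -> (forall i, e (e' i) = i) ->
  is_sum f s -> is_sum (fun j => f (e j)) s.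
Proof.
  intros H1 H2 Hf. apply (is_sum_inj _ s e').
  - intros j j' H. rewrite <- (H2 j), <- (H2 j'). now f_equal.
  - intros j _. exists (e j). apply H1.
  - revert Hf. apply is_sum_ext. intros i. now rewrite H2.
Qed.

Lemma is_sum_fubini {I J} (f : I * J -> R) s : is_sum f s ->
  exists g, (forall i, is_sum (fun j => f (i, j)) (g i)) /\ is_sum g s.
Proof.
  intros [a [b [A [B [Ha [Hb [Hf ->]]]]]]].
  destruct (psum_fubini a A Ha) as [ga [H1 H2]]. destruct (psum_fubini b B Hb) as [gb [H3 H4]].
  exists (fun i => ga i - gb i). split.
  - intros i. exists (fun j => a (i, j)), (fun j => b (i, j)), (ga i), (gb i).
    repeat split; auto; try apply H1; try apply H3.
  - exists ga, gb, A, B. auto.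
Qed.

Lemma is_sum_dominated {I} (f M : I -> R) B : psum M B -> (forall i, Rabs (f i) <= M i) ->
  exists s, is_sum f s.
Proof.
  intros HM Hf.
  destruct (ex_psum_le (fun i => f i + M i) (fun i => M i + M i) (B + B)) as [A HA].
  - intros i. specialize (Hf i). apply Rabs_le_between in Hf. lra.
  - now apply psum_plus.
  - exists (A - B), (fun i => f i + M i), M, A, B. repeat split; try apply HA; try apply HM.
    intros i. lra.
Qed.

Lemma is_sum_net {I} (f : I -> R) s eps : is_sum f s -> 0 < eps ->
  exists l0, NoDup l0 /\ forall l, NoDup l -> incl l0 l -> Rabs (rsum f l - s) < eps.
Proof.
  intros [a [b [A [B [Ha [Hb [Hf ->]]]]]]] He.
  destruct (psum_approx a A eps Ha He) as [l1 [Hl1 H1]].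
  destruct (psum_approx b B eps Hb He) as [l2 [Hl2 H2]].
  exists (nodup_app l1 l2). split; [apply nodup_app_NoDup|]. intros l Hl Hi.
  specialize (H1 l Hl (incl_tran (nodup_app_l l1 l2) Hi)).
  specialize (H2 l Hl (incl_tran (nodup_app_r l1 l2) Hi)).
  replace (rsum f l) with (rsum a l - rsum b l).
  - apply Rabs_lt_between. lra.
  - replace f with (fun i => a i + (-1) * b i).
    + rewrite rsum_plus, rsum_scal. lra.
    + apply functional_extensionality. intros i. rewrite Hf. lra.
Qed.

(* One finite set works for all families with the same majorant. *)
Lemma is_sum_tail {I} (M : I -> R) B eps : psum M B -> 0 < eps ->
  exists l0, NoDup l0 /\ forall l, NoDup l -> incl l0 l ->
    forall f s, (forall i, Rabs (f i) <= M i) -> is_sum f s -> Rabs (rsum f l - s) <= eps.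
Proof.
  intros HM He. destruct (psum_approx M B eps HM He) as [l0 [Hl0 H0]].
  exists l0. split; [easy|]. intros l Hl Hi f s Hf Hs. apply Rnot_lt_le. intros Hlt.
  destruct (is_sum_net f s (Rabs (rsum f l - s) - eps) Hs) as [l1 [Hl1 H1]]; [lra|].
  specialize (H1 _ (nodup_app_NoDup l l1) (nodup_app_r l l1)).
  destruct (NoDup_incl_split l _ Hl (nodup_app_NoDup l l1) (nodup_app_l _ _)) as [r [_ Hr]].
  pose proof (H0 l Hl Hi).
  pose proof (H0 _ (nodup_app_NoDup l l1) (incl_tran Hi (nodup_app_l _ _))).
  rewrite (rsum_perm f _ _ Hr), rsum_app in H1. rewrite (rsum_perm M _ _ Hr), rsum_app in H2.
  pose proof (rsum_abs f M r Hf).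
  assert (Rabs (rsum f l - s) <= Rabs (rsum f l + rsum f r - s) + Rabs (rsum f r)); [|lra].
  replace (rsum f l - s) with ((rsum f l + rsum f r - s) + - rsum f r) by lra.
  rewrite <- (Rabs_Ropp (rsum f r)). apply Rabs_triang.
Qed.

Lemma is_sum_nat {f : nat -> R} {s} : is_sum f s -> is_series f s.
Proof.
  intros Hf. change (is_lim_seq (sum_n f) s). apply is_lim_seq_spec. intros eps.
  destruct (is_sum_net f s eps Hf (cond_pos eps)) as [l0 [_ H]].
  exists (list_max l0). intros n Hn.
  replace (sum_n f n) with (rsum f (seq 0 (S n))).
  - apply H; [apply seq_NoDup|]. intros i Hi. apply in_seq. split; [lia|].
    pose proof (proj1 (list_max_le l0 (list_max l0)) (Nat.le_refl _)) as Hm.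
    rewrite Forall_forall in Hm. specialize (Hm i Hi). lia.
  - clear. induction n as [|n IH].
    + simpl. rewrite sum_O. lra.
    + rewrite sum_Sn, <- IH, seq_S, rsum_app. simpl rsum. unfold plus. simpl. lra.
Qed.

Lemma is_sum_finite (f : nat -> R) s K : is_sum f s -> (forall n, (K < n)%nat -> f n = 0) ->
  s = sum_n f K.
Proof.
  intros Hf H0. apply is_sum_nat in Hf.
  assert (H : is_lim_seq (sum_n f) (sum_n f K)).
  { apply is_lim_seq_ext_loc with (fun _ => sum_n f K); [|apply is_lim_seq_const].
    exists K. intros n Hn. induction Hn as [|n Hn IH]; [easy|].
    rewrite sum_Sn, <- IH, H0 by lia. unfold plus. simpl. lra. }
  change (is_lim_seq (sum_n f) s) in Hf.
  apply is_lim_seq_unique in H. apply is_lim_seq_unique in Hf.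
  rewrite H in Hf. now inversion Hf.
Qed.

(** Fubini for a partition into [K + 1] classes, each a copy of [J], after padding by zero to
    [nat * J]. It serves twice: for the two halves of the integers in [sumZ], and for the residue
    classes mod [2k]. *)
Lemma is_sum_classes {I J} (f : I -> R) s K (e : nat -> J -> I) (cl : I -> nat) (pr : I -> J) :
  (forall i, (cl i <= K)%nat) -> (forall i, e (cl i) (pr i) = i) ->
  (forall k j, (k <= K)%nat -> cl (e k j) = k /\ pr (e k j) = j) ->
  is_sum f s ->
  exists g, (forall k, (k <= K)%nat -> is_sum (fun j => f (e k j)) (g k)) /\ s = sum_n g K.
Proof.
  intros Hcl He Hk Hf.
  set (f' := fun kj : nat * J => if (fst kj <=? K)%nat then f (e (fst kj) (snd kj)) else 0).
  assert (Hf' : is_sum f' s).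
  { apply (is_sum_inj f' s (fun i => (cl i, pr i))).
    - intros i i' H. inversion H. rewrite <- (He i), <- (He i'). congruence.
    - intros [k j] H. unfold f' in H. simpl in H. destruct (Nat.leb_spec k K); [|easy].
      exists (e k j). destruct (Hk k j H0). congruence.
    - revert Hf. apply is_sum_ext. intros i. unfold f'. simpl.
      rewrite He, (proj2 (Nat.leb_le _ _) (Hcl i)). easy. }
  destruct (is_sum_fubini f' s Hf') as [g [H1 H2]]. exists g. split.
  - intros k Hkk. generalize (H1 k). apply is_sum_ext. intros j. unfold f'. simpl.
    now rewrite (proj2 (Nat.leb_le _ _) Hkk).
  - apply is_sum_finite; [easy|]. intros k Hkk. apply (is_sum_unique (fun j => f' (k, j))); [easy|].
    apply is_sum_ext with (fun _ => 0); [|apply is_sum_zero].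
    intros j. unfold f'. simpl. destruct (Nat.leb_spec k K); [lia|easy].
Qed.

Lemma is_sum_single {I} (i0 : I) (f : I -> R) : (forall i, i <> i0 -> f i = 0) ->
  is_sum f (f i0).
Proof.
  intros H. apply (is_sum_inj f (f i0) (fun _ : unit => i0)).
  - now intros [] [].
  - intros i Hi. exists tt. symmetry. apply NNPP. intros Hc. now apply Hi, H.
  - set (v := f i0). clear.
    assert (Hp : forall v, 0 <= v -> is_sum (fun _ : unit => v) v).
    { intros v0 Hv. apply psum_is_sum. split; [easy|]. split.
      - intros l Hl. destruct l as [|[] [|[] l]]; simpl; try lra.
        inversion Hl. exfalso. apply H1. now left.
      - intros B HB. specialize (HB [tt]). simpl in HB.
        assert (v0 + 0 <= B); [|lra]. apply HB. repeat constructor. easy. }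
    destruct (Rle_dec 0 v); [now apply Hp|].
    replace v with (- (- v)) by lra. apply is_sum_opp, Hp. lra.
Qed.

(** * Sums over the integers and Gaussian majorants *)

Definition zrange (N : nat) : list Z := map (fun k => (Z.of_nat k - Z.of_nat N)%Z) (seq 0 (2 * N + 1)).

Lemma in_zrange N n : In n (zrange N) <-> (Z.abs n <= Z.of_nat N)%Z.
Proof.
  unfold zrange. rewrite in_map_iff. split.
  - intros [k [<- Hk]]. apply in_seq in Hk. lia.
  - intros H. exists (Z.to_nat (n + Z.of_nat N)). split; [lia|]. apply in_seq. lia.
Qed.

Lemma NoDup_zrange N : NoDup (zrange N).
Proof.
  apply FinFun.Injective_map_NoDup; [|apply seq_NoDup]. intros x y H. lia.
Qed.

Lemma incl_zrange (l : list Z) : exists N, forall N', (N <= N')%nat -> incl l (zrange N').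
Proof.
  induction l as [|n l [N IH]].
  - exists 0%nat. intros N' _ x [].
  - exists (Nat.max N (Z.to_nat (Z.abs n))). intros N' HN x [<-|Hx].
    + apply in_zrange. lia.
    + apply IH; [lia|easy].
Qed.

Lemma rsum_telescope (H : Z -> R) N :
  rsum (fun n => H (n + 1)%Z - H n) (zrange N) = H (Z.of_nat N + 1)%Z - H (- Z.of_nat N)%Z.
Proof.
  unfold zrange. rewrite rsum_map.
  assert (Hk : forall k, rsum (fun j => H (Z.of_nat j - Z.of_nat N + 1)%Z - H (Z.of_nat j - Z.of_nat N)%Z) (seq 0 k)
     = H (Z.of_nat k - Z.of_nat N)%Z - H (- Z.of_nat N)%Z).
  { induction k as [|k IH].
    - simpl. lra.
    - rewrite seq_S, rsum_app, IH. simpl rsum.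
      replace (Z.of_nat (S k) - Z.of_nat N)%Z with (Z.of_nat k - Z.of_nat N + 1)%Z by lia. lra. }
  rewrite Hk. do 2 f_equal. lia.
Qed.

Lemma is_sum_zrange f s : is_sum f s -> is_lim_seq (fun N => rsum f (zrange N)) s.
Proof.
  intros Hf. apply is_lim_seq_spec. intros eps.
  destruct (is_sum_net f s eps Hf (cond_pos eps)) as [l0 [_ H]].
  destruct (incl_zrange l0) as [N HN]. exists N. intros n Hn.
  apply H; [apply NoDup_zrange|auto].
Qed.

(** The terms are at most the increments of the function [n / (1 + |n|)], which stays in [[-1, 1]],
    so finite sums telescope to at most 2. *)
Lemma psum_inverse_square : exists B, psum (fun n => / ((Rabs (IZR n) + 1) * (Rabs (IZR n) + 2))) B.
Proof.
  set (h := fun n => IZR n / (1 + Rabs (IZR n))).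
  assert (Hd : forall n, / ((Rabs (IZR n) + 1) * (Rabs (IZR n) + 2)) <= h (n + 1)%Z - h n).
  { intros n. unfold h. rewrite plus_IZR.
    destruct (Z_lt_le_dec n 0) as [Hn|Hn].
    - assert (IZR n <= -1) by (apply (IZR_le n (-1)); lia).
      rewrite !Rabs_left1 by lra.
      apply Rle_trans with (/ ((- IZR n) * (- IZR n + 1))).
      + apply Rinv_le_contravar; nra.
      + apply Req_le. field. lra.
    - assert (0 <= IZR n) by (apply (IZR_le 0 n); lia).
      rewrite !Rabs_pos_eq by lra. apply Req_le. field. lra. }
  assert (Hp : forall n, 0 < / ((Rabs (IZR n) + 1) * (Rabs (IZR n) + 2))).
  { intros n. apply Rinv_0_lt_compat. pose proof (Rabs_pos (IZR n)). nra. }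
  apply (ex_psum _ 2); [intros n; now apply Rlt_le|].
  intros l Hl. destruct (incl_zrange l) as [N HN].
  eapply Rle_trans; [apply (rsum_incl _ l (zrange N))|]; auto using NoDup_zrange.
  - intros n. now apply Rlt_le.
  - eapply Rle_trans; [apply rsum_le, Hd|]. rewrite rsum_telescope.
    assert (Hb : forall n, Rabs (h n) <= 1).
    { intros n. unfold h, Rdiv. pose proof (Rabs_pos (IZR n)).
      rewrite Rabs_mult, (Rabs_pos_eq (/ _)) by (apply Rlt_le, Rinv_0_lt_compat; lra).
      apply (Rle_div_l _ _ (1 + Rabs (IZR n))); lra. }
    pose proof (proj1 (Rabs_le_between _ _) (Hb (Z.of_nat N + 1)%Z)).
    pose proof (proj1 (Rabs_le_between _ _) (Hb (- Z.of_nat N)%Z)). lra.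
Qed.

Lemma exp_monotone x y : x <= y -> exp x <= exp y.
Proof. intros [H| ->]; [left; now apply exp_increasing|right; easy]. Qed.

Lemma psum_gauss a b : 0 < a -> exists B, psum (fun n => exp (- a * IZR n ^ 2 + b * IZR n)) B.
Proof.
  intros Ha. destruct psum_inverse_square as [B HB].
  (* With [t = |n|], one has [(t + 1) (t + 2) <= 2 exp (2 t)], and [- a t^2 + (|b| + 2) t] has
     maximum [(|b| + 2)^2 / (4 a)]. *)
  set (C := 2 * exp ((Rabs b + 2) ^ 2 / (4 * a))).
  apply (ex_psum_le _ (fun n => C * / ((Rabs (IZR n) + 1) * (Rabs (IZR n) + 2))) (C * B)).
  - intros n. split; [apply Rlt_le, exp_pos|].
    pose proof (Rabs_pos (IZR n)) as Ht. set (t := Rabs (IZR n)) in *.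
    assert (Hpos : 0 < (t + 1) * (t + 2)) by nra.
    apply Rle_div_r; [easy|].
    apply Rle_trans with (exp (- a * t ^ 2 + Rabs b * t) * (2 * exp (2 * t))).
    + apply Rmult_le_compat; [apply Rlt_le, exp_pos|lra| |].
      * apply exp_monotone. unfold t. rewrite pow2_abs. apply Rplus_le_compat_l.
        rewrite <- Rabs_mult. apply Rle_abs.
      * replace (2 * t) with (t + t) by lra. rewrite exp_plus.
        pose proof (exp_ineq1_le t). nra.
    + unfold C. rewrite (Rmult_comm 2 (exp (2 * t))), <- Rmult_assoc, <- exp_plus, Rmult_comm.
      apply Rmult_le_compat_l; [lra|]. apply exp_monotone.
      set (c := Rabs b) in *.
      assert (0 <= (2 * a * t - (c + 2)) ^ 2 / (4 * a)).
      { apply Rmult_le_pos; [apply pow2_ge_0|]. apply Rlt_le, Rinv_0_lt_compat. lra. }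
      assert ((2 * a * t - (c + 2)) ^ 2 / (4 * a) = (c + 2) ^ 2 / (4 * a) - (- a * t ^ 2 + c * t + 2 * t)) by (field; lra).
      lra.
  - apply psum_scal; [|easy]. unfold C. pose proof (exp_pos ((Rabs b + 2) ^ 2 / (4 * a))). lra.
Qed.

(** * Continuity and termwise integration of dominated sums *)

Section Dominated.

Variables (I : Type) (f : I -> R -> R) (M : I -> R) (B : R) (F : R -> R) (a b : R).
Hypotheses (HM : psum M B) (HfM : forall i w, a < w < b -> Rabs (f i w) <= M i)
  (Hc : forall i w, a < w < b -> continuous (f i) w)
  (HF : forall w, a < w < b -> is_sum (fun i => f i w) (F w)).

Lemma continuous_rsum l w : a < w < b -> continuous (fun w => rsum (fun i => f i w) l) w.
Proof.
  intros Hw. induction l as [|i l IH]; simpl.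
  - apply continuous_const.
  - apply (continuous_plus (V := R_NormedModule)); auto.
Qed.

Lemma continuous_is_sum w0 : a < w0 < b -> continuous F w0.
Proof.
  intros Hw0. apply filterlim_locally. intros eps.
  assert (He : 0 < eps / 4) by (destruct eps; simpl; lra).
  destruct (is_sum_tail M B _ HM He) as [l [Hnd Hl0]].
  pose proof (Hl0 l Hnd (incl_refl _)) as Hl. clear Hl0.
  pose proof (continuous_rsum l w0 Hw0) as Hcl.
  apply (proj1 (filterlim_locally _ _)) with (eps := mkposreal _ He) in Hcl.
  assert (Hab : locally w0 (fun w => a < w < b)).
  { apply (open_and (fun w => a < w) (fun w => w < b)); trivial.
    apply open_gt. apply open_lt. }
  generalize (filter_and _ _ Hcl Hab). apply filter_imp. intros w [H1 H2].
  unfold ball in *; simpl in *. unfold AbsRing_ball, abs, minus, plus, opp in *; simpl in *.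
  pose proof (Hl (fun i => f i w) (F w) (fun i => HfM i w H2) (HF w H2)) as H3.
  pose proof (Hl (fun i => f i w0) (F w0) (fun i => HfM i w0 Hw0) (HF w0 Hw0)) as H4.
  apply Rabs_def2 in H1. apply Rabs_le_between in H3. apply Rabs_le_between in H4.
  apply Rabs_def1; lra.
Qed.

Lemma ex_RInt_between c d (g : R -> R) : a < c -> c <= d -> d < b ->
  (forall w, a < w < b -> continuous g w) -> ex_RInt g c d.
Proof.
  intros H1 H2 H3 Hg. apply (ex_RInt_continuous (V := R_CompleteNormedModule)).
  intros z Hz. rewrite Rmin_left, Rmax_right in Hz by easy. apply Hg. lra.
Qed.

Lemma RInt_rsum c d l : a < c -> c <= d -> d < b ->
  RInt (fun w => rsum (fun i => f i w) l) c d = rsum (fun i => RInt (f i) c d) l.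
Proof.
  intros H1 H2 H3. induction l as [|i l IH]; simpl.
  - rewrite (RInt_const (V := R_CompleteNormedModule)). apply Rmult_0_r.
  - rewrite <- IH. apply (RInt_plus (V := R_CompleteNormedModule)).
    + apply ex_RInt_between; auto.
    + apply ex_RInt_between; auto. intros w Hw. now apply continuous_rsum.
Qed.

(** The integrals are dominated by [(d - c) M], so their sum exists. One finite index set makes both
    this sum and, uniformly in [w], the integrand accurate; on it integration is additive. *)
Lemma is_sum_RInt c d : a < c -> c <= d -> d < b ->
  is_sum (fun i => RInt (f i) c d) (RInt F c d).
Proof.
  intros H1 H2 H3.
  set (N := fun i => (d - c) * M i).
  assert (HN : psum N ((d - c) * B)) by (apply psum_scal; [lra|easy]).
  assert (Hb : forall i, Rabs (RInt (f i) c d) <= N i).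
  { intros i. apply abs_RInt_le_const; [easy| |].
    - apply ex_RInt_between; auto.
    - intros t Ht. apply HfM. lra. }
  destruct (is_sum_dominated _ N _ HN Hb) as [s Hs].
  replace (RInt F c d) with s; [easy|].
  apply Rminus_diag_uniq. apply NNPP. intros Hne.
  apply Rabs_pos_lt in Hne. set (D := Rabs (s - RInt F c d)) in *.
  set (eps := D / (4 * (d - c + 1))).
  assert (He : 0 < eps) by (apply Rdiv_lt_0_compat; lra).
  assert (Hed : (d - c) * eps <= D / 4).
  { unfold eps. replace ((d - c) * (D / (4 * (d - c + 1)))) with (D / 4 - D / (4 * (d - c + 1))) by (field; lra).
    fold eps. lra. }
  destruct (is_sum_tail M B _ HM He) as [l0 [Hl0 H4]].
  destruct (is_sum_net _ s (D / 4) Hs) as [l1 [Hl1 H5]]; [lra|].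
  set (L := nodup_app l0 l1).
  assert (H6 : forall w, a < w < b -> Rabs (rsum (fun i => f i w) L - F w) <= eps).
  { intros w Hw. apply (H4 L (nodup_app_NoDup _ _) (nodup_app_l _ _) (fun i => f i w)); auto. }
  assert (H7 : Rabs (rsum (fun i => RInt (f i) c d) L - s) < D / 4).
  { apply H5; [apply nodup_app_NoDup|apply nodup_app_r]. }
  assert (H8 : Rabs (RInt (fun w => rsum (fun i => f i w) L - F w) c d) <= (d - c) * eps).
  { apply abs_RInt_le_const; [easy| |].
    - apply (ex_RInt_between c d (fun w => rsum (fun i => f i w) L - F w)); auto.
      intros w Hw. apply (continuous_minus (V := R_NormedModule)).
      + now apply continuous_rsum.
      + now apply continuous_is_sum.
    - intros t Ht. apply H6. lra. }
  replace (RInt (fun w => rsum (fun i => f i w) L - F w) c d)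
    with (rsum (fun i => RInt (f i) c d) L - RInt F c d) in H8.
  - apply Rabs_def2 in H7. apply Rabs_le_between in H8.
    assert (D < D); [|lra]. unfold D at 1. apply Rabs_def1; lra.
  - rewrite <- RInt_rsum by easy. symmetry.
    apply (RInt_minus (V := R_CompleteNormedModule)); apply ex_RInt_between; auto.
    + intros w Hw. now apply continuous_rsum.
    + intros w Hw. now apply continuous_is_sum.
Qed.

End Dominated.

(** * The Gaussian integral and its Fourier transform *)

Ltac eqR := lazymatch goal with |- ?a = ?b => change (@eq R a b) end.

Ltac elem_continuous :=
  apply (ex_derive_continuous (V := R_NormedModule)); auto_derive; trivial.

Ltac elem_RInt :=
  apply (ex_RInt_continuous (V := R_CompleteNormedModule)); intros;
  unfold scal, mult; simpl; unfold mult; simpl; elem_continuous.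

Lemma continuity_2d_comp (f : R -> R) (g : R -> R -> R) x y :
  continuous f (g x y) -> continuity_2d_pt g x y -> continuity_2d_pt (fun u v => f (g u v)) x y.
Proof.
  intros Hf Hg. apply continuity_1d_2d_pt_comp; [|easy]. now apply continuity_pt_filterlim.
Qed.

Ltac elem_continuity_2d :=
  repeat first
    [ apply continuity_2d_pt_id1 | apply continuity_2d_pt_id2 | apply continuity_2d_pt_const
    | apply continuity_2d_pt_plus | apply continuity_2d_pt_minus | apply continuity_2d_pt_mult
    | apply continuity_2d_pt_opp
    | apply (continuity_2d_comp exp); [elem_continuous|]
    | apply (continuity_2d_comp cos); [elem_continuous|]
    | apply (continuity_2d_comp sin); [elem_continuous|] ].

Lemma RInt_Rmult c f a b : ex_RInt f a b -> RInt (fun t => c * f t) a b = c * RInt f a b.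
Proof. apply (RInt_scal (V := R_CompleteNormedModule)). Qed.

Lemma RInt_Rlin f u v a b : ex_RInt f (u * a + v) (u * b + v) ->
  RInt (fun t => u * f (u * t + v)) a b = RInt f (u * a + v) (u * b + v).
Proof. apply (RInt_comp_lin (V := R_CompleteNormedModule)). Qed.

Lemma RInt_Rminus f g a b : ex_RInt f a b -> ex_RInt g a b ->
  RInt (fun t => f t - g t) a b = RInt f a b - RInt g a b.
Proof. apply (RInt_minus (V := R_CompleteNormedModule)). Qed.

Lemma is_derive_continuity_pt f x l : is_derive f x l -> continuity_pt f x.
Proof.
  intros H. apply derivable_continuous_pt. exists l. now apply is_derive_Reals.
Qed.

Lemma is_derive_E x : is_derive E x (2 * exp (- PI * x ^ 2)).
Proof.
  unfold E. apply (is_derive_scal (fun x => RInt _ 0 x)).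
  apply (is_derive_RInt (V := R_NormedModule) (fun w => exp (- PI * w ^ 2))) with (a := 0).
  - apply filter_forall. intros b. apply (RInt_correct (V := R_CompleteNormedModule)). elem_RInt.
  - elem_continuous.
Qed.

Lemma E_0 : E 0 = 0.
Proof. unfold E. rewrite RInt_point. unfold zero; simpl. lra. Qed.

Lemma RInt_gauss k a b : 0 < k ->
  RInt (fun s => exp (- PI * s ^ 2 / k ^ 2)) a b = k * (E (b / k) - E (a / k)) / 2.
Proof.
  intros Hk. apply is_RInt_unique.
  replace (k * (E (b / k) - E (a / k)) / 2)
    with (minus (k / 2 * E (b / k)) (k / 2 * E (a / k))) by (unfold minus, plus, opp; simpl; field).
  apply (is_RInt_derive (V := R_CompleteNormedModule) (fun s => k / 2 * E (s / k))).
  - intros x _.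
    replace (exp _) with (k / 2 * (/ k * (2 * exp (- PI * (x / k) ^ 2)))).
    + apply (is_derive_scal (fun s => E (s / k))).
      apply (is_derive_comp E (fun s => s / k)); [apply is_derive_E|].
      auto_derive; [easy|]. cbn [pow] in *. eqR. field. lra.
    + replace (- PI * (x / k) ^ 2) with (- PI * x ^ 2 / k ^ 2) by (field; lra). field. lra.
  - intros x _. elem_continuous.
Qed.

Lemma E_opp x : E (- x) = - E x.
Proof.
  assert (H : forall t, is_derive (fun t => E (- t) + E t) t 0).
  { intros t.
    replace 0 with ((-1) * (2 * exp (- PI * (- t) ^ 2)) + 2 * exp (- PI * t ^ 2)).
    - apply (is_derive_plus (V := R_NormedModule) (fun t => E (- t)) E); [|apply is_derive_E].
      apply (is_derive_comp E (fun s => - s)); [apply is_derive_E|]. auto_derive; [easy|]. cbn [pow] in *. eqR. ring.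
    - replace ((- t) ^ 2) with (t ^ 2) by ring. ring. }
  destruct (MVT_gen (fun t => E (- t) + E t) 0 x (fun _ => 0)) as [c [_ Hc]].
  - auto.
  - intros t _. eapply is_derive_continuity_pt, H.
  - rewrite Ropp_0, E_0 in Hc. lra.
Qed.

Lemma E_nondecreasing x y : x <= y -> E x <= E y.
Proof.
  intros Hxy. destruct (MVT_gen E x y (fun t => 2 * exp (- PI * t ^ 2))) as [c [_ Hc]].
  - intros t _. apply is_derive_E.
  - intros t _. eapply is_derive_continuity_pt, is_derive_E.
  - pose proof (exp_pos (- PI * c ^ 2)). nra.
Qed.

(* The derivatives in [x] of the two terms cancel, and at [x = 0] the integral is [atan 1]. *)
Lemma E_square x :
  E x ^ 2 + 4 / PI * RInt (fun t => exp (- PI * x ^ 2 * (1 + t ^ 2)) / (1 + t ^ 2)) 0 1 = 1.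
Proof.
  pose proof PI_RGT_0 as HPI.
  set (H := fun x => RInt (fun t => exp (- PI * x ^ 2 * (1 + t ^ 2)) / (1 + t ^ 2)) 0 1).
  assert (Ht : forall t : R, 0 < 1 + t ^ 2) by (intros t; pose proof (pow2_ge_0 t); lra).
  assert (Hd : forall x t, is_derive (fun x => exp (- PI * x ^ 2 * (1 + t ^ 2)) / (1 + t ^ 2)) x
                 (- 2 * PI * x * exp (- PI * x ^ 2 * (1 + t ^ 2)))).
  { intros z t. specialize (Ht t). auto_derive; [lra|]. cbn [pow] in *. eqR. field. lra. }
  assert (HH : forall x, is_derive H x (- PI * exp (- PI * x ^ 2) * E x)).
  { intros z.
    replace (- PI * exp (- PI * z ^ 2) * E z)
      with (RInt (fun t => Derive (fun u => exp (- PI * u ^ 2 * (1 + t ^ 2)) / (1 + t ^ 2)) z) 0 1).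
    - apply (is_derive_RInt_param (fun x t => exp (- PI * x ^ 2 * (1 + t ^ 2)) / (1 + t ^ 2))).
      + apply filter_forall. intros w t _. eexists. apply Hd.
      + intros t _.
        apply continuity_2d_pt_ext with (fun u v => - 2 * PI * u * exp (- PI * (u * u) * (1 + v * v))).
        * intros u v. symmetry. apply is_derive_unique.
          replace (u * u) with (u ^ 2) by ring. replace (v * v) with (v ^ 2) by ring. apply Hd.
        * elem_continuity_2d.
      + apply filter_forall. intros w. apply (ex_RInt_continuous (V := R_CompleteNormedModule)).
        intros t _. specialize (Ht t).
        apply (ex_derive_continuous (V := R_NormedModule)). auto_derive. lra.
    - rewrite (RInt_ext _ (fun t => (- 2 * PI * exp (- PI * z ^ 2)) * (z * exp (- PI * (z * t + 0) ^ 2)))).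
      + rewrite RInt_Rmult by elem_RInt.
        rewrite (RInt_Rlin (fun s => exp (- PI * s ^ 2))) by elem_RInt.
        unfold E. rewrite Rmult_0_r, Rmult_1_r, !Rplus_0_r. eqR. ring.
      + intros t _. etransitivity; [apply is_derive_unique, Hd|]. eqR.
        transitivity (- 2 * PI * z * (exp (- PI * z ^ 2) * exp (- PI * (z * t + 0) ^ 2))); [|ring].
        rewrite <- exp_plus. f_equal. f_equal. ring. }
  set (G := fun x => E x ^ 2 + 4 / PI * H x).
  assert (HG : forall x, is_derive G x 0).
  { intros z. replace 0 with (2 * E z * (2 * exp (- PI * z ^ 2)) + 4 / PI * (- PI * exp (- PI * z ^ 2) * E z)).
    - apply (is_derive_plus (V := R_NormedModule) (fun x => E x ^ 2) (fun x => 4 / PI * H x)).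
      + replace (2 * E z * (2 * exp (- PI * z ^ 2))) with (INR 2 * (2 * exp (- PI * z ^ 2)) * E z ^ (pred 2)) by (simpl; ring).
        apply is_derive_pow. apply is_derive_E.
      + apply (is_derive_scal H). apply HH.
    - field. lra. }
  assert (HG0 : G 0 = 1).
  { unfold G, H. rewrite E_0.
    rewrite (RInt_ext _ (fun t => / (1 + t ^ 2))).
    - replace (RInt _ 0 1) with (PI / 4).
      + field. lra.
      + symmetry. apply is_RInt_unique. rewrite <- atan_1.
        replace (atan 1) with (minus (atan 1) (atan 0)) by (unfold minus, plus, opp; simpl; rewrite atan_0; ring).
        apply (is_RInt_derive (V := R_CompleteNormedModule) atan).
        * intros t _. specialize (Ht t). auto_derive; [easy|]. cbn [pow] in *. eqR. field. lra.
        * intros t _. specialize (Ht t). apply (ex_derive_continuous (V := R_NormedModule)). auto_derive. lra.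
    - intros t _. specialize (Ht t). replace (- PI * 0 ^ 2 * (1 + t ^ 2)) with 0 by ring. rewrite exp_0. eqR. field. lra. }
  destruct (MVT_gen G 0 x (fun _ => 0)) as [c [_ Hc]].
  - auto.
  - intros t _. eapply is_derive_continuity_pt, HG.
  - change (G x = 1). lra.
Qed.

(** By [E_square], [1 - E x ^ 2] is [4 / PI] times an integral of at most
    [PI / 4 * exp (- PI * x ^ 2)], and [1 - E x <= 1 - E x ^ 2] because [0 <= E x <= 1]. *)
Lemma E_tail x : 0 <= x -> 0 <= 1 - E x <= exp (- PI * x ^ 2).
Proof.
  intros Hx. pose proof PI_RGT_0 as HPI. pose proof (E_square x) as H.
  assert (H0 : 0 <= E x) by (rewrite <- E_0; now apply E_nondecreasing).
  assert (Ht : forall t : R, 0 < 1 + t ^ 2) by (intros t; pose proof (pow2_ge_0 t); lra).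
  assert (Hex : forall c, ex_RInt (fun t => c * / (1 + t ^ 2)) 0 1).
  { intros c. apply (ex_RInt_continuous (V := R_CompleteNormedModule)).
    intros t _. specialize (Ht t). apply (ex_derive_continuous (V := R_NormedModule)). auto_derive. lra. }
  assert (Hex2 : ex_RInt (fun t => exp (- PI * x ^ 2 * (1 + t ^ 2)) / (1 + t ^ 2)) 0 1).
  { apply (ex_RInt_continuous (V := R_CompleteNormedModule)).
    intros t _. specialize (Ht t). apply (ex_derive_continuous (V := R_NormedModule)). auto_derive. lra. }
  set (I := RInt _ 0 1) in H.
  assert (HI0 : 0 <= I).
  { apply RInt_ge_0; [lra|easy|]. intros t _. specialize (Ht t).
    apply Rlt_le, Rdiv_lt_0_compat; [apply exp_pos|easy]. }
  assert (HI1 : I <= PI / 4 * exp (- PI * x ^ 2)).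
  { apply Rle_trans with (RInt (fun t => exp (- PI * x ^ 2) * / (1 + t ^ 2)) 0 1).
    - apply RInt_le; [lra|easy|apply Hex|]. intros t _. specialize (Ht t).
      apply Rmult_le_compat_r; [now apply Rlt_le, Rinv_0_lt_compat|].
      apply exp_monotone. pose proof (pow2_ge_0 x). pose proof (pow2_ge_0 t).
      assert (0 <= PI * (x ^ 2 * t ^ 2)) by (apply Rmult_le_pos; [lra|now apply Rmult_le_pos]). lra.
    - apply Req_le. apply is_RInt_unique.
      replace (PI / 4 * exp (- PI * x ^ 2)) with (scal (exp (- PI * x ^ 2)) (minus (atan 1) (atan 0))).
      + apply (is_RInt_scal (V := R_NormedModule)).
        apply (is_RInt_derive (V := R_CompleteNormedModule) atan).
        * intros t _. specialize (Ht t). auto_derive; [easy|]. cbn [pow] in *. eqR. field. lra.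
        * intros t _. specialize (Ht t). apply (ex_derive_continuous (V := R_NormedModule)). auto_derive. lra.
      + unfold scal, minus, plus, opp; simpl; unfold mult; simpl. eqR. rewrite atan_0, atan_1. field. }
  assert (E x ^ 2 <= 1).
  { assert (0 <= 4 / PI * I); [|lra]. apply Rmult_le_pos; [|easy]. apply Rlt_le, Rdiv_lt_0_compat; lra. }
  assert (E x <= 1) by nra.
  split; [lra|].
  assert (4 / PI * I <= exp (- PI * x ^ 2)).
  { replace (exp (- PI * x ^ 2)) with (4 / PI * (PI / 4 * exp (- PI * x ^ 2))) by (field; lra).
    apply Rmult_le_compat_l; [|easy]. apply Rlt_le, Rdiv_lt_0_compat; lra. }
  nra.
Qed.

Lemma is_lim_seq_gauss c d : 0 < c -> is_lim_seq (fun N => exp (- c * (INR N + d) ^ 2)) 0.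
Proof.
  (* From [c y^2 >= y - 1 / (4 c)] with [y = N + d]: the Gaussian lies below the geometric sequence
     [K * exp (-1) ^ N]. *)
  intros Hc. set (K := exp (1 / (4 * c) - d)).
  assert (Hn : forall N, exp (- INR N) = exp (-1) ^ N).
  { induction N as [|N IH]; [simpl; rewrite Ropp_0; apply exp_0|].
    rewrite S_INR. simpl. rewrite <- IH, <- exp_plus. f_equal. ring. }
  apply (is_lim_seq_le_le (fun _ => 0) _ (fun N => K * exp (-1) ^ N)).
  - intros N. split; [apply Rlt_le, exp_pos|].
    rewrite <- Hn. unfold K. rewrite <- exp_plus. apply exp_monotone.
    assert (0 <= (2 * c * (INR N + d) - 1) ^ 2 / (4 * c)).
    { apply Rmult_le_pos; [apply pow2_ge_0|]. apply Rlt_le, Rinv_0_lt_compat. lra. }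
    assert ((2 * c * (INR N + d) - 1) ^ 2 / (4 * c) = c * (INR N + d) ^ 2 - (INR N + d) + 1 / (4 * c)) by (field; lra).
    lra.
  - apply is_lim_seq_const.
  - replace (Finite 0) with (Rbar_mult K 0) by (simpl; f_equal; ring).
    apply (is_lim_seq_scal_l (fun N => exp (-1) ^ N) K 0). apply is_lim_seq_geom.
    rewrite Rabs_pos_eq by (apply Rlt_le, exp_pos). rewrite <- exp_0. apply exp_increasing. lra.
Qed.

(** * The Fourier integral of the Gaussian over growing intervals *)

Section GaussFourier.

Variables (k th : R).
Hypothesis Hk : 0 < k.

Let J A B t := RInt (fun s => exp (- PI * s ^ 2 / k ^ 2) * cos (2 * PI * t * s + th)) A B.
Let bd s t := k ^ 2 * exp (- PI * s ^ 2 / k ^ 2) * sin (2 * PI * t * s + th).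

(** Differentiation under the integral followed by integration by parts: up to the boundary values
    [bd], the truncated transform [J] satisfies the equation [J' = - 2 PI k^2 t J] of a Gaussian. *)
Lemma is_derive_gauss_fourier A B t : is_derive (J A B) t (bd B t - bd A t - 2 * PI * k ^ 2 * t * J A B t).
Proof.
  assert (Hd : forall s t, is_derive (fun t => exp (- PI * s ^ 2 / k ^ 2) * cos (2 * PI * t * s + th)) t
              (exp (- PI * s ^ 2 / k ^ 2) * (- (2 * PI * s) * sin (2 * PI * t * s + th)))).
  { intros s u. auto_derive; [easy|]. cbn [pow] in *. eqR. ring. }
  replace (bd B t - bd A t - 2 * PI * k ^ 2 * t * J A B t)
    with (RInt (fun s => Derive (fun u => exp (- PI * s ^ 2 / k ^ 2) * cos (2 * PI * u * s + th)) t) A B).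
  - apply (is_derive_RInt_param (fun t s => exp (- PI * s ^ 2 / k ^ 2) * cos (2 * PI * t * s + th))).
    + apply filter_forall. intros w s _. eexists. apply Hd.
    + intros s _.
      apply continuity_2d_pt_ext with (fun u v => exp (- PI * (v * v) * / k ^ 2) * (- (2 * PI * v) * sin (2 * PI * u * v + th))).
      * intros u v. symmetry. apply is_derive_unique. replace (v * v) with (v ^ 2) by ring. apply Hd.
      * elem_continuity_2d.
    + apply filter_forall. intros w. elem_RInt.
  - rewrite (RInt_ext _ (fun s => (exp (- PI * s ^ 2 / k ^ 2) * (- (2 * PI * s) * sin (2 * PI * t * s + th))
        + 2 * PI * k ^ 2 * t * (exp (- PI * s ^ 2 / k ^ 2) * cos (2 * PI * t * s + th)))
       - (2 * PI * k ^ 2 * t) * (exp (- PI * s ^ 2 / k ^ 2) * cos (2 * PI * t * s + th)))).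
    + rewrite RInt_Rminus, RInt_Rmult by elem_RInt.
      f_equal. apply is_RInt_unique.
      apply (is_RInt_derive (V := R_CompleteNormedModule) (fun s => bd s t)).
      * intros s _. unfold bd. auto_derive; [easy|]. cbn [pow]. unfold Rdiv. field. lra.
      * intros s _. elem_continuous.
    + intros s _. etransitivity; [apply is_derive_unique, Hd|]. eqR. ring.
Qed.

(** The integrating factor [exp (PI k^2 t^2)] leaves only boundary terms in the derivative. The mean
    value theorem evaluates it at some [c] with [c^2 <= t^2], so multiplying back by
    [exp (- PI k^2 t^2)] leaves a factor of at most 1. The value at [t = 0] is a difference of [E],
    controlled by [E_tail]. *)
Lemma gauss_fourier_bound A B t : A <= 0 <= B ->
  Rabs (J A B t - k * exp (- PI * k ^ 2 * t ^ 2) * cos th)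
    <= (Rabs t * k ^ 2 + k) * (exp (- PI * A ^ 2 / k ^ 2) + exp (- PI * B ^ 2 / k ^ 2)).
Proof.
  intros HAB. pose proof PI_RGT_0 as HPI.
  set (b := exp (- PI * A ^ 2 / k ^ 2) + exp (- PI * B ^ 2 / k ^ 2)).
  assert (Hb0 : 0 < b) by (apply Rplus_lt_0_compat; apply exp_pos).
  assert (Hbd : forall c, Rabs (bd B c - bd A c) <= k ^ 2 * b).
  { intros c. unfold bd, b.
    pose proof (SIN_bound (2 * PI * c * B + th)). pose proof (SIN_bound (2 * PI * c * A + th)).
    pose proof (exp_pos (- PI * A ^ 2 / k ^ 2)). pose proof (exp_pos (- PI * B ^ 2 / k ^ 2)).
    assert (0 < k ^ 2) by now apply pow_lt.
    set (ea := exp (- PI * A ^ 2 / k ^ 2)) in *. set (eb := exp (- PI * B ^ 2 / k ^ 2)) in *.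
    set (sb := sin (2 * PI * c * B + th)) in *. set (sa := sin (2 * PI * c * A + th)) in *.
    rewrite !Rmult_assoc, <- Rmult_minus_distr_l, Rabs_mult, (Rabs_pos_eq (k ^ 2)) by lra.
    apply Rmult_le_compat_l; [lra|]. apply Rabs_le. nra. }
  set (P := fun t => exp (PI * k ^ 2 * t ^ 2) * J A B t).
  assert (HP : forall t, is_derive P t (exp (PI * k ^ 2 * t ^ 2) * (bd B t - bd A t))).
  { intros u.
    replace (exp (PI * k ^ 2 * u ^ 2) * (bd B u - bd A u)) with
      (plus (mult (2 * PI * k ^ 2 * u * exp (PI * k ^ 2 * u ^ 2)) (J A B u))
       (mult (exp (PI * k ^ 2 * u ^ 2)) (bd B u - bd A u - 2 * PI * k ^ 2 * u * J A B u))).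
    - apply (is_derive_mult (fun t => exp (PI * k ^ 2 * t ^ 2)) (J A B)).
      + auto_derive; [easy|]. cbn [pow] in *. eqR. ring.
      + apply is_derive_gauss_fourier.
      + intros; apply Rmult_comm.
    - unfold plus, mult; simpl. ring. }
  destruct (MVT_gen P 0 t (fun u => exp (PI * k ^ 2 * u ^ 2) * (bd B u - bd A u))) as [c [Hc1 Hc]].
  { auto. }
  { intros u _. eapply is_derive_continuity_pt, HP. }
  assert (Hct : c ^ 2 <= t ^ 2).
  { unfold Rmin, Rmax in Hc1. destruct (Rle_dec 0 t); nra. }
  assert (HJ0 : P 0 = cos th * (k * (E (B / k) - E (A / k)) / 2)).
  { unfold P, J. rewrite <- RInt_gauss by easy.
    replace (PI * k ^ 2 * 0 ^ 2) with 0 by ring. rewrite exp_0, Rmult_1_l.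
    rewrite (RInt_ext _ (fun s => cos th * exp (- PI * s ^ 2 / k ^ 2))).
    - apply RInt_Rmult. elem_RInt.
    - intros s _. replace (2 * PI * 0 * s + th) with th by ring. apply Rmult_comm. }
  assert (HE : Rabs ((E (B / k) - E (A / k)) / 2 - 1) <= b).
  { destruct (E_tail (B / k)) as [H1 H2]; [apply Rdiv_le_0_compat; lra|].
    destruct (E_tail (- (A / k))) as [H3 H4].
    { unfold Rdiv. rewrite <- Ropp_mult_distr_l_reverse. apply Rdiv_le_0_compat; lra. }
    rewrite E_opp in H3, H4.
    replace (- PI * (B / k) ^ 2) with (- PI * B ^ 2 / k ^ 2) in H2 by (field; lra).
    replace (- PI * (- (A / k)) ^ 2) with (- PI * A ^ 2 / k ^ 2) in H4 by (field; lra).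
    unfold b. apply Rabs_le. lra. }
  assert (HPt : J A B t = exp (- PI * k ^ 2 * t ^ 2) * P t).
  { unfold P. rewrite <- Rmult_assoc, <- exp_plus.
    replace (- PI * k ^ 2 * t ^ 2 + PI * k ^ 2 * t ^ 2) with 0 by ring. rewrite exp_0. symmetry. apply Rmult_1_l. }
  set (e := exp (- PI * k ^ 2 * t ^ 2)) in *.
  assert (He : 0 < e <= 1).
  { split; [apply exp_pos|]. unfold e. rewrite <- exp_0. apply exp_monotone.
    assert (0 <= PI * (k ^ 2 * t ^ 2)); [|lra]. apply Rmult_le_pos; [lra|].
    apply Rmult_le_pos; apply pow2_ge_0. }
  replace (J A B t - k * e * cos th) with (e * (P t - P 0) + e * (k * (cos th * ((E (B / k) - E (A / k)) / 2 - 1)))).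
  2:{ rewrite HPt, HJ0. field. }
  eapply Rle_trans; [apply Rabs_triang|]. rewrite Rmult_plus_distr_r. apply Rplus_le_compat.
  - rewrite Hc, <- !Rmult_assoc. unfold e. rewrite <- exp_plus, !Rabs_mult, Rminus_0_r.
    rewrite (Rmult_comm _ (Rabs t)), (Rmult_assoc (Rabs t)).
    apply Rmult_le_compat_l; [apply Rabs_pos|].
    rewrite <- (Rmult_1_l (k ^ 2 * b)). apply Rmult_le_compat; try apply Rabs_pos; [|apply Hbd].
    rewrite Rabs_pos_eq by apply Rlt_le, exp_pos. rewrite <- exp_0. apply exp_monotone.
    assert (0 < PI * k ^ 2) by (apply Rmult_lt_0_compat; [easy|now apply pow_lt]). nra.
  - rewrite !Rabs_mult, (Rabs_pos_eq e), (Rabs_pos_eq k) by lra.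
    assert (Hcos : Rabs (cos th) <= 1) by (apply Rabs_le; apply COS_bound).
    apply Rle_trans with (1 * (k * (1 * b))); [|lra].
    apply Rmult_le_compat; try lra.
    + apply Rmult_le_pos; [lra|]. apply Rmult_le_pos; apply Rabs_pos.
    + apply Rmult_le_compat_l; [lra|]. apply Rmult_le_compat; try easy; apply Rabs_pos.
Qed.

(** The endpoints bound the union of the unit intervals centred at [w0 + a] with [|a| <= N], which
    is how unfolding a sum of translates produces them. *)
Lemma gauss_fourier w0 t :
  is_lim_seq (fun N => RInt (fun s => exp (- PI * s ^ 2 / k ^ 2) * cos (2 * PI * t * s + th))
                (w0 - INR N - 1 / 2) (w0 + INR N + 1 / 2))
    (k * exp (- PI * k ^ 2 * t ^ 2) * cos th).
Proof.
  pose proof PI_RGT_0 as HPI.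
  apply is_lim_seq_ext_loc with (fun N => (k * exp (- PI * k ^ 2 * t ^ 2) * cos th)
     + (J (w0 - INR N - 1 / 2) (w0 + INR N + 1 / 2) t - k * exp (- PI * k ^ 2 * t ^ 2) * cos th)).
  { exists 0%nat. intros N _. unfold J. ring. }
  set (l := k * _ * _). replace (Finite l) with (Finite (l + 0)) by (f_equal; lra).
  apply is_lim_seq_plus'; [apply is_lim_seq_const|].
  apply is_lim_seq_abs_0.
  apply (is_lim_seq_le_le_loc (fun _ => 0) _
    (fun N => (Rabs t * k ^ 2 + k) * (exp (- (PI / k ^ 2) * (INR N + (1 / 2 - w0)) ^ 2)
         + exp (- (PI / k ^ 2) * (INR N + (w0 + 1 / 2)) ^ 2)))).
  - destruct (INR_unbounded (Rabs w0)) as [N0 HN0]. exists N0. intros N HN.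
    apply le_INR in HN. split; [apply Rabs_pos|].
    pose proof (Rle_abs w0). pose proof (Rle_abs (- w0)). rewrite Rabs_Ropp in H0.
    eapply Rle_trans; [apply gauss_fourier_bound; lra|]. apply Req_le. do 2 f_equal; f_equal; field; lra.
  - apply is_lim_seq_const.
  - replace (Finite 0) with (Rbar_mult (Rabs t * k ^ 2 + k) (Finite (0 + 0))) by (simpl; f_equal; ring).
    apply is_lim_seq_scal_l.
    assert (0 < PI / k ^ 2) by (apply Rdiv_lt_0_compat; [easy|now apply pow_lt]).
    apply is_lim_seq_plus'; now apply is_lim_seq_gauss.
Qed.

End GaussFourier.

(** * Fourier uniqueness and theta inversion *)

Lemma RInt_ge_const f a b c : a <= b -> ex_RInt f a b -> (forall x, a < x < b -> c <= f x) ->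
  c * (b - a) <= RInt f a b.
Proof.
  intros Hab Hf Hc.
  replace (c * (b - a)) with (RInt (fun _ => c) a b).
  - apply RInt_le; auto. apply (ex_RInt_const (V := R_NormedModule)).
  - rewrite (RInt_const (V := R_CompleteNormedModule)). apply Rmult_comm.
Qed.

Lemma cos_PI_abs w : cos (PI * Rabs w) = cos (PI * w).
Proof.
  unfold Rabs. destruct (Rcase_abs w); [|easy].
  rewrite Ropp_mult_distr_r_reverse. apply cos_neg.
Qed.

Section FourierZero.

Variables (g : R -> R) (B : R).
Hypotheses (Hg : forall w, -1 < w < 1 -> continuous g w)
  (HB : forall w, -1 < w < 1 -> Rabs (g w) <= B)
  (H0 : forall (n : Z) th, RInt (fun w => g w * cos (2 * PI * IZR n * w + th)) (-1 / 2) (1 / 2) = 0).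

Lemma continuous_mult_elem (u : R -> R) w : -1 < w < 1 -> ex_derive u w -> continuous (fun w => g w * u w) w.
Proof.
  intros Hw Hu. apply (continuous_mult (K := R_AbsRing)); [now apply Hg|].
  now apply (ex_derive_continuous (V := R_NormedModule)).
Qed.

Lemma ex_RInt_mult_elem (u : R -> R) a b : -1 < a -> a <= b -> b < 1 ->
  (forall w, ex_derive u w) -> ex_RInt (fun w => g w * u w) a b.
Proof.
  intros H1 H2 H3 Hu. apply (ex_RInt_continuous (V := R_CompleteNormedModule)).
  intros w Hw. rewrite Rmin_left, Rmax_right in Hw by easy. apply continuous_mult_elem; [lra|easy].
Qed.

(** By [cos^2 (PI w) = (1 + cos (2 PI w)) / 2], one more factor mixes the frequency [n] with [n + 1]
    and [n - 1] only, with weights 1/2, 1/4, 1/4. *)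
Lemma cos_power_zero N (n : Z) th :
  RInt (fun w => g w * ((cos (PI * w) ^ 2) ^ N * cos (2 * PI * IZR n * w + th))) (-1 / 2) (1 / 2) = 0.
Proof.
  revert n th. induction N as [|N IH]; intros n th.
  - rewrite <- (H0 n th). apply RInt_ext. intros w _. eqR. simpl. ring.
  - rewrite (RInt_ext _ (fun w => (/ 2 * (g w * ((cos (PI * w) ^ 2) ^ N * cos (2 * PI * IZR n * w + th)))
       - (- / 4) * (g w * ((cos (PI * w) ^ 2) ^ N * cos (2 * PI * IZR (n + 1) * w + th))))
       - (- / 4) * (g w * ((cos (PI * w) ^ 2) ^ N * cos (2 * PI * IZR (n - 1) * w + th))))).
    + assert (Hex : forall n c, ex_RInt (fun w => c * (g w * ((cos (PI * w) ^ 2) ^ N * cos (2 * PI * IZR n * w + th)))) (-1 / 2) (1 / 2)).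
      { intros n' c. apply (ex_RInt_scal (V := R_CompleteNormedModule)).
        apply ex_RInt_mult_elem; try lra. intros w. auto_derive. easy. }
      assert (Hex1 : forall n, ex_RInt (fun w => (g w * ((cos (PI * w) ^ 2) ^ N * cos (2 * PI * IZR n * w + th)))) (-1 / 2) (1 / 2)).
      { intros n'. apply ex_RInt_mult_elem; try lra. intros w. auto_derive. easy. }
      rewrite RInt_Rminus, RInt_Rminus, !RInt_Rmult, !IH; auto; [eqR; ring|].
      apply (ex_RInt_minus (V := R_CompleteNormedModule)); auto.
    + intros w _. eqR. rewrite plus_IZR, minus_IZR.
      replace (2 * PI * (IZR n + 1) * w + th) with ((2 * PI * IZR n * w + th) + 2 * (PI * w)) by ring.
      replace (2 * PI * (IZR n - 1) * w + th) with ((2 * PI * IZR n * w + th) - 2 * (PI * w)) by ring.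
      generalize (2 * PI * IZR n * w + th). intros b. rewrite cos_plus, cos_minus, cos_2a_cos. rewrite <- tech_pow_Rmult.
      generalize ((cos (PI * w) ^ 2) ^ N). intros q. field.
Qed.

(* The kernel [cos (pi w) ^ (2 N)] concentrates at [0] but integrates to zero against [g]. *)
Lemma fourier_zero_pos : ~ 0 < g 0.
Proof.
  intros Hpos. pose proof PI_RGT_0 as HPI.
  assert (Hd : exists d, 0 < d < 1 / 2 /\ forall w, Rabs w <= d -> g 0 / 2 <= g w).
  { assert (Hc : continuous g 0) by (apply Hg; lra).
    assert (He : 0 < g 0 / 2) by lra.
    destruct (proj1 (filterlim_locally _ _) Hc (mkposreal _ He)) as [d Hd].
    assert (Hd2 : 0 < Rmin (d / 2) (1 / 4)) by (apply Rmin_pos; [pose proof (cond_pos d); lra|lra]).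
    exists (Rmin (d / 2) (1 / 4)). pose proof (Rmin_l (d / 2) (1 / 4)). pose proof (Rmin_r (d / 2) (1 / 4)).
    split; [lra|]. intros w Hw.
    assert (Hb : ball 0 d w).
    { unfold ball; simpl. unfold AbsRing_ball, abs, minus, plus, opp; simpl.
      rewrite Ropp_0, Rplus_0_r. pose proof (cond_pos d). lra. }
    specialize (Hd w Hb). unfold ball in Hd; simpl in Hd.
    unfold AbsRing_ball, abs, minus, plus, opp in Hd; simpl in Hd. apply Rabs_def2 in Hd. lra. }
  destruct Hd as [d [Hd1 Hd2]].
  set (r1 := cos (PI * d) ^ 2). set (r2 := cos (PI * (d / 2)) ^ 2).
  assert (Hc1 : 0 < cos (PI * d)) by (apply cos_gt_0; nra).
  assert (Hc12 : cos (PI * d) < cos (PI * (d / 2))) by (apply cos_decreasing_1; nra).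
  assert (Hr1 : 0 < r1) by (unfold r1; nra).
  assert (Hr12 : r1 < r2) by (unfold r1, r2; nra).
  assert (HB0 : 0 <= B).
  { apply Rle_trans with (Rabs (g 0)); [apply Rabs_pos|apply HB; lra]. }
  set (K := fun N w => (cos (PI * w) ^ 2) ^ N).
  assert (HKpos : forall N w, 0 <= K N w) by (intros; apply pow_le, pow2_ge_0).
  assert (HK1 : forall N w, d <= Rabs w <= 1 / 2 -> K N w <= r1 ^ N).
  { intros N w Hw. apply pow_incr. split; [apply pow2_ge_0|]. rewrite <- cos_PI_abs.
    apply pow_incr. split; [apply cos_ge_0; nra|apply cos_decr_1; nra]. }
  assert (HK2 : forall N w, Rabs w <= d / 2 -> r2 ^ N <= K N w).
  { intros N w Hw. pose proof (Rabs_pos w). apply pow_incr. split; [lra|]. rewrite <- cos_PI_abs.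
    apply pow_incr. split; [lra|apply cos_decr_1; nra]. }
  assert (Hex : forall N a b, -1 < a -> a <= b -> b < 1 -> ex_RInt (fun w => g w * K N w) a b).
  { intros N a b H1 H2 H3. apply ex_RInt_mult_elem; auto. intros w. unfold K. auto_derive. easy. }
  assert (Hout : forall N w, d <= Rabs w <= 1 / 2 -> - B * r1 ^ N <= g w * K N w).
  { intros N w Hw. assert (Hgw : Rabs (g w) <= B).
    { apply HB. assert (Hw' : Rabs w < 1) by lra. apply Rabs_def2 in Hw'. lra. }
    apply Rabs_le_between in Hgw. specialize (HK1 N w Hw). specialize (HKpos N w).
    apply Rle_trans with (- B * K N w); nra. }
  (* The interval is cut at [- d], [- d / 2], [d / 2] and [d]. The middle piece contributes at least
     [d (g 0 / 2) r2^N], its two neighbours are nonnegative, and the outer pieces, of total length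
     below 1, cost at most [B r1^N]. *)
  assert (HN : forall N, d * (g 0 / 2) * r2 ^ N <= B * r1 ^ N).
  { intros N.
    assert (Hz : RInt (fun w => g w * K N w) (-1 / 2) (1 / 2) = 0).
    { rewrite <- (cos_power_zero N 0 0). apply RInt_ext. intros w _.
      unfold K. eqR. replace (2 * PI * 0 * w + 0) with 0 by ring. rewrite cos_0. ring. }
    assert (P1 : - B * r1 ^ N * (- d - -1 / 2) <= RInt (fun w => g w * K N w) (-1 / 2) (- d)).
    { apply RInt_ge_const; [lra|apply Hex; lra|]. intros w Hw. apply Hout. rewrite Rabs_left1; lra. }
    assert (P2 : 0 * (- (d / 2) - - d) <= RInt (fun w => g w * K N w) (- d) (- (d / 2))).
    { apply RInt_ge_const; [lra|apply Hex; lra|]. intros w Hw. apply Rmult_le_pos; [|easy].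
      assert (g 0 / 2 <= g w); [|lra]. apply Hd2. rewrite Rabs_left1; lra. }
    assert (P3 : g 0 / 2 * r2 ^ N * (d / 2 - - (d / 2)) <= RInt (fun w => g w * K N w) (- (d / 2)) (d / 2)).
    { apply RInt_ge_const; [lra|apply Hex; lra|]. intros w Hw.
      assert (Rabs w <= d / 2) by (apply Rabs_le; lra).
      apply Rmult_le_compat; [lra|apply pow_le; lra| |]; [apply Hd2; lra|now apply HK2]. }
    assert (P4 : 0 * (d - d / 2) <= RInt (fun w => g w * K N w) (d / 2) d).
    { apply RInt_ge_const; [lra|apply Hex; lra|]. intros w Hw. apply Rmult_le_pos; [|easy].
      assert (g 0 / 2 <= g w); [|lra]. apply Hd2. rewrite Rabs_pos_eq; lra. }
    assert (P5 : - B * r1 ^ N * (1 / 2 - d) <= RInt (fun w => g w * K N w) d (1 / 2)).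
    { apply RInt_ge_const; [lra|apply Hex; lra|]. intros w Hw. apply Hout. rewrite Rabs_pos_eq; lra. }
    rewrite <- (RInt_Chasles (V := R_CompleteNormedModule) _ (-1 / 2) (- d) (1 / 2)) in Hz by (apply Hex; lra).
    rewrite <- (RInt_Chasles (V := R_CompleteNormedModule) _ (- d) (- (d / 2)) (1 / 2)) in Hz by (apply Hex; lra).
    rewrite <- (RInt_Chasles (V := R_CompleteNormedModule) _ (- (d / 2)) (d / 2) (1 / 2)) in Hz by (apply Hex; lra).
    rewrite <- (RInt_Chasles (V := R_CompleteNormedModule) _ (d / 2) d (1 / 2)) in Hz by (apply Hex; lra).
    unfold plus in Hz; simpl in Hz.
    assert (0 <= r1 ^ N) by (apply pow_le; lra).
    assert (0 <= B * r1 ^ N) by now apply Rmult_le_pos.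
    nra. }
  assert (Hlim : is_lim_seq (fun N => (r1 / r2) ^ N) 0).
  { apply is_lim_seq_geom. rewrite Rabs_pos_eq by (apply Rdiv_le_0_compat; lra).
    apply (Rlt_div_l r1 1 r2); lra. }
  assert (Hle : d * (g 0 / 2) <= 0).
  { apply (is_lim_seq_le (fun _ => d * (g 0 / 2)) (fun N => B * (r1 / r2) ^ N) (d * (g 0 / 2)) 0).
    - intros N. unfold Rdiv at 2. rewrite Rpow_mult_distr, pow_inv, <- Rmult_assoc.
      apply (Rle_div_r _ _ (r2 ^ N)); [apply pow_lt; lra|]. apply HN.
    - apply is_lim_seq_const.
    - replace (Finite 0) with (Rbar_mult B 0) by (simpl; f_equal; ring). now apply is_lim_seq_scal_l. }
  nra.
Qed.

End FourierZero.

Lemma fourier_zero g B : (forall w, -1 < w < 1 -> continuous g w) ->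
  (forall w, -1 < w < 1 -> Rabs (g w) <= B) ->
  (forall (n : Z) th, RInt (fun w => g w * cos (2 * PI * IZR n * w + th)) (-1 / 2) (1 / 2) = 0) ->
  g 0 = 0.
Proof.
  intros Hg HB H0. destruct (Rtotal_order (g 0) 0) as [H|[H|H]]; [|easy|].
  - exfalso. apply (fourier_zero_pos (fun w => - g w) B).
    + intros w Hw. apply (continuous_opp (V := R_NormedModule)). now apply Hg.
    + intros w Hw. rewrite Rabs_Ropp. now apply HB.
    + intros n th. rewrite (RInt_ext _ (fun w => (-1) * (g w * cos (2 * PI * IZR n * w + th)))).
      * rewrite RInt_Rmult, H0; [eqR; ring|].
        apply (ex_RInt_mult_elem g Hg); try lra. intros w. auto_derive. easy.
      * intros w _. eqR. ring.
    + lra.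
  - exfalso. now apply (fourier_zero_pos g B).
Qed.

Lemma cos_period_Z x (n : Z) : cos (x + 2 * PI * IZR n) = cos x.
Proof.
  destruct (Z_le_gt_dec 0 n) as [H|H].
  - rewrite <- (cos_period x (Z.to_nat n)). rewrite INR_IZR_INZ, Z2Nat.id by easy. f_equal. ring.
  - rewrite <- (cos_period (x + 2 * PI * IZR n) (Z.to_nat (- n))).
    rewrite INR_IZR_INZ, Z2Nat.id, opp_IZR by lia. f_equal. ring.
Qed.

Lemma sin_period_Z x (n : Z) : sin (x + 2 * PI * IZR n) = sin x.
Proof.
  rewrite <- !cos_shift, <- (cos_period_Z (PI / 2 - x) (- n)), opp_IZR. f_equal. ring.
Qed.

Lemma psum_gauss_shift c x : 0 < c -> exists B, psum (fun n => exp (- c * (IZR n - x) ^ 2)) B.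
Proof.
  intros Hc. destruct (psum_gauss c (2 * c * x) Hc) as [B HB].
  exists (exp (- c * x ^ 2) * B).
  apply psum_ext with (fun n => exp (- c * x ^ 2) * exp (- c * IZR n ^ 2 + 2 * c * x * IZR n)).
  - intros n. rewrite <- exp_plus. f_equal. ring.
  - apply psum_scal; [apply Rlt_le, exp_pos|easy].
Qed.

(* Junk when [f] is not summable. *)
Definition sum_of {I} (f : I -> R) : R := epsilon (inhabits 0) (is_sum f).

Lemma sum_of_correct {I} (f : I -> R) : (exists s, is_sum f s) -> is_sum f (sum_of f).
Proof. apply epsilon_spec. Qed.

Lemma is_sum_le {I} (f M : I -> R) s B : psum M B -> (forall i, Rabs (f i) <= M i) ->
  is_sum f s -> Rabs s <= B.
Proof.
  intros [_ [HB _]] Hf Hs. apply Rnot_lt_le. intros Hlt.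
  destruct (is_sum_net f s (Rabs s - B) Hs) as [l [Hl H]]; [lra|].
  specialize (H l Hl (incl_refl _)). specialize (HB l Hl).
  pose proof (rsum_abs f M l Hf).
  pose proof (Rabs_triang_inv s (rsum f l)). rewrite Rabs_minus_sym in H1. lra.
Qed.

Lemma Rabs_mult_cos a x : 0 <= a -> Rabs (a * cos x) <= a.
Proof.
  intros Ha. rewrite Rabs_mult, (Rabs_pos_eq a) by easy. rewrite <- (Rmult_1_r a) at 2.
  apply Rmult_le_compat_l; [easy|]. apply Rabs_le, COS_bound.
Qed.

Lemma RInt_cos_period (j : Z) th :
  RInt (fun w => cos (2 * PI * IZR j * w + th)) (-1 / 2) (1 / 2) = if Z.eq_dec j 0 then cos th else 0.
Proof.
  pose proof PI_RGT_0 as HPI. destruct (Z.eq_dec j 0) as [->|Hj].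
  - rewrite (RInt_ext _ (fun _ => cos th)).
    + rewrite (RInt_const (V := R_CompleteNormedModule)). unfold scal; simpl; unfold mult; simpl.
      eqR. field.
    + intros w _. f_equal. ring.
  - apply eq_IZR_contrapositive in Hj. apply is_RInt_unique.
    replace 0 with (minus (sin (2 * PI * IZR j * (1 / 2) + th) / (2 * PI * IZR j))
                          (sin (2 * PI * IZR j * (-1 / 2) + th) / (2 * PI * IZR j))).
    + apply (is_RInt_derive (V := R_CompleteNormedModule) (fun w => sin (2 * PI * IZR j * w + th) / (2 * PI * IZR j))).
      * intros w _. auto_derive; [easy|]. eqR. field. lra.
      * intros w _. elem_continuous.
    + unfold minus, plus, opp; simpl.
      replace (2 * PI * IZR j * (1 / 2) + th) with ((2 * PI * IZR j * (-1 / 2) + th) + 2 * PI * IZR j) by field.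
      rewrite sin_period_Z. eqR. ring.
Qed.

(** * Poisson summation for a Gaussian with real argument *)

Section ThetaInversion.

Variables (k x al w0 : R).
Hypothesis Hk : 0 < k.

(** Both sides are functions of a displacement [w] from the point of interest [w0]: [fourier_zero]
    concludes only at 0, and majorants of the translated Gaussians are then needed only for
    [|w| < 1]. *)
Let trig_term (n : Z) (w : R) := k * exp (- PI * k ^ 2 * (IZR n - x) ^ 2) * cos (2 * PI * IZR n * (w0 + w) + al).
Let gauss_term (a : Z) (w : R) := exp (- PI * (w0 + w + IZR a) ^ 2 / k ^ 2) * cos (2 * PI * x * (w0 + w + IZR a) + al).
Let trig_majorant (n : Z) := k * exp (- (PI * k ^ 2) * (IZR n - x) ^ 2).
Let gauss_majorant (a : Z) := exp (PI / k ^ 2) * exp (- (PI / k ^ 2 / 2) * (IZR a - - w0) ^ 2).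

Let e n := k * exp (- PI * k ^ 2 * (IZR n - x) ^ 2).

Lemma psum_trig_majorant : exists B, psum trig_majorant B.
Proof.
  pose proof PI_RGT_0 as HPI.
  destruct (psum_gauss_shift (PI * k ^ 2) x) as [B HB].
  - apply Rmult_lt_0_compat; [easy|now apply pow_lt].
  - exists (k * B). apply psum_scal; [lra|easy].
Qed.

Lemma psum_gauss_majorant : exists B, psum gauss_majorant B.
Proof.
  pose proof PI_RGT_0 as HPI.
  destruct (psum_gauss_shift (PI / k ^ 2 / 2) (- w0)) as [B HB].
  - apply Rdiv_lt_0_compat; [|lra]. apply Rdiv_lt_0_compat; [easy|now apply pow_lt].
  - exists (exp (PI / k ^ 2) * B). apply psum_scal; [apply Rlt_le, exp_pos|easy].
Qed.

Lemma trig_term_bound n w : Rabs (trig_term n w) <= trig_majorant n.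
Proof.
  unfold trig_term, trig_majorant. eapply Rle_trans; [apply Rabs_mult_cos|].
  - apply Rmult_le_pos; [lra|apply Rlt_le, exp_pos].
  - apply Req_le. do 2 f_equal. ring.
Qed.

Lemma gauss_term_bound a w : -1 < w < 1 -> Rabs (gauss_term a w) <= gauss_majorant a.
Proof.
  intros Hw. pose proof PI_RGT_0 as HPI. unfold gauss_term, gauss_majorant.
  eapply Rle_trans; [apply Rabs_mult_cos, Rlt_le, exp_pos|].
  rewrite <- exp_plus. apply exp_monotone.
  assert (Hc : 0 < PI / k ^ 2) by (apply Rdiv_lt_0_compat; [easy|now apply pow_lt]).
  replace (- PI * (w0 + w + IZR a) ^ 2 / k ^ 2) with (- (PI / k ^ 2) * (w0 + w + IZR a) ^ 2) by (field; lra).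
  set (c := PI / k ^ 2) in *. assert (w ^ 2 <= 1) by nra.
  (* With [X = w0 + a], nonnegativity of [(X + 2 w)^2] gives [(X + w)^2 >= X^2 / 2 - w^2], whence
     the halved exponent and the factor [exp (PI / k^2)] of [gauss_majorant]. *)
  pose proof (pow2_ge_0 (w0 + IZR a + 2 * w)). nra.
Qed.

Lemma continuous_trig_term n w : continuous (trig_term n) w.
Proof. unfold trig_term. elem_continuous. Qed.

Lemma continuous_gauss_term a w : continuous (gauss_term a) w.
Proof. unfold gauss_term. elem_continuous. Qed.

Let trig_sum w := sum_of (fun n => trig_term n w).
Let gauss_sum w := sum_of (fun a => gauss_term a w).

Lemma trig_sum_correct w : is_sum (fun n => trig_term n w) (trig_sum w).
Proof.
  destruct psum_trig_majorant as [B HB]. apply sum_of_correct. eapply is_sum_dominated; [apply HB|].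
  intros n. apply trig_term_bound.
Qed.

Lemma gauss_sum_correct w : -1 < w < 1 -> is_sum (fun n => gauss_term n w) (gauss_sum w).
Proof.
  intros Hw. destruct psum_gauss_majorant as [B HB]. apply sum_of_correct. eapply is_sum_dominated; [apply HB|].
  intros n. now apply gauss_term_bound.
Qed.

Lemma is_sum_RInt_cos (f : Z -> R -> R) M B F (m : Z) th : psum M B ->
  (forall i w, -1 < w < 1 -> Rabs (f i w) <= M i) -> (forall i w, continuous (f i) w) ->
  (forall w, -1 < w < 1 -> is_sum (fun i => f i w) (F w)) ->
  is_sum (fun i => RInt (fun w => f i w * cos (2 * PI * IZR m * w + th)) (-1 / 2) (1 / 2))
     (RInt (fun w => F w * cos (2 * PI * IZR m * w + th)) (-1 / 2) (1 / 2)).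
Proof.
  intros HM Hf Hc HF.
  apply (is_sum_RInt _ (fun i w => f i w * cos (2 * PI * IZR m * w + th)) M B
     (fun w => F w * cos (2 * PI * IZR m * w + th)) (-1) 1); try lra; trivial.
  - intros i w Hw. eapply Rle_trans; [|now apply (Hf i w)].
    rewrite Rabs_mult. rewrite <- (Rmult_1_r (Rabs (f i w))) at 2.
    apply Rmult_le_compat_l; [apply Rabs_pos|]. apply Rabs_le, COS_bound.
  - intros i w Hw. apply (continuous_mult (K := R_AbsRing)); [apply Hc|]. elem_continuous.
  - intros w Hw. apply is_sum_ext with (fun i => cos (2 * PI * IZR m * w + th) * f i w); [intros; ring|].
    rewrite (Rmult_comm (F w)). apply is_sum_scal. now apply HF.
Qed.

(** Orthogonality leaves only [n = - m] and [n = m]. They are kept as two separate families [d1] and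
    [d2], each with weight 1/2, so that [m = 0] needs no special treatment. *)
Lemma fourier_coef_trig_sum (m : Z) th : RInt (fun w => trig_sum w * cos (2 * PI * IZR m * w + th)) (-1 / 2) (1 / 2)
  = / 2 * e (- m) * cos (2 * PI * IZR (- m) * w0 + al + th) + / 2 * e m * cos (2 * PI * IZR m * w0 + al - th).
Proof.
  destruct psum_trig_majorant as [B HB].
  pose proof (is_sum_RInt_cos trig_term trig_majorant B trig_sum m th HB (fun i w _ => trig_term_bound i w) continuous_trig_term
      (fun w _ => trig_sum_correct w)) as H.
  apply (is_sum_unique _ _ _ H). clear H.
  set (d1 := fun n : Z => if Z.eq_dec (n + m) 0 then / 2 * e n * cos (2 * PI * IZR n * w0 + al + th) else 0).
  set (d2 := fun n : Z => if Z.eq_dec (n - m) 0 then / 2 * e n * cos (2 * PI * IZR n * w0 + al - th) else 0).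
  apply is_sum_ext with (fun n => d1 n + d2 n).
  - intros n.
    rewrite (RInt_ext _ (fun w => (/ 2 * e n) * cos (2 * PI * IZR (n + m) * w + (2 * PI * IZR n * w0 + al + th))
      - (- (/ 2 * e n)) * cos (2 * PI * IZR (n - m) * w + (2 * PI * IZR n * w0 + al - th)))).
    + rewrite RInt_Rminus, !RInt_Rmult, !RInt_cos_period by elem_RInt.
      unfold d1, d2. eqR. destruct (Z.eq_dec (n + m) 0); destruct (Z.eq_dec (n - m) 0); ring.
    + intros w _. eqR. rewrite plus_IZR, minus_IZR. unfold trig_term. fold (e n).
      replace (2 * PI * (IZR n + IZR m) * w + (2 * PI * IZR n * w0 + al + th))
        with ((2 * PI * IZR n * (w0 + w) + al) + (2 * PI * IZR m * w + th)) by ring.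
      replace (2 * PI * (IZR n - IZR m) * w + (2 * PI * IZR n * w0 + al - th))
        with ((2 * PI * IZR n * (w0 + w) + al) - (2 * PI * IZR m * w + th)) by ring.
      rewrite (cos_plus (_ + al)), (cos_minus (_ + al)). field.
  - apply is_sum_plus.
    + replace (/ 2 * e (- m) * cos (2 * PI * IZR (- m) * w0 + al + th)) with (d1 (- m)%Z).
      * apply is_sum_single. intros n Hn. unfold d1. destruct (Z.eq_dec (n + m) 0); [lia|easy].
      * unfold d1. destruct (Z.eq_dec (- m + m) 0); [easy|lia].
    + replace (/ 2 * e m * cos (2 * PI * IZR m * w0 + al - th)) with (d2 m).
      * apply is_sum_single. intros n Hn. unfold d2. destruct (Z.eq_dec (n - m) 0); [lia|easy].
      * unfold d2. destruct (Z.eq_dec (m - m) 0); [easy|lia].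
Qed.

(** Unfolding: the test function has period 1, so integrals of translates over a unit interval join
    into one integral over a long interval. A product of cosines splits into frequencies [x + m] and
    [x - m], and [gauss_fourier] gives the limits. *)
Lemma fourier_coef_gauss_sum (m : Z) th : RInt (fun w => gauss_sum w * cos (2 * PI * IZR m * w + th)) (-1 / 2) (1 / 2)
  = / 2 * e (- m) * cos (2 * PI * IZR (- m) * w0 + al + th) + / 2 * e m * cos (2 * PI * IZR m * w0 + al - th).
Proof.
  destruct psum_gauss_majorant as [B HB].
  pose proof (is_sum_RInt_cos gauss_term gauss_majorant B gauss_sum m th HB gauss_term_bound continuous_gauss_term gauss_sum_correct) as H.
  apply is_sum_zrange in H. apply is_lim_seq_unique in H.
  enough (HL : is_lim_seq (fun N => rsum (fun i => RInt (fun w => gauss_term i w * cos (2 * PI * IZR m * w + th)) (-1 / 2) (1 / 2)) (zrange N))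
     (/ 2 * e (- m) * cos (2 * PI * IZR (- m) * w0 + al + th) + / 2 * e m * cos (2 * PI * IZR m * w0 + al - th))).
  { apply is_lim_seq_unique in HL. rewrite H in HL. now inversion HL. }
  set (psi := fun s => exp (- PI * s ^ 2 / k ^ 2) * cos (2 * PI * x * s + al) * cos (2 * PI * IZR m * (s - w0) + th)).
  assert (Hpsi : forall a b, ex_RInt psi a b) by (intros; unfold psi; elem_RInt).
  (* A primitive of [psi] sampled at the endpoints of the unit intervals; the [i]-th integral is
     [Psi (i + 1) - Psi i], which telescopes over [zrange N]. *)
  set (Psi := fun a : Z => RInt psi w0 (w0 + IZR a - 1 / 2)).
  assert (Hterm : forall i, RInt (fun w => gauss_term i w * cos (2 * PI * IZR m * w + th)) (-1 / 2) (1 / 2) = Psi (i + 1)%Z - Psi i).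
  { intros i. unfold Psi.
    rewrite <- (RInt_Chasles (V := R_CompleteNormedModule) psi w0 (w0 + IZR i - 1 / 2) (w0 + IZR (i + 1) - 1 / 2)) by easy.
    unfold plus; simpl.
    replace (RInt psi (w0 + IZR i - 1 / 2) (w0 + IZR (i + 1) - 1 / 2))
      with (RInt psi (1 * (-1 / 2) + (w0 + IZR i)) (1 * (1 / 2) + (w0 + IZR i)))
      by (rewrite plus_IZR; f_equal; eqR; field).
    rewrite <- RInt_Rlin, Rplus_minus_l by easy.
    apply RInt_ext. intros w _. eqR. unfold gauss_term, psi.
    replace (2 * PI * IZR m * (1 * w + (w0 + IZR i) - w0) + th)
      with ((2 * PI * IZR m * w + th) + 2 * PI * IZR (m * i)) by (rewrite mult_IZR; ring).
    rewrite cos_period_Z. replace (1 * w + (w0 + IZR i)) with (w0 + w + IZR i) by ring. ring. }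
  apply is_lim_seq_ext with (fun N => / 2 * RInt (fun s => exp (- PI * s ^ 2 / k ^ 2)
       * cos (2 * PI * (x + IZR m) * s + (2 * PI * IZR (- m) * w0 + al + th))) (w0 - INR N - 1 / 2) (w0 + INR N + 1 / 2)
      + / 2 * RInt (fun s => exp (- PI * s ^ 2 / k ^ 2)
       * cos (2 * PI * (x - IZR m) * s + (2 * PI * IZR m * w0 + al - th))) (w0 - INR N - 1 / 2) (w0 + INR N + 1 / 2)).
  - intros N. rewrite <- !RInt_Rmult by elem_RInt.
    replace (rsum _ (zrange N)) with (RInt psi (w0 - INR N - 1 / 2) (w0 + INR N + 1 / 2)).
    + rewrite <- (RInt_plus (V := R_CompleteNormedModule)) by elem_RInt.
      apply RInt_ext. intros s _. unfold plus; simpl. unfold psi. eqR. rewrite opp_IZR.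
      replace (2 * PI * (x + IZR m) * s + (2 * PI * - IZR m * w0 + al + th))
        with ((2 * PI * x * s + al) + (2 * PI * IZR m * (s - w0) + th)) by ring.
      replace (2 * PI * (x - IZR m) * s + (2 * PI * IZR m * w0 + al - th))
        with ((2 * PI * x * s + al) - (2 * PI * IZR m * (s - w0) + th)) by ring.
      rewrite (cos_plus (_ + al)), (cos_minus (_ + al)). cbn [pow]. generalize (exp (- PI * (s * (s * 1)) / (k * (k * 1)))). intros ex. field.
    + etransitivity; [|symmetry; etransitivity; [|apply (rsum_telescope Psi)]].
      * unfold Psi. rewrite opp_IZR, plus_IZR, <- INR_IZR_INZ.
        rewrite <- (RInt_Chasles (V := R_CompleteNormedModule) psi w0 (w0 + - INR N - 1 / 2) (w0 + (INR N + 1) - 1 / 2)) by easy.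
        unfold plus; simpl. eqR.
        replace (w0 + (INR N + 1) - 1 / 2) with (w0 + INR N + 1 / 2) by field.
        replace (w0 + - INR N - 1 / 2) with (w0 - INR N - 1 / 2) by ring. symmetry. apply Rplus_minus_l.
      * f_equal. now apply functional_extensionality.
  - rewrite !(Rmult_assoc (/ 2)).
    apply is_lim_seq_plus'.
    + replace (Finite (/ 2 * _)) with (Rbar_mult (/ 2) (e (- m) * cos (2 * PI * IZR (- m) * w0 + al + th))) by easy.
      apply is_lim_seq_scal_l.
      replace (e (- m)) with (k * exp (- PI * k ^ 2 * (x + IZR m) ^ 2)).
      * now apply gauss_fourier.
      * unfold e. do 2 f_equal. rewrite opp_IZR. ring.
    + replace (Finite (/ 2 * _)) with (Rbar_mult (/ 2) (e m * cos (2 * PI * IZR m * w0 + al - th))) by easy.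
      apply is_lim_seq_scal_l.
      replace (e m) with (k * exp (- PI * k ^ 2 * (x - IZR m) ^ 2)).
      * now apply gauss_fourier.
      * unfold e. do 2 f_equal. ring.
Qed.

Lemma theta_inversion_aux : trig_sum 0 = gauss_sum 0.
Proof.
  destruct psum_trig_majorant as [B1 HB1]. destruct psum_gauss_majorant as [B2 HB2].
  assert (H1 : forall w, -1 < w < 1 -> continuous trig_sum w).
  { apply (continuous_is_sum _ trig_term trig_majorant B1 trig_sum (-1) 1 HB1); auto using trig_term_bound, continuous_trig_term, trig_sum_correct. }
  assert (H2 : forall w, -1 < w < 1 -> continuous gauss_sum w).
  { apply (continuous_is_sum _ gauss_term gauss_majorant B2 gauss_sum (-1) 1 HB2); auto using gauss_term_bound, continuous_gauss_term, gauss_sum_correct. }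
  apply Rminus_diag_uniq.
  apply (fourier_zero (fun w => trig_sum w - gauss_sum w) (B1 + B2)).
  - intros w Hw. apply (continuous_minus (V := R_NormedModule)); auto.
  - intros w Hw. pose proof (is_sum_le _ trig_majorant _ B1 HB1 (fun n => trig_term_bound n w) (trig_sum_correct w)).
    pose proof (is_sum_le _ gauss_majorant _ B2 HB2 (fun n => gauss_term_bound n w Hw) (gauss_sum_correct w Hw)).
    eapply Rle_trans; [apply Rabs_triang|]. rewrite Rabs_Ropp. lra.
  - intros n th.
    rewrite (RInt_ext _ (fun w => trig_sum w * cos (2 * PI * IZR n * w + th) - gauss_sum w * cos (2 * PI * IZR n * w + th))).
    + rewrite RInt_Rminus.
      * rewrite fourier_coef_trig_sum, fourier_coef_gauss_sum. eqR. ring.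
      * apply (ex_RInt_mult_elem trig_sum); auto; try lra. intros w. auto_derive. easy.
      * apply (ex_RInt_mult_elem gauss_sum); auto; try lra. intros w. auto_derive. easy.
    + intros w _. eqR. ring.
Qed.

End ThetaInversion.

Lemma theta_inversion k x al w : 0 < k -> exists s,
  is_sum (fun n => k * exp (- PI * k ^ 2 * (IZR n - x) ^ 2) * cos (2 * PI * IZR n * w + al)) s /\
  is_sum (fun a => exp (- PI * (w + IZR a) ^ 2 / k ^ 2) * cos (2 * PI * x * (w + IZR a) + al)) s.
Proof.
  intros Hk. eexists. split.
  - generalize (trig_sum_correct k x al w Hk 0). apply is_sum_ext. intros n. now rewrite Rplus_0_r.
  - rewrite theta_inversion_aux by easy.
    generalize (gauss_sum_correct k x al w Hk 0). intros H. assert (H0 : -1 < 0 < 1) by lra.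
    generalize (H H0). apply is_sum_ext. intros n. now rewrite Rplus_0_r.
Qed.

Local Open Scope C_scope.

(** * Complex sums and integrals *)

Lemma C_ext (a b : C) : Re a = Re b -> Im a = Im b -> a = b.
Proof. destruct a, b. simpl. now intros -> ->. Qed.

Definition csum {I} (f : I -> C) (s : C) : Prop :=
  is_sum (fun i => Re (f i)) (Re s) /\ is_sum (fun i => Im (f i)) (Im s).

Lemma csum_unique {I} (f : I -> C) s t : csum f s -> csum f t -> s = t.
Proof. intros [H1 H2] [H3 H4]. apply C_ext; eapply is_sum_unique; eassumption. Qed.

Lemma csum_ext {I} (f g : I -> C) s : (forall i, f i = g i) -> csum f s -> csum g s.
Proof. intros H. now replace g with f by now apply functional_extensionality. Qed.

Lemma csum_plus {I} (f g : I -> C) s t : csum f s -> csum g t -> csum (fun i => f i + g i) (s + t).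
Proof. intros [H1 H2] [H3 H4]. split; now apply is_sum_plus. Qed.

Lemma csum_scal {I} (f : I -> C) s c : csum f s -> csum (fun i => c * f i) (c * s).
Proof.
  intros [H1 H2]. split; simpl.
  - apply (is_sum_ext (fun i => Re c * Re (f i) + - (Im c * Im (f i)))%R); [easy|].
    apply is_sum_plus; [|apply is_sum_opp]; now apply is_sum_scal.
  - apply (is_sum_plus (fun i => Re c * Im (f i)) (fun i => Im c * Re (f i)))%R; now apply is_sum_scal.
Qed.

Lemma csum_opp {I} (f : I -> C) s : csum f s -> csum (fun i => - f i) (- s).
Proof. intros [H1 H2]. split; now apply is_sum_opp. Qed.

Lemma csum_minus {I} (f g : I -> C) s t : csum f s -> csum g t -> csum (fun i => f i - g i) (s - t).
Proof. intros Hf Hg. apply csum_plus; [easy|now apply csum_opp]. Qed.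

Lemma csum_bij {I J} (f : I -> C) s (e : J -> I) (e' : I -> J) :
  (forall j, e' (e j) = j) -> (forall i, e (e' i) = i) ->
  csum f s -> csum (fun j => f (e j)) s.
Proof.
  intros H1 H2 [H3 H4]. split.
  - now apply (is_sum_bij (fun i => Re (f i)) (Re s) e e').
  - now apply (is_sum_bij (fun i => Im (f i)) (Im s) e e').
Qed.

Lemma csum_fubini {I J} (f : I * J -> C) s : csum f s ->
  exists g, (forall i, csum (fun j => f (i, j)) (g i)) /\ csum g s.
Proof.
  intros [H1 H2]. destruct (is_sum_fubini _ _ H1) as [g1 [H3 H4]].
  destruct (is_sum_fubini _ _ H2) as [g2 [H5 H6]].
  exists (fun i => (g1 i, g2 i)). split; [intros i|]; split; auto.
Qed.

Lemma csum_dominated {I} (f : I -> C) (M : I -> R) B : psum M B -> (forall i, (Cmod (f i) <= M i)%R) ->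
  exists s, csum f s.
Proof.
  intros HM Hf.
  destruct (is_sum_dominated (fun i => Re (f i)) M B HM) as [s1 H1].
  { intros i. eapply Rle_trans; [apply Rle_trans with (2 := Rmax_Cmod (f i)); apply Rmax_l|apply Hf]. }
  destruct (is_sum_dominated (fun i => Im (f i)) M B HM) as [s2 H2].
  { intros i. eapply Rle_trans; [apply Rle_trans with (2 := Rmax_Cmod (f i)); apply Rmax_r|apply Hf]. }
  exists (s1, s2). now split.
Qed.

Lemma csum_zero {I} : csum (fun _ : I => RtoC 0) 0.
Proof. split; apply is_sum_zero. Qed.

Lemma csum_single {I} (i0 : I) (f : I -> C) : (forall i, i <> i0 -> f i = 0) -> csum f (f i0).
Proof.
  intros H. split; [apply (is_sum_single i0 (fun i => Re (f i)))|apply (is_sum_single i0 (fun i => Im (f i)))];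
  intros i Hi; now rewrite H.
Qed.

Lemma csum_classes {I J} (f : I -> C) s K (e : nat -> J -> I) (cl : I -> nat) (pr : I -> J) :
  (forall i, (cl i <= K)%nat) -> (forall i, e (cl i) (pr i) = i) ->
  (forall k j, (k <= K)%nat -> cl (e k j) = k /\ pr (e k j) = j) ->
  csum f s ->
  exists g, (forall k, (k <= K)%nat -> csum (fun j => f (e k j)) (g k)) /\ s = sum_n g K.
Proof.
  intros H1 H2 H3 [H4 H5].
  destruct (is_sum_classes _ _ K e cl pr H1 H2 H3 H4) as [g1 [H6 H7]].
  destruct (is_sum_classes _ _ K e cl pr H1 H2 H3 H5) as [g2 [H8 H9]].
  exists (fun k => (g1 k, g2 k)). split.
  - intros k Hk. split; auto.
  - apply C_ext; [rewrite H7|rewrite H9]; clear; induction K as [|K IH].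
    + now rewrite !sum_O.
    + rewrite !sum_Sn, IH. easy.
    + now rewrite !sum_O.
    + rewrite !sum_Sn, IH. easy.
Qed.

Lemma is_sum_Z f s : is_sum f s ->
  s = (Series (fun n => f (Z.of_nat n)) + Series (fun n => f (- Z.of_nat (S n))%Z))%R.
Proof.
  intros Hf.
  destruct (is_sum_classes f s 1 (fun k n => match k with O => Z.of_nat n | _ => (- Z.of_nat (S n))%Z end)
    (fun n => if (0 <=? n)%Z then 0%nat else 1%nat)
    (fun n => if (0 <=? n)%Z then Z.to_nat n else Z.to_nat (- n - 1))) as [g [H1 H2]]; trivial.
  - intros i. destruct (Z.leb_spec 0 i); lia.
  - intros i. destruct (Z.leb_spec 0 i); lia.
  - intros k j Hk. destruct k as [|[|k]]; [| |lia].
    + destruct (Z.leb_spec 0 (Z.of_nat j)); lia.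
    + destruct (Z.leb_spec 0 (- Z.of_nat (S j))); lia.
  - rewrite H2, sum_Sn, sum_O. unfold plus; simpl. f_equal.
    + symmetry. apply is_series_unique, is_sum_nat, (H1 0%nat). lia.
    + symmetry. apply is_series_unique, is_sum_nat, (H1 1%nat). lia.
Qed.

Lemma csum_sumZ f s : csum f s -> sumZ f = s.
Proof.
  intros [H1 H2]. apply C_ext; symmetry.
  - exact (is_sum_Z _ _ H1).
  - exact (is_sum_Z _ _ H2).
Qed.

Lemma Cexp_plus a b : Cexp (a + b) = Cexp a * Cexp b.
Proof.
  destruct a, b. unfold Cexp. apply C_ext; simpl; rewrite exp_plus, ?cos_plus, ?sin_plus; ring.
Qed.

Lemma Cmod_Cexp z : Cmod (Cexp z) = exp (Re z).
Proof.
  unfold Cmod, Cexp; cbn [fst snd].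
  replace ((exp (Re z) * cos (Im z)) ^ 2 + (exp (Re z) * sin (Im z)) ^ 2)%R with (exp (Re z) ^ 2)%R.
  - rewrite sqrt_pow2; [easy|apply Rlt_le, exp_pos].
  - pose proof (sin2_cos2 (Im z)) as H. unfold Rsqr in H.
    transitivity (exp (Re z) ^ 2 * (sin (Im z) * sin (Im z) + cos (Im z) * cos (Im z)))%R; [|ring].
    rewrite H. ring.
Qed.

Lemma e2pi_plus a b : e2pi (a + b) = e2pi a * e2pi b.
Proof. unfold e2pi. rewrite <- Cexp_plus. f_equal. ring. Qed.

Lemma e2pi_components z :
  e2pi z = (exp (- 2 * PI * Im z) * cos (2 * PI * Re z), exp (- 2 * PI * Im z) * sin (2 * PI * Re z))%R.
Proof.
  unfold e2pi, Cexp. destruct z as [x y]. simpl. f_equal; f_equal; f_equal; ring.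
Qed.

Lemma e2pi_IZR n : e2pi (RtoC (IZR n)) = 1.
Proof.
  rewrite e2pi_components. simpl. rewrite Rmult_0_r, exp_0, !Rmult_1_l.
  rewrite <- (Rplus_0_l (2 * PI * IZR n)), cos_period_Z, sin_period_Z, cos_0, sin_0. easy.
Qed.

Lemma e2pi_plus_IZR z n : e2pi (z + RtoC (IZR n)) = e2pi z.
Proof. rewrite e2pi_plus, e2pi_IZR. ring. Qed.

Lemma Cmod_e2pi z : Cmod (e2pi z) = exp (- 2 * PI * Im z).
Proof. unfold e2pi. rewrite Cmod_Cexp. f_equal. destruct z. simpl. ring. Qed.

Lemma e2pi_eq_1 z : e2pi z = 1 -> exists n, z = RtoC (IZR n).
Proof.
  intros H. pose proof PI_RGT_0 as HPI.
  assert (Hi : Im z = 0%R).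
  { pose proof (Cmod_e2pi z) as H1. rewrite H, Cmod_1, <- exp_0 in H1. apply exp_inv in H1. nra. }
  rewrite e2pi_components, Hi, Rmult_0_r, exp_0, !Rmult_1_l in H.
  assert (Hs : sin (2 * PI * Re z) = 0%R) by (now inversion H).
  assert (Hc : cos (2 * PI * Re z) = 1%R) by (now inversion H).
  destruct (sin_eq_0_0 _ Hs) as [j Hj].
  destruct (Z.Even_or_Odd j) as [[n ->]|[n ->]].
  - exists n. apply C_ext; simpl; [|easy]. rewrite mult_IZR in Hj. nra.
  - rewrite Hj, plus_IZR, mult_IZR in Hc.
    replace ((2 * IZR n + 1) * PI)%R with (PI + 2 * PI * IZR n)%R in Hc by ring.
    rewrite cos_period_Z, cos_PI in Hc. lra.
Qed.

(** The term on the dual side of Poisson summation, with [w * w] and not [|w|^2]: it is holomorphic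
    in [w]. The modulus squared appears only after multiplication by [quad_weight]. *)
Definition gauss_phase (k x : R) (w : C) : C :=
  Cexp (RtoC (2 * PI * x) * Ci * w - RtoC (PI / k ^ 2) * (w * w)).

(* [Im w] is absorbed into a real translation of [x]. *)
Lemma ctheta_inversion k x w : (0 < k)%R -> exists s,
  csum (fun n => RtoC (k * exp (- PI * k ^ 2 * (IZR n - x) ^ 2)) * e2pi (RtoC (IZR n) * w)) s /\
  csum (fun a => gauss_phase k x (w + RtoC (IZR a))) s.
Proof.
  intros Hk. destruct w as [w1 w2].
  set (x' := (x - w2 / k ^ 2)%R).
  set (C0 := exp (PI * w2 ^ 2 / k ^ 2 - 2 * PI * x * w2)).
  (* Phase 0 gives the real parts, phase [- PI / 2] the imaginary parts; [C0] is what completing the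
     square in [Im w] leaves over. *)
  destruct (theta_inversion k x' 0 w1 Hk) as [s1 [H1 H2]].
  destruct (theta_inversion k x' (- (PI / 2)) w1 Hk) as [s2 [H3 H4]].
  assert (Hsin : forall t, cos (t + - (PI / 2)) = sin t).
  { intros t. rewrite <- cos_shift, <- (cos_neg (t + _)). f_equal. ring. }
  assert (He : forall n, (k * exp (- PI * k ^ 2 * (IZR n - x) ^ 2) * exp (- 2 * PI * (IZR n * w2))
            = C0 * (k * exp (- PI * k ^ 2 * (IZR n - x') ^ 2)))%R).
  { intros n. unfold C0.
    transitivity (k * (exp (- PI * k ^ 2 * (IZR n - x) ^ 2) * exp (- 2 * PI * (IZR n * w2))))%R; [ring|].
    match goal with |- _ = (?c * (k * ?d))%R => transitivity (k * (c * d))%R; [|ring] end.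
    rewrite <- !exp_plus. do 2 f_equal. unfold x'. field. lra. }
  assert (Hn : forall n, RtoC (IZR n) * ((w1, w2) : C) = (IZR n * w1, IZR n * w2)%R).
  { intros n. apply C_ext; simpl; ring. }
  assert (Hg : forall a, gauss_phase k x ((w1, w2) + RtoC (IZR a)) =
     (C0 * (exp (- PI * (w1 + IZR a) ^ 2 / k ^ 2) * cos (2 * PI * x' * (w1 + IZR a))),
      C0 * (exp (- PI * (w1 + IZR a) ^ 2 / k ^ 2) * sin (2 * PI * x' * (w1 + IZR a))))%R).
  { intros a. unfold gauss_phase, Cexp, C0. rewrite <- !Rmult_assoc, <- !exp_plus.
    f_equal; f_equal; f_equal; unfold x'; simpl; field; lra. }
  exists ((C0 * s1)%R, (C0 * s2)%R). split; split.
  - generalize (is_sum_scal _ _ C0 H1). apply is_sum_ext. intros n. rewrite Hn, e2pi_components.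
    cbn [Re Im fst snd Cmult RtoC]. rewrite Rplus_0_r, <- Rmult_assoc, <- He, !(Rmult_assoc (2 * PI)). ring.
  - generalize (is_sum_scal _ _ C0 H3). apply is_sum_ext. intros n. rewrite Hn, e2pi_components.
    cbn [Re Im fst snd Cmult RtoC]. rewrite Hsin, <- Rmult_assoc, <- He, !(Rmult_assoc (2 * PI)). ring.
  - generalize (is_sum_scal _ _ C0 H2). apply is_sum_ext. intros a. rewrite Hg. cbn [Re fst]. now rewrite Rplus_0_r.
  - generalize (is_sum_scal _ _ C0 H4). apply is_sum_ext. intros a. rewrite Hg. cbn [Im snd]. now rewrite Hsin.
Qed.

Definition CInt (f : R -> C) : C := (RInt (fun u => Re (f u)) 0 1, RInt (fun u => Im (f u)) 0 1).

(** Both families of integrals sum to the integral of the common sum [F]. The range [-1 < u < 2] is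
    an open neighbourhood of [[0, 1]], as termwise integration asks for. *)
Lemma is_sum_RInt_transfer {I J} (f : I -> R -> R) (g : J -> R -> R) (M : I -> R) (N : J -> R) A B :
  psum M A -> psum N B ->
  (forall i u, (-1 < u < 2 -> Rabs (f i u) <= M i)%R) -> (forall i u, (-1 < u < 2 -> Rabs (g i u) <= N i)%R) ->
  (forall i u, continuous (f i) u) -> (forall i u, continuous (g i) u) ->
  (forall u, exists s, is_sum (fun i => f i u) s /\ is_sum (fun i => g i u) s) ->
  exists s, is_sum (fun i => RInt (f i) 0 1) s /\ is_sum (fun i => RInt (g i) 0 1) s.
Proof.
  intros HM HN HfM HgN Hf Hg Hs.
  set (F := fun u => sum_of (fun i => f i u)).
  assert (HF : forall u, is_sum (fun i => f i u) (F u)).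
  { intros u. apply sum_of_correct. destruct (Hs u) as [s [H _]]. now exists s. }
  exists (RInt F 0 1). split.
  - apply (is_sum_RInt _ f M A F (-1) 2); auto; lra.
  - apply (is_sum_RInt _ g N B F (-1) 2); auto; try lra.
    intros u _. destruct (Hs u) as [s [H1 H2]].
    now rewrite (is_sum_unique _ _ _ (HF u) H1).
Qed.

Lemma csum_CInt_transfer {I J} (f : I -> R -> C) (g : J -> R -> C) (M : I -> R) (N : J -> R) A B :
  psum M A -> psum N B ->
  (forall i u, (-1 < u < 2 -> Cmod (f i u) <= M i)%R) -> (forall i u, (-1 < u < 2 -> Cmod (g i u) <= N i)%R) ->
  (forall i u, continuous (fun u => Re (f i u)) u /\ continuous (fun u => Im (f i u)) u) ->
  (forall i u, continuous (fun u => Re (g i u)) u /\ continuous (fun u => Im (g i u)) u) ->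
  (forall u, exists s, csum (fun i => f i u) s /\ csum (fun i => g i u) s) ->
  exists s, csum (fun i => CInt (f i)) s /\ csum (fun i => CInt (g i)) s.
Proof.
  intros HM HN HfM HgN Hf Hg Hs.
  assert (Hre : forall z : C, (Rabs (Re z) <= Cmod z)%R).
  { intros z. eapply Rle_trans; [apply Rmax_l|apply Rmax_Cmod]. }
  assert (Him : forall z : C, (Rabs (Im z) <= Cmod z)%R).
  { intros z. eapply Rle_trans; [apply Rmax_r|apply Rmax_Cmod]. }
  destruct (is_sum_RInt_transfer (fun i u => Re (f i u)) (fun i u => Re (g i u)) M N A B HM HN
    (fun i u Hu => Rle_trans _ _ _ (Hre _) (HfM i u Hu)) (fun i u Hu => Rle_trans _ _ _ (Hre _) (HgN i u Hu))
    (fun i u => proj1 (Hf i u)) (fun i u => proj1 (Hg i u))) as [s1 [H1 H2]].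
  { intros u. destruct (Hs u) as [s [[H3 _] [H4 _]]]. now exists (Re s). }
  destruct (is_sum_RInt_transfer (fun i u => Im (f i u)) (fun i u => Im (g i u)) M N A B HM HN
    (fun i u Hu => Rle_trans _ _ _ (Him _) (HfM i u Hu)) (fun i u Hu => Rle_trans _ _ _ (Him _) (HgN i u Hu))
    (fun i u => proj2 (Hf i u)) (fun i u => proj2 (Hg i u))) as [s2 [H3 H4]].
  { intros u. destruct (Hs u) as [s [[_ H3] [_ H4]]]. now exists (Im s). }
  exists (s1, s2). split; split; easy.
Qed.

Lemma is_derive_Cexp_lin (l mu nu : C) (u : R) :
  is_derive (fun u => Re (nu * Cexp (l * RtoC u + mu))) u (Re (nu * l * Cexp (l * RtoC u + mu))) /\
  is_derive (fun u => Im (nu * Cexp (l * RtoC u + mu))) u (Im (nu * l * Cexp (l * RtoC u + mu))).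
Proof.
  destruct l as [l1 l2], mu as [m1 m2], nu as [n1 n2]. unfold Cexp. simpl. split.
  - auto_derive; [easy|]. eqR. unfold Rminus. ring.
  - auto_derive; [easy|]. eqR. unfold Rminus. ring.
Qed.

Lemma continuous_Cexp_lin (l mu nu : C) (u : R) :
  continuous (fun u => Re (nu * Cexp (l * RtoC u + mu))) u /\
  continuous (fun u => Im (nu * Cexp (l * RtoC u + mu))) u.
Proof.
  destruct (is_derive_Cexp_lin l mu nu u) as [H1 H2].
  split; apply (ex_derive_continuous (V := R_NormedModule)); eexists; eassumption.
Qed.

Lemma CInt_Cexp_lin (l mu : C) : l <> 0 ->
  CInt (fun u => Cexp (l * RtoC u + mu)) = (Cexp l - 1) * Cexp mu / l.
Proof.
  intros Hl. unfold CInt.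
  assert (Hd : forall u, Cexp (l * RtoC u + mu) = / l * l * Cexp (l * RtoC u + mu)) by (intros; field; easy).
  replace ((Cexp l - 1) * Cexp mu / l) with (/ l * Cexp (l * RtoC 1 + mu) - / l * Cexp (l * RtoC 0 + mu)).
  2:{ rewrite Cmult_0_r, Cmult_1_r, Cplus_0_l, Cexp_plus. field. easy. }
  apply C_ext; simpl; apply is_RInt_unique.
  - apply (is_RInt_ext (fun u => Re (/ l * l * Cexp (l * RtoC u + mu)))).
    { intros u _. now rewrite <- Hd. }
    apply (is_RInt_derive (V := R_CompleteNormedModule) (fun u => Re (/ l * Cexp (l * RtoC u + mu)))).
    + intros u _. apply (proj1 (is_derive_Cexp_lin l mu (/ l) u)).
    + intros u _. apply (proj1 (continuous_Cexp_lin l mu (/ l * l) u)).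
  - apply (is_RInt_ext (fun u => Im (/ l * l * Cexp (l * RtoC u + mu)))).
    { intros u _. now rewrite <- Hd. }
    apply (is_RInt_derive (V := R_CompleteNormedModule) (fun u => Im (/ l * Cexp (l * RtoC u + mu)))).
    + intros u _. apply (proj2 (is_derive_Cexp_lin l mu (/ l) u)).
    + intros u _. apply (proj2 (continuous_Cexp_lin l mu (/ l * l) u)).
Qed.

Lemma CInt_RtoC (a : R -> R) (z : C) : ex_RInt a 0 1 ->
  CInt (fun u => RtoC (a u) * z) = RtoC (RInt a 0 1) * z.
Proof.
  intros Ha. apply C_ext.
  - simpl. rewrite (RInt_ext _ (fun u => Re z * a u)%R).
    + rewrite RInt_Rmult by easy. eqR. unfold Re. ring.
    + intros u _. eqR. unfold Re. ring.
  - simpl. rewrite (RInt_ext _ (fun u => Im z * a u)%R).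
    + rewrite RInt_Rmult by easy. eqR. unfold Im. ring.
    + intros u _. eqR. unfold Im. ring.
Qed.

(** * A single Appell summand as a sum over Z *)

Lemma E_bound x : (Rabs (E x) <= 1)%R.
Proof.
  destruct (Rle_dec 0 x) as [H|H].
  - pose proof (E_tail x H) as H1. pose proof (E_nondecreasing 0 x H) as H2. rewrite E_0 in H2.
    apply Rabs_le. lra.
  - assert (H0 : (0 <= - x)%R) by lra.
    pose proof (E_tail _ H0) as H1. pose proof (E_nondecreasing _ _ H0) as H2. rewrite E_0 in H2.
    rewrite E_opp in *. apply Rabs_le. lra.
Qed.

Lemma sign_half n : sign (IZR n + 1 / 2) = if (0 <=? n)%Z then 1%R else (-1)%R.
Proof.
  destruct (Z.leb_spec 0 n) as [H|H].
  - apply sign_eq_1. apply IZR_le in H. lra.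
  - apply sign_eq_m1. assert (H1 : (n <= -1)%Z) by lia. apply IZR_le in H1. lra.
Qed.

(** Where [n + d] and [n + 1/2] have the same sign this is the Gaussian tail of [E]. Otherwise
    [|n + d| <= |d|], and the trivial bound 2 is absorbed by the factor [exp (PI k^2 d^2)]. *)
Lemma E_sign_bound k d n : (0 < k)%R ->
  (Rabs (E ((IZR n + d) * k) - sign (IZR n + 1 / 2))
    <= 2 * exp (PI * k ^ 2 * d ^ 2) * exp (- PI * k ^ 2 * (IZR n + d) ^ 2))%R.
Proof.
  intros Hk. pose proof PI_RGT_0 as HPI.
  assert (Hp : (0 < PI * k ^ 2)%R) by (apply Rmult_lt_0_compat; [easy|now apply pow_lt]).
  set (x := ((IZR n + d) * k)%R).
  assert (Hx : (- PI * k ^ 2 * (IZR n + d) ^ 2 = - PI * x ^ 2)%R) by (unfold x; ring).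
  assert (H1 : (1 <= exp (PI * k ^ 2 * d ^ 2))%R).
  { rewrite <- exp_0. apply exp_monotone. pose proof (pow2_ge_0 d). nra. }
  assert (Hfar : ((IZR n + d) ^ 2 <= d ^ 2 -> Rabs (E x - sign (IZR n + 1 / 2)) <=
       2 * exp (PI * k ^ 2 * d ^ 2) * exp (- PI * k ^ 2 * (IZR n + d) ^ 2))%R).
  { intros Hd. apply Rle_trans with 2%R.
    - pose proof (E_bound x) as HE. apply Rabs_le_between in HE. rewrite sign_half.
      apply Rabs_le. destruct (0 <=? n)%Z; lra.
    - rewrite Rmult_assoc, <- exp_plus. rewrite <- (Rmult_1_r 2) at 1. apply Rmult_le_compat_l; [lra|].
      rewrite <- exp_0. apply exp_monotone. nra. }
  rewrite sign_half in *. destruct (Z.leb_spec 0 n) as [H|H].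
  - apply IZR_le in H. destruct (Rle_dec 0 (IZR n + d)) as [Hd|Hd]; [|apply Hfar; nra].
    assert (Hx0 : (0 <= x)%R) by (unfold x; nra). rewrite Hx.
    pose proof (E_tail x Hx0). pose proof (exp_pos (- PI * x ^ 2)).
    rewrite Rabs_minus_sym, Rabs_pos_eq by lra. nra.
  - assert (H2 : (n <= -1)%Z) by lia. apply IZR_le in H2.
    destruct (Rle_dec (IZR n + d) 0) as [Hd|Hd]; [|apply Hfar; nra].
    assert (Hx0 : (0 <= - x)%R) by (unfold x; nra). rewrite Hx.
    pose proof (E_tail _ Hx0) as H3. rewrite E_opp in H3. replace ((- x) ^ 2)%R with (x ^ 2)%R in H3 by ring.
    pose proof (exp_pos (- PI * x ^ 2)).
    rewrite Rabs_pos_eq by lra. nra.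
Qed.

Lemma Cmod_RtoC_mult r z : Cmod (RtoC r * z) = (Rabs r * Cmod z)%R.
Proof. now rewrite Cmod_mult, Cmod_R. Qed.

Lemma Im_IZR_mult n w : Im (RtoC (IZR n) * w) = (IZR n * Im w)%R.
Proof. destruct w. simpl. ring. Qed.

Lemma csum_E_sign k c w : (0 < k)%R ->
  exists s, csum (fun n => RtoC (E ((IZR n - c) * k) - sign (IZR n + 1 / 2)) * e2pi (RtoC (IZR n) * w)) s.
Proof.
  intros Hk. pose proof PI_RGT_0 as HPI.
  assert (Hp : (0 < PI * k ^ 2)%R) by (apply Rmult_lt_0_compat; [easy|now apply pow_lt]).
  destruct (psum_gauss (PI * k ^ 2) (2 * PI * k ^ 2 * c - 2 * PI * Im w) Hp) as [B HB].
  set (K := (2 * exp (PI * k ^ 2 * c ^ 2) * exp (- PI * k ^ 2 * c ^ 2))%R).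
  assert (HK : (0 <= K)%R) by (apply Rlt_le; repeat apply Rmult_lt_0_compat; try apply exp_pos; lra).
  apply (csum_dominated _ _ _ (psum_scal _ _ K HK HB)).
  intros n. rewrite Cmod_RtoC_mult, Cmod_e2pi, Im_IZR_mult.
  eapply Rle_trans; [apply Rmult_le_compat_r; [apply Rlt_le, exp_pos|apply (E_sign_bound k (- c) n Hk)]|].
  apply Req_le. unfold K. rewrite !Rmult_assoc, <- !exp_plus. do 2 f_equal. ring.
Qed.

Lemma RInt_E_difference k c n : (0 < k)%R ->
  RInt (fun u => (k * exp (- PI * k ^ 2 * (IZR n - (c + u)) ^ 2))%R) 0 1
   = ((E ((IZR n - c) * k) - E ((IZR n - 1 - c) * k)) / 2)%R.
Proof.
  intros Hk. apply is_RInt_unique.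
  replace ((E ((IZR n - c) * k) - E ((IZR n - 1 - c) * k)) / 2)%R
    with (minus (- / 2 * E ((IZR n - (c + 1)) * k)) (- / 2 * E ((IZR n - (c + 0)) * k)))%R.
  - apply (is_RInt_derive (V := R_CompleteNormedModule) (fun u => - / 2 * E ((IZR n - (c + u)) * k))%R).
    + intros u _.
      replace (k * exp (- PI * k ^ 2 * (IZR n - (c + u)) ^ 2))%R
        with (- / 2 * (- k * (2 * exp (- PI * ((IZR n - (c + u)) * k) ^ 2))))%R.
      * apply (is_derive_scal (fun u => E ((IZR n - (c + u)) * k)%R)).
        apply (is_derive_comp E (fun u => (IZR n - (c + u)) * k)%R); [apply is_derive_E|].
        auto_derive; [easy|]. eqR. ring.
      * replace (- PI * ((IZR n - (c + u)) * k) ^ 2)%R with (- PI * k ^ 2 * (IZR n - (c + u)) ^ 2)%R by ring. field.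
    + intros u _. elem_continuous.
  - unfold minus, plus, opp; simpl.
    replace (IZR n - (c + 1))%R with (IZR n - 1 - c)%R by ring. rewrite Rplus_0_r. eqR. field.
Qed.

(** Increments of [E] are integrals over [u] in [[0, 1]] of Gaussians centred at [c + u]. After
    theta inversion [u] enters only through [e2pi (u W)] with [W = w + a], whose integral is
    [(e2pi W - 1) / (2 PI i W)]. The numerator is the same for all [a] and factors out; the
    denominator is the [1 / W] of the lattice sum. *)
Lemma csum_E_difference k c w : (0 < k)%R -> (forall a, w + RtoC (IZR a) <> 0) -> exists s t,
  csum (fun n => RtoC ((E ((IZR n - c) * k) - E ((IZR n - 1 - c) * k)) / 2) * e2pi (RtoC (IZR n) * w)) s /\
  csum (fun a => gauss_phase k c (w + RtoC (IZR a)) / (w + RtoC (IZR a))) t /\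
  s = (e2pi w - 1) / (RtoC (2 * PI) * Ci) * t.
Proof.
  intros Hk Hw. pose proof PI_RGT_0 as HPI.
  assert (Hp : (0 < PI * k ^ 2)%R) by (apply Rmult_lt_0_compat; [easy|now apply pow_lt]).
  assert (Hq : (0 < PI / k ^ 2)%R) by (apply Rdiv_lt_0_compat; [easy|now apply pow_lt]).
  assert (H2pi : RtoC (2 * PI) * Ci <> 0).
  { intros H. apply (f_equal Im) in H. simpl in H. lra. }
  set (f := fun n u => RtoC (k * exp (- PI * k ^ 2 * (IZR n - (c + u)) ^ 2)) * e2pi (RtoC (IZR n) * w)).
  set (g := fun a u => gauss_phase k (c + u) (w + RtoC (IZR a))).
  destruct (psum_gauss (PI * k ^ 2 / 2) (PI * k ^ 2 * c - 2 * PI * Im w)) as [A HA]; [lra|].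
  destruct (psum_gauss_shift (PI / k ^ 2) (- Re w) Hq) as [B HB].
  (* [KA] comes from [(n - c - u)^2 >= (n - c)^2 / 2 - u^2] with [u^2 <= 4]; [KB] from the modulus
     of [gauss_phase] at frequency [c + u] with [|u| <= 2]. *)
  set (KA := (k * exp (4 * PI * k ^ 2 - PI * k ^ 2 / 2 * c ^ 2))%R).
  set (KB := exp (2 * PI * (Rabs c + 2) * Rabs (Im w) + PI / k ^ 2 * Im w ^ 2)).
  assert (HKA : (0 <= KA)%R) by (apply Rmult_le_pos; [lra|apply Rlt_le, exp_pos]).
  assert (HKB : (0 <= KB)%R) by apply Rlt_le, exp_pos.
  set (l := fun a => RtoC (2 * PI) * Ci * (w + RtoC (IZR a))).
  set (mu := fun a => RtoC (2 * PI * c) * Ci * (w + RtoC (IZR a)) - RtoC (PI / k ^ 2) * ((w + RtoC (IZR a)) * (w + RtoC (IZR a)))).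
  assert (Hg : forall a u, g a u = Cexp (l a * RtoC u + mu a)).
  { intros a u. unfold g, gauss_phase, l, mu. f_equal. rewrite !RtoC_mult, RtoC_plus. ring. }
  destruct (csum_CInt_transfer f g _ _ _ _ (psum_scal _ _ KA HKA HA) (psum_scal _ _ KB HKB HB)) as [s [H1 H2]].
  - intros n u Hu. unfold f. rewrite Cmod_RtoC_mult, Cmod_e2pi, Im_IZR_mult.
    rewrite Rabs_pos_eq by (apply Rmult_le_pos; [lra|apply Rlt_le, exp_pos]).
    unfold KA. rewrite !Rmult_assoc. apply Rmult_le_compat_l; [lra|]. rewrite <- !exp_plus.
    apply exp_monotone.
    assert (Hu2 : (u ^ 2 <= 4)%R) by nra.
    assert (H : (PI * k ^ 2 * (IZR n - c - 2 * u) ^ 2 >= 0)%R) by (pose proof (pow2_ge_0 (IZR n - c - 2 * u)); nra).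
    nra.
  - intros a u Hu. rewrite Hg, Cmod_Cexp. unfold KB. rewrite <- exp_plus. apply exp_monotone.
    unfold l, mu. destruct w as [w1 w2].
    match goal with |- (?x <= _)%R => replace x with (- 2 * PI * (c + u) * w2 - PI / k ^ 2 * ((w1 + IZR a) ^ 2 - w2 ^ 2))%R by (simpl; ring) end.
    cbn [Re Im fst snd].
    assert (H : (- (c + u) * w2 <= (Rabs c + 2) * Rabs w2)%R).
    { eapply Rle_trans; [apply Rle_abs|]. rewrite Rabs_mult, Rabs_Ropp.
      apply Rmult_le_compat_r; [apply Rabs_pos|]. eapply Rle_trans; [apply Rabs_triang|].
      apply Rplus_le_compat_l. apply Rabs_le. lra. }
    nra.
  - intros n u. unfold f. split.
    + apply continuous_ext with (fun u => (k * exp (- PI * k ^ 2 * (IZR n - (c + u)) ^ 2) * Re (e2pi (RtoC (IZR n) * w)))%R).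
      * intros v. simpl. ring.
      * elem_continuous.
    + apply continuous_ext with (fun u => (k * exp (- PI * k ^ 2 * (IZR n - (c + u)) ^ 2) * Im (e2pi (RtoC (IZR n) * w)))%R).
      * intros v. simpl. ring.
      * elem_continuous.
  - intros a u. destruct (continuous_Cexp_lin (l a) (mu a) 1 u) as [Ha Hb]. split.
    + revert Ha. apply continuous_ext. intros v. now rewrite Hg, Cmult_1_l.
    + revert Hb. apply continuous_ext. intros v. now rewrite Hg, Cmult_1_l.
  - intros u. apply (ctheta_inversion k (c + u) w Hk).
  - exists s, (s * (RtoC (2 * PI) * Ci) / (e2pi w - 1)).
    assert (Hw1 : e2pi w - 1 <> 0).
    { intros H. destruct (e2pi_eq_1 w) as [n Hn].
      - replace (e2pi w) with (e2pi w - 1 + 1) by ring. rewrite H. ring.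
      - apply (Hw (- n)%Z). rewrite Hn, opp_IZR, RtoC_opp. ring. }
    split; [|split].
    + revert H1. apply csum_ext. intros n. unfold f.
      rewrite (CInt_RtoC (fun u => (k * exp (- PI * k ^ 2 * (IZR n - (c + u)) ^ 2))%R)) by elem_RInt.
      now rewrite RInt_E_difference.
    + replace (s * (RtoC (2 * PI) * Ci) / (e2pi w - 1)) with ((RtoC (2 * PI) * Ci) / (e2pi w - 1) * s) by (field; easy).
      generalize (csum_scal _ _ ((RtoC (2 * PI) * Ci) / (e2pi w - 1)) H2). apply csum_ext. intros a.
      replace (g a) with (fun u => Cexp (l a * RtoC u + mu a)) by (apply functional_extensionality; intros; now rewrite Hg).
      rewrite CInt_Cexp_lin.
      * change (Cexp (mu a)) with (gauss_phase k c (w + RtoC (IZR a))).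
        change (Cexp (l a)) with (e2pi (w + RtoC (IZR a))). rewrite e2pi_plus_IZR.
        unfold l. specialize (Hw a). clear - Hw Hw1 H2pi. revert H2pi.
        generalize (RtoC (2 * PI) * Ci). intros q Hq. field. auto.
      * unfold l. apply Cmult_neq_0; auto.
    + clear - Hw1 H2pi. revert H2pi. generalize (RtoC (2 * PI) * Ci). intros q Hq. field. auto.
Qed.

(* With [X = e2pi w], multiplying the left-hand side by [1 - X] telescopes it into the sum of
   [csum_E_difference], an integral over [0, 1] of theta series. *)
Lemma appell_lattice k c w : (0 < k)%R -> e2pi w <> 1 -> exists s t,
  csum (fun n => RtoC (E ((IZR n - c) * k) - sign (IZR n + 1 / 2)) * e2pi (RtoC (IZR n) * w)) s /\
  csum (fun a => gauss_phase k c (w + RtoC (IZR a)) / (w + RtoC (IZR a))) t /\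
  1 / (1 - e2pi w) + RtoC (/ 2) * s = - (/ (RtoC (2 * PI) * Ci) * t).
Proof.
  intros Hk Hw. pose proof PI_RGT_0 as HPI.
  assert (Hwa : forall a, w + RtoC (IZR a) <> 0).
  { intros a Ha. apply Hw. rewrite <- (e2pi_plus_IZR w a), Ha. apply (e2pi_IZR 0). }
  destruct (csum_E_sign k c w Hk) as [s Hs].
  destruct (csum_E_difference k c w Hk Hwa) as [s1 [t [Hs1 [Ht Hst]]]].
  exists s, t. split; [easy|]. split; [easy|].
  set (X := e2pi w) in *.
  set (f := fun n => RtoC (E ((IZR n - c) * k) - sign (IZR n + 1 / 2)) * e2pi (RtoC (IZR n) * w)) in Hs.
  assert (Hf' : csum (fun n => f n - X * f (n - 1)%Z) (s - X * s)).
  { apply csum_minus; [easy|]. apply (csum_scal (fun n => f (n - 1)%Z)).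
    apply (csum_bij f s (fun n => (n - 1)%Z) (fun n => (n + 1)%Z)); try (intros; lia); easy. }
  (* The sign jumps only at [n = 0], so this family sums to 2; halved and divided by [1 - X], this
     constant cancels the term [1 / (1 - X)]. *)
  set (d := fun n => RtoC (sign (IZR n + 1 / 2) - sign (IZR (n - 1) + 1 / 2)) * e2pi (RtoC (IZR n) * w)).
  assert (Hd : csum d 2).
  { replace (RtoC 2) with (d 0%Z).
    - apply csum_single. intros n Hn. unfold d. rewrite !sign_half.
      replace (0 <=? n - 1)%Z with (0 <=? n)%Z; [rewrite Rminus_diag; ring|].
      destruct (Z.leb_spec 0 n); destruct (Z.leb_spec 0 (n - 1)); lia.
    - unfold d. rewrite !sign_half. simpl. replace (RtoC 0 * w) with (RtoC (IZR 0)) by ring. rewrite e2pi_IZR.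
      rewrite <- RtoC_mult. f_equal. ring. }
  assert (Heq : s - X * s = RtoC 2 * s1 - 2).
  { apply (csum_unique _ _ _ Hf').
    generalize (csum_minus _ _ _ _ (csum_scal _ _ (RtoC 2) Hs1) Hd). apply csum_ext. intros n.
    unfold f, d, X.
    replace (e2pi (RtoC (IZR n) * w)) with (e2pi w * e2pi (RtoC (IZR (n - 1)) * w)).
    - rewrite minus_IZR. rewrite !RtoC_minus, RtoC_div, RtoC_minus by lra. field.
    - rewrite <- e2pi_plus. f_equal. rewrite minus_IZR, RtoC_minus. ring. }
  assert (HX : 1 - X <> 0).
  { intros H. apply Hw. transitivity (1 - (1 - X)); [ring|rewrite H; ring]. }
  assert (H2 : RtoC 2 <> 0) by (intros H; apply (f_equal Re) in H; simpl in H; lra).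
  assert (H2pi : RtoC (2 * PI) * Ci <> 0).
  { intros H. apply (f_equal Im) in H. simpl in H. lra. }
  replace s with ((RtoC 2 * s1 - 2) / (1 - X)) by (rewrite <- Heq; field; easy).
  rewrite Hst, RtoC_inv by lra. clear - HX H2 H2pi. revert H2pi. generalize (RtoC (2 * PI) * Ci).
  intros q Hq. field. auto.
Qed.

(** * Lattice sums *)

(** Induction on the list of exceptions: overwriting [f] by 1 at an exceptional index removes it
    from the list, and its true value enters through [Rmin]. *)
Lemma positive_lower_bound {I} (f : I -> R) (l : list I) :
  (forall i, 0 < f i)%R -> (forall i, ~ In i l -> 1 / 2 <= f i)%R ->
  exists d, (0 < d)%R /\ forall i, (d <= f i)%R.
Proof.
  intros Hpos. revert f Hpos. induction l as [|i0 l IH]; intros f Hpos Hl.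
  - exists (1 / 2)%R. split; [lra|]. intros i. apply Hl. easy.
  - destruct (IH (fun i => if excluded_middle_informative (i = i0) then 1 else f i)%R) as [d [Hd1 Hd2]].
    + intros i. destruct (excluded_middle_informative (i = i0)); [lra|easy].
    + intros i Hi. destruct (excluded_middle_informative (i = i0)); [lra|].
      apply Hl. intros [H|H]; [now apply n|easy].
    + exists (Rmin d (f i0)). split; [now apply Rmin_pos|].
      intros i. specialize (Hd2 i). destruct (excluded_middle_informative (i = i0)) as [->|].
      * apply Rmin_r.
      * eapply Rle_trans; [apply Rmin_l|easy].
Qed.

Lemma zrange_large y r : (0 < y)%R -> exists N, forall p, ~ In p (zrange N) -> (r <= Rabs (IZR p) * y)%R.
Proof.
  intros Hy. destruct (INR_unbounded (r / y)) as [N HN]. exists N. intros p Hp.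
  rewrite in_zrange in Hp.
  assert (H : (INR N <= Rabs (IZR p))%R).
  { rewrite INR_IZR_INZ, <- abs_IZR. apply IZR_le. lia. }
  apply Rle_trans with (r / y * y)%R; [right; field; lra|]. apply Rmult_le_compat_r; lra.
Qed.

(** Once [|p| Im tau >= |Im z| + 1], the modulus of the exponential is at most 1/2 for [p >= 0] and
    at least 2 for [p < 0]; finitely many [p] remain. *)
Lemma one_minus_e2pi_lower_bound tau z : (0 < Im tau)%R ->
  (forall p, e2pi (z + RtoC (IZR p) * tau) <> 1) ->
  exists d, (0 < d)%R /\ forall p, (d <= Cmod (1 - e2pi (z + RtoC (IZR p) * tau)))%R.
Proof.
  intros Hy Hz. destruct (zrange_large (Im tau) (Rabs (Im z) + 1) Hy) as [N HN].
  apply (positive_lower_bound _ (zrange N)).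
  - intros p. apply Cmod_gt_0. intros H. apply (Hz p).
    set (X := e2pi _) in *. transitivity (1 - (1 - X)); [ring|rewrite H; ring].
  - intros p Hp. specialize (HN p Hp). pose proof PI2_3_2 as HPI.
    set (X := e2pi (z + RtoC (IZR p) * tau)).
    assert (HX : Cmod X = exp (- 2 * PI * (Im z + IZR p * Im tau))).
    { unfold X. rewrite Cmod_e2pi. f_equal. destruct z, tau. simpl. ring. }
    assert (H1 : (1 - Cmod X <= Cmod (1 - X))%R).
    { pose proof (Cmod_triangle (1 - X) X) as H. replace (1 - X + X) with (RtoC 1) in H by ring.
      rewrite Cmod_1 in H. lra. }
    assert (H2 : (Cmod X - 1 <= Cmod (1 - X))%R).
    { pose proof (Cmod_triangle 1 (- (1 - X))) as H. replace (1 + - (1 - X)) with X in H by ring.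
      rewrite Cmod_1, Cmod_opp in H. lra. }
    pose proof (Rle_abs (Im z)). pose proof (Rle_abs (- Im z)) as H3. rewrite Rabs_Ropp in H3.
    destruct (Rle_dec 0 (IZR p)) as [Hs|Hs].
    + rewrite (Rabs_pos_eq (IZR p)) in HN by easy.
      assert (Cmod X <= / 2)%R; [|lra]. rewrite HX.
      replace (- 2 * PI * (Im z + IZR p * Im tau))%R with (- (2 * PI * (Im z + IZR p * Im tau)))%R by ring.
      rewrite exp_Ropp. apply Rinv_le_contravar; [lra|].
      pose proof (exp_ineq1_le (2 * PI * (Im z + IZR p * Im tau))). nra.
    + rewrite (Rabs_left (IZR p)) in HN by lra.
      assert (2 <= Cmod X)%R; [|lra]. rewrite HX.
      pose proof (exp_ineq1_le (- 2 * PI * (Im z + IZR p * Im tau))). nra.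
Qed.

(** Outside a finite rectangle one coordinate has size at least 1: the imaginary part for large [p],
    and for the finitely many other [p] the real part for large [a]. This is why [N'] depends on
    [N]. *)
Lemma lattice_lower_bound tau z : (0 < Im tau)%R ->
  (forall p a, z + RtoC (IZR p) * tau + RtoC (IZR a) <> 0) ->
  exists d, (0 < d)%R /\ forall pa : Z * Z,
    (d <= Cmod (z + RtoC (IZR (fst pa)) * tau + RtoC (IZR (snd pa))))%R.
Proof.
  intros Hy Hz. destruct (zrange_large (Im tau) (Rabs (Im z) + 1) Hy) as [N HN].
  destruct (zrange_large 1 (Rabs (Re z) + INR N * Rabs (Re tau) + 1) Rlt_0_1) as [N' HN'].
  apply (positive_lower_bound _ (list_prod (zrange N) (zrange N'))).
  - intros [p a]. apply Cmod_gt_0, Hz.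
  - intros [p a] H. rewrite in_prod_iff in H. cbn [fst snd].
    set (W := z + RtoC (IZR p) * tau + RtoC (IZR a)).
    destruct (classic (In p (zrange N))) as [Hp|Hp].
    + assert (Ha : ~ In a (zrange N')) by tauto. specialize (HN' a Ha).
      eapply Rle_trans; [|eapply Rle_trans; [apply Rmax_l|apply (Rmax_Cmod W)]].
      replace (fst W) with (IZR a - - (Re z + IZR p * Re tau))%R by (unfold W; destruct z, tau; simpl; ring).
      rewrite in_zrange in Hp. apply IZR_le in Hp. rewrite abs_IZR, <- INR_IZR_INZ in Hp.
      pose proof (Rabs_triang_inv (IZR a) (- (Re z + IZR p * Re tau))) as H1.
      rewrite Rabs_Ropp in H1. pose proof (Rabs_triang (Re z) (IZR p * Re tau)) as H2.
      rewrite Rabs_mult in H2. pose proof (Rabs_pos (Re tau)). nra.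
    + specialize (HN p Hp).
      eapply Rle_trans; [|eapply Rle_trans; [apply Rmax_r|apply (Rmax_Cmod W)]].
      replace (snd W) with (IZR p * Im tau - - Im z)%R by (unfold W; destruct z, tau; simpl; ring).
      pose proof (Rabs_triang_inv (IZR p * Im tau) (- Im z)) as H1.
      rewrite Rabs_Ropp, Rabs_mult, (Rabs_pos_eq (Im tau)) in H1 by lra. lra.
Qed.

(* The product of the [p]-th Appell weight with the [a]-th term of [appell_lattice], rewritten
   (dropping [2 pi i M p a]) so that modular covariance is visible: the Gaussian depends only
   on [|W|^2 / Im tau]. *)
Definition lattice_term (M : R) (tau z1 z2 : C) (pa : Z * Z) : C :=
  let W := z1 + RtoC (IZR (fst pa)) * tau + RtoC (IZR (snd pa)) in
  Cexp (RtoC (2 * PI * M) * Ci * (RtoC (IZR (fst pa)) * z2 - RtoC (Im z2 / Im tau) * W)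
        - RtoC (PI * M / Im tau * (Re W ^ 2 + Im W ^ 2))) / W.

(** Subtracting [s W] with [s = Im z2 / Im tau] cancels the growth in [p] of the phase [p z2]: its
    exponential has the constant modulus [exp (2 PI M s Im z1)]. What is left is a Gaussian in the
    definite form [|W|^2], and [1 / W] is bounded. *)
Lemma csum_lattice_term M tau z1 z2 : (0 < M)%R -> (0 < Im tau)%R ->
  (forall p a, z1 + RtoC (IZR p) * tau + RtoC (IZR a) <> 0) ->
  exists L, csum (lattice_term M tau z1 z2) L.
Proof.
  intros HM Hy Hz. pose proof PI_RGT_0 as HPI.
  destruct (lattice_lower_bound tau z1 Hy Hz) as [d [Hd1 Hd2]].
  destruct tau as [x y], z1 as [r1 i1], z2 as [r2 i2]. cbn [Im snd] in Hy.
  set (c := (PI * M / y)%R).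
  assert (Hc : (0 < c)%R) by (apply Rdiv_lt_0_compat; nra).
  (* The real part of [W] gives [A^2 / 2 - (p x)^2] with [A = a + r1], the imaginary part
     [(p y)^2 / 2 - i1^2]. Scaling the first by [eta <= 1] with [eta x^2 <= y^2 / 4] keeps its loss
     within half of the second, so the majorant separates into [p] and [a]. *)
  set (eta := (y ^ 2 / (4 * x ^ 2 + y ^ 2))%R).
  assert (Hden : (0 < 4 * x ^ 2 + y ^ 2)%R) by nra.
  assert (Heta0 : (0 < eta)%R) by (apply Rdiv_lt_0_compat; nra).
  assert (Heta1 : (eta <= 1)%R) by (apply Rle_div_l; nra).
  assert (Heta2 : (eta * x ^ 2 <= y ^ 2 / 4)%R).
  { assert (Hq : (eta * (4 * x ^ 2 + y ^ 2) = y ^ 2)%R) by (unfold eta; field; lra). nra. }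
  destruct (psum_gauss_shift (c * (y ^ 2 / 4)) 0) as [A HA]; [apply Rmult_lt_0_compat; nra|].
  destruct (psum_gauss_shift (c * (eta / 2)) (- r1)) as [B HB]; [apply Rmult_lt_0_compat; nra|].
  destruct (ex_psum_prod _ _ _ _ HA HB) as [D HD].
  set (K := (exp (2 * PI * M * (i2 / y) * i1 + c * i1 ^ 2) * / d)%R).
  assert (HK : (0 <= K)%R).
  { apply Rmult_le_pos; [apply Rlt_le, exp_pos|]. now apply Rlt_le, Rinv_0_lt_compat. }
  apply (csum_dominated _ _ _ (psum_scal _ _ K HK HD)).
  intros [p a]. specialize (Hd2 (p, a)). cbn [fst snd] in *. unfold lattice_term. cbn [fst snd].
  set (W := (r1, i1) + RtoC (IZR p) * (x, y) + RtoC (IZR a)) in *.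
  assert (HW0 : W <> 0) by apply Hz.
  rewrite Cmod_div, Cmod_Cexp by easy. unfold K.
  match goal with |- (_ <= ?a * ?b * ?e)%R => replace (a * b * e)%R with ((a * e) * b)%R by ring end.
  apply Rmult_le_compat; [apply Rlt_le, exp_pos| | |].
  - apply Rlt_le, Rinv_0_lt_compat. lra.
  - rewrite <- !exp_plus. apply exp_monotone.
    replace (Re _) with (2 * PI * M * (i2 / y) * i1 - c * (Re W ^ 2 + Im W ^ 2))%R.
    + unfold Rminus. rewrite Rplus_assoc. apply Rplus_le_compat_l.
      replace (Re W) with ((IZR a + r1) + IZR p * x)%R by (unfold W; simpl; ring).
      replace (Im W) with (i1 + IZR p * y)%R by (unfold W; simpl; ring).
      assert (H1 : ((IZR a + r1 + IZR p * x) ^ 2 >= eta * ((IZR a + r1) ^ 2 / 2 - (IZR p * x) ^ 2))%R).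
      { pose proof (pow2_ge_0 (IZR a + r1 + IZR p * x)). pose proof (pow2_ge_0 (IZR a + r1 + 2 * (IZR p * x))).
        assert ((IZR a + r1 + IZR p * x) ^ 2 >= (IZR a + r1) ^ 2 / 2 - (IZR p * x) ^ 2)%R by nra.
        destruct (Rle_dec 0 ((IZR a + r1) ^ 2 / 2 - (IZR p * x) ^ 2)); nra. }
      assert (H2 : ((i1 + IZR p * y) ^ 2 >= (IZR p * y) ^ 2 / 2 - i1 ^ 2)%R).
      { pose proof (pow2_ge_0 (2 * i1 + IZR p * y)). nra. }
      assert (H3 : (eta * (IZR p * x) ^ 2 <= IZR p ^ 2 * y ^ 2 / 4)%R).
      { pose proof (pow2_ge_0 (IZR p)). nra. }
      assert (H4 : ((IZR a + r1 + IZR p * x) ^ 2 + (i1 + IZR p * y) ^ 2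
                   >= eta / 2 * (IZR a - - r1) ^ 2 + y ^ 2 / 4 * (IZR p - 0) ^ 2 - i1 ^ 2)%R) by nra.
      nra.
    + unfold W, c. simpl. field. lra.
  - now apply Rinv_le_contravar.
Qed.

Ltac positive := repeat match goal with
  | |- (0 < _ * _)%R => apply Rmult_lt_0_compat
  | |- (0 < _ / _)%R => apply Rdiv_lt_0_compat end; try lra.

(** * Appell weights and the expanded correction term *)

Definition quad_weight (M : R) (tau u : C) (p : Z) : C :=
  e2pi (RtoC (IZR p * M) * u) * qpow tau (IZR p ^ 2 * M).

Lemma quad_weight_e2pi M tau u p : quad_weight M tau u p = e2pi (RtoC (IZR p * M) * u + RtoC (IZR p ^ 2 * M) * tau).
Proof. unfold quad_weight, qpow. now rewrite e2pi_plus. Qed.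

Lemma psum_quad_weight M tau u : (0 < M)%R -> (0 < Im tau)%R ->
  exists B, psum (fun p => Cmod (quad_weight M tau u p)) B.
Proof.
  intros HM Hy. pose proof PI_RGT_0 as HPI.
  destruct (psum_gauss (2 * PI * M * Im tau) (- 2 * PI * M * Im u)) as [B HB].
  { positive. }
  exists B. revert HB. apply psum_ext. intros p. rewrite quad_weight_e2pi, Cmod_e2pi. f_equal.
  destruct u, tau. simpl. ring.
Qed.

Lemma csum_quad_weight M tau u : (0 < M)%R -> (0 < Im tau)%R -> exists s, csum (quad_weight M tau u) s.
Proof.
  intros HM Hy. destruct (psum_quad_weight M tau u HM Hy) as [B HB].
  apply (csum_dominated _ _ _ HB). intros; lra.
Qed.

Lemma csum_quad_weight_opp M tau u s : csum (quad_weight M tau u) s -> csum (quad_weight M tau (- u)) s.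
Proof.
  intros H. apply csum_ext with (fun p => quad_weight M tau u (- p)).
  - intros p. rewrite !quad_weight_e2pi. f_equal. rewrite opp_IZR. f_equal.
    + rewrite Ropp_mult_distr_l_reverse, RtoC_opp. ring.
    + f_equal. f_equal. ring.
  - apply (csum_bij (quad_weight M tau u) s Z.opp Z.opp); try (intros; lia). easy.
Qed.

Lemma csum_quad_weight_div M tau z1 u : (0 < M)%R -> (0 < Im tau)%R ->
  (forall p, e2pi (z1 + RtoC (IZR p) * tau) <> 1) ->
  exists s, csum (fun p => quad_weight M tau u p / (1 - e2pi (z1 + RtoC (IZR p) * tau))) s.
Proof.
  intros HM Hy Hz. destruct (psum_quad_weight M tau u HM Hy) as [B HB].
  destruct (one_minus_e2pi_lower_bound tau z1 Hy Hz) as [d [Hd1 Hd2]].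
  apply (csum_dominated _ _ _ (psum_scal _ _ (/ d) (Rlt_le _ _ (Rinv_0_lt_compat _ Hd1)) HB)).
  intros p. specialize (Hd2 p). rewrite Cmod_div.
  - rewrite (Rmult_comm (/ d)). apply Rmult_le_compat_l; [apply Cmod_ge_0|]. now apply Rinv_le_contravar.
  - apply Cmod_gt_0. lra.
Qed.

Section CorrectionTerm.

Variables (M : R) (tau z1 z2 : C).
Hypotheses (HM : (0 < M)%R) (Hy : (0 < Im tau)%R).

Let u := z1 + z2.
Let v := (z1 - z2) / 2.
Let c := (2 * M * (Im v / Im tau))%R.
Let k := sqrt (Im tau / M).

Lemma width_pos : (0 < k)%R.
Proof. apply sqrt_lt_R0. now apply Rdiv_lt_0_compat. Qed.

Lemma width_square : (k ^ 2 = Im tau / M)%R.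
Proof. apply pow2_sqrt. apply Rlt_le. now apply Rdiv_lt_0_compat. Qed.

(** The double series behind [R_j Theta_{-j}], indexed so that for fixed [p] it is a series in
    powers of [1 / X] with [X = e2pi (z1 + p tau)]; [correction_term_factor] recovers the
    product. *)
Definition correction_term (pn : Z * Z) : C :=
  RtoC (sign (IZR (snd pn) + 1 / 2) - E ((IZR (snd pn) + c) * k)) *
  (quad_weight M tau u (fst pn) * e2pi (- (RtoC (IZR (snd pn)) * (z1 + RtoC (IZR (fst pn)) * tau)))).

Lemma csum_correction_term : exists H, csum correction_term H.
Proof.
  pose proof PI_RGT_0 as HPI. pose proof width_square as Hk2.
  set (y := Im tau) in *.
  destruct (psum_gauss (PI * y * M / 3) (- 2 * PI * M * Im u)) as [A HA].
  { positive. }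
  destruct (psum_gauss (PI * y / (3 * M)) (- 2 * PI * (y / M) * c + 2 * PI * Im z1)) as [B HB].
  { positive. }
  destruct (ex_psum_prod _ _ _ _ HA HB) as [D HD].
  assert (HK : (0 <= 2)%R) by lra.
  apply (csum_dominated _ _ _ (psum_scal _ _ 2 HK HD)).
  intros [p n]. unfold correction_term. cbn [fst snd].
  rewrite Cmod_RtoC_mult, Rabs_minus_sym, quad_weight_e2pi, <- e2pi_plus, Cmod_e2pi.
  eapply Rle_trans.
  { apply Rmult_le_compat_r; [apply Rlt_le, exp_pos|apply (E_sign_bound k c n width_pos)]. }
  rewrite !Rmult_assoc. apply Rmult_le_compat_l; [lra|]. rewrite <- !exp_plus. apply exp_monotone.
  replace (Im _) with (IZR p * M * Im u + IZR p ^ 2 * M * y - IZR n * (Im z1 + IZR p * y))%R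
    by (unfold y; destruct u, tau, z1; simpl; ring).
  rewrite Hk2.
  (* The exponent is governed by the definite form [n^2 - 2 M n p + 2 (M p)^2]. Splitting off
     [n^2 / 3 + (M p)^2 / 3] gives a product majorant, and the remainder is this sum of squares. *)
  assert (Hsq : (0 <= PI * y / M * (2 / 3 * (IZR n - 3 / 2 * M * IZR p) ^ 2 + 1 / 6 * (M * IZR p) ^ 2))%R).
  { apply Rmult_le_pos.
    - apply Rlt_le, Rdiv_lt_0_compat; [|lra]. apply Rmult_lt_0_compat; lra.
    - pose proof (pow2_ge_0 (IZR n - 3 / 2 * M * IZR p)). pose proof (pow2_ge_0 (M * IZR p)). lra. }
  apply Rminus_le.
  match goal with |- (?x <= 0)%R =>
    replace x with (- (PI * y / M * (2 / 3 * (IZR n - 3 / 2 * M * IZR p) ^ 2 + 1 / 6 * (M * IZR p) ^ 2)))%R end.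
  - lra.
  - field. lra.
Qed.

(** Write [W^2 = |W|^2 + 2 i (Im W) W]. Since [c = M (Im z1 - Im z2) / Im tau] and
    [Im W = Im z1 + p Im tau], the terms linear in [W] add up to [- M (s + p) W] with
    [s = Im z2 / Im tau]; expanding [p W] against the quadratic weight leaves
    [M (p z2 - s W) - M p a]. *)
Lemma quad_weight_gauss_phase p a :
  quad_weight M tau u p * gauss_phase k c (z1 + RtoC (IZR p) * tau + RtoC (IZR a))
  = e2pi (RtoC (- (IZR p * IZR a * M))) *
    Cexp (RtoC (2 * PI * M) * Ci * (RtoC (IZR p) * z2 - RtoC (Im z2 / Im tau) * (z1 + RtoC (IZR p) * tau + RtoC (IZR a)))
        - RtoC (PI * M / Im tau * (Re (z1 + RtoC (IZR p) * tau + RtoC (IZR a)) ^ 2 + Im (z1 + RtoC (IZR p) * tau + RtoC (IZR a)) ^ 2))).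
Proof.
  rewrite quad_weight_e2pi. unfold e2pi, gauss_phase. rewrite <- !Cexp_plus. f_equal. rewrite width_square.
  unfold c, u, v. destruct tau as [x y], z1 as [r1 i1], z2 as [r2 i2]. cbn [Im snd] in *.
  apply C_ext; simpl; field; lra.
Qed.

Hypothesis HMZ : exists m, M = IZR m.
Hypothesis Hz : forall p, e2pi (z1 + RtoC (IZR p) * tau) <> 1.

Lemma lattice_neq_0 p a : z1 + RtoC (IZR p) * tau + RtoC (IZR a) <> 0.
Proof.
  intros H. apply (Hz p). rewrite <- (e2pi_plus_IZR _ a), H. apply (e2pi_IZR 0).
Qed.

Lemma lattice_term_row p a : lattice_term M tau z1 z2 (p, a) =
  quad_weight M tau u p * (gauss_phase k c (z1 + RtoC (IZR p) * tau + RtoC (IZR a)) / (z1 + RtoC (IZR p) * tau + RtoC (IZR a))).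
Proof.
  pose proof (lattice_neq_0 p a) as HW. unfold Cdiv. rewrite Cmult_assoc, quad_weight_gauss_phase.
  destruct HMZ as [m ->]. rewrite <- !mult_IZR, <- opp_IZR, e2pi_IZR. unfold lattice_term. cbn [fst snd].
  field. easy.
Qed.

(** At [n = 0] both signs are [+1], so reversal is not odd there; the resulting 2 is the source of
    the theta constant. *)
Lemma sign_half_opp n : sign (IZR (- n) + 1 / 2) = (- sign (IZR n + 1 / 2) + if Z.eq_dec n 0 then 2 else 0)%R.
Proof.
  rewrite !sign_half. destruct (Z.leb_spec 0 n); destruct (Z.leb_spec 0 (- n)); destruct (Z.eq_dec n 0); try lia; lra.
Qed.

Lemma appell_sum_lattice : exists b H th L,
  csum (fun p => quad_weight M tau u p / (1 - e2pi (z1 + RtoC (IZR p) * tau))) b /\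
  csum correction_term H /\ csum (quad_weight M tau u) th /\ csum (lattice_term M tau z1 z2) L /\
  b + RtoC (/ 2) * H - th = - (/ (RtoC (2 * PI) * Ci) * L).
Proof.
  destruct (csum_quad_weight_div M tau z1 u HM Hy Hz) as [b Hb].
  destruct csum_correction_term as [H HH].
  destruct (csum_quad_weight M tau u HM Hy) as [th Hth].
  destruct (csum_lattice_term M tau z1 z2 HM Hy lattice_neq_0) as [L HL].
  exists b, H, th, L. repeat (split; [easy|]).
  destruct (csum_fubini _ _ HH) as [h [Hh1 Hh2]].
  destruct (csum_fubini _ _ HL) as [l [Hl1 Hl2]].
  apply (csum_unique (fun p => quad_weight M tau u p / (1 - e2pi (z1 + RtoC (IZR p) * tau)) + RtoC (/ 2) * h p - quad_weight M tau u p)).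
  { apply csum_minus; [|easy]. apply csum_plus; [easy|]. now apply csum_scal. }
  apply csum_ext with (fun p => - (/ (RtoC (2 * PI) * Ci) * l p)).
  2:{ apply csum_opp. now apply csum_scal. }
  intros p. set (w := z1 + RtoC (IZR p) * tau).
  destruct (appell_lattice k c w width_pos (Hz p)) as [s [t [Hs [Ht Hst]]]].
  assert (Hl : l p = quad_weight M tau u p * t).
  { apply (csum_unique _ _ _ (Hl1 p)). generalize (csum_scal _ _ (quad_weight M tau u p) Ht). apply csum_ext.
    intros a. now rewrite lattice_term_row. }
  (* Reversing [n] turns [sign - E] against powers of [1 / X] into [E - sign] against powers of [X],
     plus 2 at [n = 0]. Halved and weighted, that 2 sums to [th]. *)
  assert (Hh : h p = quad_weight M tau u p * (s + 2)).
  { apply (csum_unique _ _ _ (Hh1 p)).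
    assert (Hd : csum (fun n : Z => if Z.eq_dec n 0 then RtoC 2 else 0) 2).
    { apply (csum_single 0%Z (fun n : Z => if Z.eq_dec n 0 then RtoC 2 else 0)). intros n Hn.
      now destruct (Z.eq_dec n 0). }
    pose proof (csum_scal _ _ (quad_weight M tau u p) (csum_plus _ _ _ _ Hs Hd)) as Hsum.
    apply (csum_bij _ _ Z.opp Z.opp Z.opp_involutive Z.opp_involutive) in Hsum.
    revert Hsum. apply csum_ext. intros n. unfold correction_term. cbn [fst snd]. fold w.
    rewrite sign_half_opp, opp_IZR.
    replace ((- IZR n - c) * k)%R with (- ((IZR n + c) * k))%R by ring. rewrite E_opp.
    replace (RtoC (- IZR n) * w) with (- (RtoC (IZR n) * w)) by (rewrite RtoC_opp; ring).
    destruct (Z.eq_dec n 0) as [->|Hn]; destruct (Z.eq_dec (- _) 0); try lia.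
    - replace (- (RtoC 0 * w)) with (RtoC (IZR 0)) by ring. rewrite e2pi_IZR.
      rewrite !RtoC_minus, RtoC_plus, !RtoC_opp. ring.
    - rewrite !RtoC_minus, RtoC_plus, !RtoC_opp. ring. }
  rewrite Hl, Hh.
  replace (/ (RtoC (2 * PI) * Ci) * (quad_weight M tau u p * t)) with (quad_weight M tau u p * (/ (RtoC (2 * PI) * Ci) * t)) by ring.
  replace (- (quad_weight M tau u p * (/ (RtoC (2 * PI) * Ci) * t))) with (quad_weight M tau u p * (1 / (1 - e2pi w) + RtoC (/ 2) * s))
    by (rewrite Hst; ring).
  replace (RtoC (/ 2) * (quad_weight M tau u p * (s + 2))) with (RtoC (/ 2) * (quad_weight M tau u p * s) + RtoC (/ 2 * 2) * quad_weight M tau u p)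
    by (rewrite RtoC_mult; ring).
  replace (/ 2 * 2)%R with 1%R by field. unfold Cdiv. ring.
Qed.

End CorrectionTerm.

Ltac eqC := lazymatch goal with |- ?a = ?b => change (@eq C a b) end.

(** * Theta functions and the series [Rkj] *)

Definition theta_term (j : Z) (k : nat) (tau z : C) (p : Z) : C :=
  let n := (IZR p + IZR j / (2 * INR k))%R in
  qpow tau (INR k * n ^ 2) * e2pi (RtoC (INR k * n) * z).

Lemma csum_Theta j k tau z : (0 < k)%nat -> (0 < Im tau)%R ->
  csum (theta_term j k tau z) (Theta j k tau z).
Proof.
  intros Hk Hy. pose proof PI_RGT_0 as HPI.
  assert (HK : (0 < INR k)%R) by now apply lt_0_INR.
  set (K := INR k) in *. set (h := (IZR j / (2 * K))%R).
  destruct (psum_gauss (2 * PI * K * Im tau) (- 4 * PI * K * h * Im tau - 2 * PI * K * Im z)) as [B HB].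
  { positive. }
  set (K0 := exp (- 2 * PI * (K * h ^ 2 * Im tau + K * h * Im z))).
  destruct (csum_dominated (theta_term j k tau z) _ _ (psum_scal _ _ K0 (Rlt_le _ _ (exp_pos _)) HB)) as [s Hs].
  - intros p. unfold theta_term. fold K. fold h. unfold qpow. rewrite <- e2pi_plus, Cmod_e2pi.
    unfold K0. rewrite <- exp_plus. apply Req_le. f_equal. destruct tau, z. simpl. ring.
  - rewrite <- (csum_sumZ _ _ Hs) in Hs. exact Hs.
Qed.

Lemma Theta_opp j k tau z : (0 < k)%nat -> (0 < Im tau)%R -> Theta (- j) k tau (- z) = Theta j k tau z.
Proof.
  intros Hk Hy. apply (csum_unique (theta_term j k tau z)); [|now apply csum_Theta].
  pose proof (csum_bij _ _ Z.opp Z.opp Z.opp_involutive Z.opp_involutive (csum_Theta (- j) k tau (- z) Hk Hy)) as H.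
  revert H. apply csum_ext. intros p. unfold theta_term. rewrite !opp_IZR.
  replace (- IZR p + - IZR j / (2 * INR k))%R with (- (IZR p + IZR j / (2 * INR k)))%R by (unfold Rdiv; ring).
  set (n := (IZR p + _)%R). f_equal; f_equal.
  - ring.
  - rewrite Ropp_mult_distr_r_reverse, RtoC_opp. ring.
Qed.

Definition R_term (k : nat) (tau v : C) (l : Z) : C :=
  RtoC (sign (IZR l + 1 / 2) - E ((IZR l + 2 * INR k * (Im v / Im tau)) * sqrt (Im tau / INR k)))
  * Cexp (- (RtoC (PI * IZR l ^ 2 / (2 * INR k)) * Ci * tau) - RtoC (2 * PI * IZR l) * Ci * v).

(** With [n = j + 2 k q], the theta index [p - q - j / 2k] is [p - n / 2k]. Completing the square in
    [k p^2 - n p] leaves [- n^2 / 4k], the exponent in [Rkj], and [k p (z1 + z2) - n z1] becomes the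
    theta phase minus [n v], where [v = (z1 - z2) / 2]. *)
Lemma correction_term_factor k tau z1 z2 p j q : (0 < k)%nat -> (0 < Im tau)%R ->
  correction_term (INR k) tau z1 z2 (p, (j + 2 * Z.of_nat k * q)%Z)
  = R_term k tau ((z1 - z2) / 2) (j + 2 * Z.of_nat k * q) * theta_term (- j) k tau (z1 + z2) (p - q).
Proof.
  intros Hk Hy. unfold correction_term, R_term, theta_term, qpow. cbn [fst snd].
  rewrite <- !Cmult_assoc. f_equal.
  rewrite quad_weight_e2pi, <- !e2pi_plus. unfold e2pi. rewrite <- Cexp_plus. f_equal.
  rewrite !plus_IZR, !mult_IZR, minus_IZR, opp_IZR, <- INR_IZR_INZ.
  assert (HK : (0 < INR k)%R) by now apply lt_0_INR.
  destruct tau as [x y], z1 as [r1 i1], z2 as [r2 i2].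
  apply C_ext; simpl; field; lra.
Qed.

(** Summing over [p] first gives [R_term] times a theta function that depends only on the class of
    [n] mod [2k], because [q] merely translates [p]. The classes then assemble the [Rkj]. *)
Lemma csum_R_Theta k tau z1 z2 H : (0 < k)%nat -> (0 < Im tau)%R ->
  csum (correction_term (INR k) tau z1 z2) H ->
  H = sum_n (fun i => Rkj k (Z.of_nat i) tau ((z1 - z2) / 2) * Theta (- Z.of_nat i) k tau (z1 + z2)) (2 * k - 1).
Proof.
  intros Hk Hy HH. set (v := (z1 - z2) / 2). set (u := z1 + z2).
  assert (HH' : csum (fun np : Z * Z => correction_term (INR k) tau z1 z2 (snd np, fst np)) H).
  { apply (csum_bij _ H (fun np : Z * Z => (snd np, fst np)) (fun pn : Z * Z => (snd pn, fst pn))); try easy;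
    intros [? ?]; easy. }
  destruct (csum_fubini _ _ HH') as [g [Hg1 Hg2]]. cbn [fst snd] in Hg1.
  assert (Hg : forall j q, g (j + 2 * Z.of_nat k * q)%Z = R_term k tau v (j + 2 * Z.of_nat k * q) * Theta (- j) k tau u).
  { intros j q. apply (csum_unique _ _ _ (Hg1 (j + 2 * Z.of_nat k * q)%Z)).
    pose proof (csum_bij _ _ (fun p => p - q)%Z (fun p => p + q)%Z
       (Z.sub_add q) (fun p => Z.add_simpl_r p q) (csum_Theta (- j) k tau u Hk Hy)) as Hth.
    generalize (csum_scal _ _ (R_term k tau v (j + 2 * Z.of_nat k * q)) Hth). apply csum_ext.
    intros p. now rewrite correction_term_factor. }
  destruct (csum_classes g H (2 * k - 1) (fun i q => Z.of_nat i + 2 * Z.of_nat k * q)%Z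
     (fun n => Z.to_nat (n mod (2 * Z.of_nat k))) (fun n => n / (2 * Z.of_nat k))%Z) as [G [HG1 HG2]]; trivial.
  - intros n. pose proof (Z.mod_pos_bound n (2 * Z.of_nat k)). lia.
  - intros n. pose proof (Z.mod_pos_bound n (2 * Z.of_nat k)). rewrite Z2Nat.id by lia.
    pose proof (Z.div_mod n (2 * Z.of_nat k)). lia.
  - intros i q Hi. rewrite (Z.mul_comm _ q). split.
    + rewrite Z.mod_add, Z.mod_small by lia. lia.
    + rewrite Z.div_add, Z.div_small by lia. lia.
  - rewrite HG2. apply sum_n_ext_loc. intros i Hi. specialize (HG1 i Hi). cbn beta in HG1.
    apply (csum_ext _ (fun q => Theta (- Z.of_nat i) k tau u * R_term k tau v (Z.of_nat i + 2 * Z.of_nat k * q))) in HG1.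
    2:{ intros q. rewrite Hg. ring. }
    (* Dividing by [Theta] when it is not zero spares a convergence proof for [Rkj]. *)
    destruct (classic (Theta (- Z.of_nat i) k tau u = 0)) as [H0|H0].
    + rewrite H0, Cmult_0_r. rewrite H0 in HG1. apply (csum_unique _ _ _ HG1).
      generalize (csum_zero (I := Z)). apply csum_ext. intros q. ring.
    + pose proof (csum_scal _ _ (/ Theta (- Z.of_nat i) k tau u) HG1) as HR.
      apply (csum_ext _ (fun q => R_term k tau v (Z.of_nat i + 2 * Z.of_nat k * q))) in HR.
      2:{ intros q. field. easy. }
      apply csum_sumZ in HR. unfold Rkj. fold (R_term k tau v).
      change (sumZ _) with (sumZ (fun q => R_term k tau v (Z.of_nat i + 2 * Z.of_nat k * q))).
      rewrite HR. eqC. field. easy.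
Qed.

Lemma sum_n_Cminus (f g : nat -> C) N : sum_n (fun i => f i - g i) N = sum_n f N - sum_n g N.
Proof.
  induction N as [|N IH]; [now rewrite !sum_O|]. rewrite !sum_Sn, IH.
  unfold plus; simpl. eqC. ring.
Qed.

(* The non-holomorphic parts of the [R_{m+1;j}] are exactly what turns each Appell sum
   into an absolutely convergent sum over the lattice [Z tau + Z]. *)
Lemma Phi_tilde_lattice m tau z1 z2 t : (0 < Im tau)%R ->
  (forall p, e2pi (z1 + RtoC (IZR p) * tau) <> 1) ->
  (forall p, e2pi (- z2 + RtoC (IZR p) * tau) <> 1) ->
  exists L1 L2, csum (lattice_term (INR (m + 1)) tau z1 z2) L1 /\
    csum (lattice_term (INR (m + 1)) tau (- z2) (- z1)) L2 /\
    Phi_tilde m tau z1 z2 t = - (e2pi (RtoC (INR (m + 1)) * t) / (RtoC (2 * PI) * Ci) * (L1 - L2)).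
Proof.
  intros Hy H1 H2. pose proof PI_RGT_0 as HPI.
  assert (Hk : (0 < m + 1)%nat) by lia.
  assert (HM : (0 < INR (m + 1))%R) by now apply lt_0_INR.
  assert (HMZ : exists n, INR (m + 1) = IZR n) by (eexists; apply INR_IZR_INZ).
  set (M := INR (m + 1)) in *.
  destruct (appell_sum_lattice M tau z1 z2 HM Hy HMZ H1) as [b1 [h1 [th1 [L1 [Hb1 [Hh1 [Hth1 [HL1 Heq1]]]]]]]].
  destruct (appell_sum_lattice M tau (- z2) (- z1) HM Hy HMZ H2) as [b2 [h2 [th2 [L2 [Hb2 [Hh2 [Hth2 [HL2 Heq2]]]]]]]].
  exists L1, L2. split; [easy|]. split; [easy|].
  assert (Hu : - z2 + - z1 = - (z1 + z2)) by ring. rewrite Hu in *.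
  assert (Hth : th2 = th1).
  { apply (csum_unique _ _ _ Hth2). now apply csum_quad_weight_opp. }
  assert (HPhi : Phi m tau z1 z2 t = e2pi (RtoC M * t) * (b1 - b2)).
  { unfold Phi. fold M. f_equal. apply csum_sumZ.
    generalize (csum_minus _ _ _ _ Hb1 Hb2). apply csum_ext. intros p. unfold quad_weight, qpow.
    rewrite !e2pi_plus. f_equal. unfold Cdiv. do 3 f_equal. ring. }
  apply (csum_R_Theta (m + 1) tau z1 z2 h1 Hk Hy) in Hh1.
  apply (csum_R_Theta (m + 1) tau (- z2) (- z1) h2 Hk Hy) in Hh2.
  rewrite Hu in Hh2.
  replace ((- z2 - - z1) / 2) with ((z1 - z2) / 2) in Hh2 by (unfold Cdiv; ring).
  (* Replacing [(z1, z2)] by [(- z2, - z1)] fixes [z1 - z2] and negates [z1 + z2]. Both halves thus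
     share the same [Rkj], and [Theta_opp] turns the second theta function into [Theta_j (z1 + z2)],
     giving the difference in [Phi_add]. *)
  assert (Hadd : Phi_add m tau z1 z2 t = RtoC (/ 2) * e2pi (RtoC M * t) * (h1 - h2)).
  { unfold Phi_add. fold M. rewrite Hh1, Hh2, <- sum_n_Cminus.
    replace (2 * (m + 1) - 1)%nat with (2 * m + 1)%nat by lia.
    replace (RtoC (- (1 / 2))) with (- RtoC (/ 2)) by (rewrite <- RtoC_opp; f_equal; field).
    replace (sum_n (fun i : nat => let j := Z.of_nat i in _) (2 * m + 1))
      with (- sum_n (fun i => Rkj (m + 1) (Z.of_nat i) tau ((z1 - z2) / 2) * Theta (- Z.of_nat i) (m + 1) tau (z1 + z2) -
        Rkj (m + 1) (Z.of_nat i) tau ((z1 - z2) / 2) * Theta (- Z.of_nat i) (m + 1) tau (- (z1 + z2))) (2 * m + 1)).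
    - ring.
    - assert (Hopp : forall f N, - sum_n f N = sum_n (fun i => - f i : C) N).
      { intros f N. induction N as [|N IH]; [now rewrite !sum_O|]. rewrite !sum_Sn, <- IH.
        unfold plus; simpl. eqC. ring. }
      rewrite Hopp. apply sum_n_ext. intros i. rewrite Theta_opp by easy. cbv zeta. eqC. ring. }
  unfold Phi_tilde. rewrite HPhi, Hadd.
  assert (Hd : (b1 - b2) + RtoC (/ 2) * (h1 - h2) = - (/ (RtoC (2 * PI) * Ci) * (L1 - L2))).
  { transitivity ((b1 + RtoC (/ 2) * h1 - th1) - (b2 + RtoC (/ 2) * h2 - th2)); [rewrite Hth; ring|].
    rewrite Heq1, Heq2. ring. }
  transitivity (e2pi (RtoC M * t) * ((b1 - b2) + RtoC (/ 2) * (h1 - h2))); [ring|].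
  rewrite Hd. unfold Cdiv. ring.
Qed.

(** * Transformations of the lattice sum *)

Definition off_lattice (tau z : C) : Prop := forall p a, z + RtoC (IZR p) * tau + RtoC (IZR a) <> 0.

Lemma off_lattice_e2pi tau z : off_lattice tau z <-> forall p, e2pi (z + RtoC (IZR p) * tau) <> 1.
Proof.
  split.
  - intros H p Hp. destruct (e2pi_eq_1 _ Hp) as [a Ha]. apply (H p (- a)%Z).
    rewrite Ha, opp_IZR, RtoC_opp. ring.
  - intros H p a Ha. apply (H p). rewrite <- (e2pi_plus_IZR _ a), Ha. apply (e2pi_IZR 0).
Qed.

Lemma off_lattice_opp tau z : off_lattice tau z -> off_lattice tau (- z).
Proof.
  intros H p a Ha. apply (H (- p)%Z (- a)%Z). rewrite !opp_IZR, !RtoC_opp.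
  transitivity (- (- z + RtoC (IZR p) * tau + RtoC (IZR a))); [ring|]. rewrite Ha. ring.
Qed.

Lemma off_lattice_plus tau z j b : off_lattice tau z ->
  off_lattice tau (z + RtoC (IZR j) * tau + RtoC (IZR b)).
Proof.
  intros H p a Ha. apply (H (j + p)%Z (b + a)%Z). rewrite !plus_IZR, !RtoC_plus, <- Ha. ring.
Qed.

Lemma off_lattice_T tau z : off_lattice tau z -> off_lattice (tau + 1) z.
Proof.
  intros H p a Ha. apply (H p (p + a)%Z). rewrite plus_IZR, RtoC_plus, <- Ha. ring.
Qed.

Lemma off_lattice_S (tau z : C) : tau <> 0 -> off_lattice tau z -> off_lattice (- RtoC 1 / tau) (z / tau).
Proof.
  intros Ht H p a Ha. apply (H a (- p)%Z). rewrite opp_IZR, RtoC_opp.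
  transitivity (tau * (z / tau + RtoC (IZR p) * (- RtoC 1 / tau) + RtoC (IZR a))); [field; easy|].
  rewrite Ha. ring.
Qed.

Lemma Phi_defined_off_lattice tau z1 z2 : Phi_defined tau z1 z2 -> off_lattice tau z1 /\ off_lattice tau z2.
Proof.
  assert (H0 : forall X : C, 1 - X <> 0 -> X <> 1) by (intros X HX ->; apply HX; ring).
  intros H. split.
  - apply off_lattice_e2pi. intros p. rewrite e2pi_plus. apply H0, (H p).
  - replace z2 with (- - z2) by ring. apply off_lattice_opp.
    apply off_lattice_e2pi. intros p. rewrite e2pi_plus. apply H0, (H p).
Qed.

Section LatticeSum.

Variables (M : R) (tau z1 z2 L : C).
Hypotheses (HMZ : exists m, M = IZR m) (Hy : (0 < Im tau)%R) (Hz : off_lattice tau z1).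
Hypothesis HL : csum (lattice_term M tau z1 z2) L.

Lemma upper_half_plane_neq_0 : tau <> 0.
Proof. intros H. rewrite H in Hy. simpl in Hy. lra. Qed.

(** The lattice of [-1 / tau] is the old one divided by [tau], with [(p, a)] corresponding to
    [(a, - p)]. So [W] becomes [W / tau], which yields the factor [tau], while [|W|^2 / Im tau] is
    invariant. *)
Lemma lattice_sum_S :
  csum (lattice_term M (- RtoC 1 / tau) (z1 / tau) (z2 / tau)) (tau * e2pi (RtoC M * (z1 * z2 / tau)) * L).
Proof.
  pose proof upper_half_plane_neq_0 as Ht.
  generalize (csum_scal _ _ (tau * e2pi (RtoC M * (z1 * z2 / tau)))
    (csum_bij _ _ (fun pa : Z * Z => (snd pa, - fst pa)%Z) (fun pa : Z * Z => (- snd pa, fst pa)%Z)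
      ltac:(intros [? ?]; cbn [fst snd]; f_equal; lia) ltac:(intros [? ?]; cbn [fst snd]; f_equal; lia) HL)).
  apply csum_ext. intros [p a]. unfold lattice_term. cbn [fst snd]. rewrite opp_IZR, RtoC_opp.
  assert (HW0 : z1 + RtoC (IZR a) * tau + - RtoC (IZR p) <> 0).
  { rewrite <- RtoC_opp, <- opp_IZR. apply Hz. }
  replace (z1 / tau + RtoC (IZR p) * (- RtoC 1 / tau) + RtoC (IZR a)) with ((z1 + RtoC (IZR a) * tau + - RtoC (IZR p)) / tau) by (field; easy).
  set (W := z1 + RtoC (IZR a) * tau + - RtoC (IZR p)) in *.
  (* Real coordinates [z2 = s tau + r]: dividing by [tau] gives [z2 / tau = s - r (-1 / tau)], so
     [- r] takes the place of [s]. The phases then differ by [z1 * z2 / tau], as [Hkey] records. *)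
  set (s := (Im z2 / Im tau)%R). set (r := (Re z2 - s * Re tau)%R).
  assert (Hz2 : z2 = RtoC s * tau + RtoC r).
  { unfold s, r, s. destruct z2, tau. cbn [Im snd] in Hy. apply C_ext; simpl; field; lra. }
  assert (Hn : (0 < Re tau ^ 2 + Im tau ^ 2)%R) by (pose proof (pow2_ge_0 (Re tau)); nra).
  assert (Him : Im (- RtoC 1 / tau) = (Im tau / (Re tau ^ 2 + Im tau ^ 2))%R).
  { destruct tau as [x y]. cbn [Re Im fst snd] in *. simpl. field. lra. }
  assert (Hs : (Im (z2 / tau) / Im (- RtoC 1 / tau) = - r)%R).
  { rewrite Him, Hz2. clear Him. destruct tau as [x y]. cbn [Re Im fst snd] in *. simpl. field. lra. }
  assert (Hnorm : (PI * M / Im (- RtoC 1 / tau) * (Re (W / tau) ^ 2 + Im (W / tau) ^ 2) = PI * M / Im tau * (Re W ^ 2 + Im W ^ 2))%R).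
  { rewrite Him. clear Him Hs. destruct tau as [x y], W as [w1 w2]. cbn [Re Im fst snd] in *. simpl. field. lra. }
  rewrite Hnorm, Hs.
  replace (Cexp (RtoC (2 * PI * M) * Ci * (RtoC (IZR p) * (z2 / tau) - RtoC (- r) * (W / tau))
     - RtoC (PI * M / Im tau * (Re W ^ 2 + Im W ^ 2))))
    with (e2pi (RtoC M * (z1 * z2 / tau)) * Cexp (RtoC (2 * PI * M) * Ci * (RtoC (IZR a) * z2 - RtoC s * W)
       - RtoC (PI * M / Im tau * (Re W ^ 2 + Im W ^ 2)))).
  - field. easy.
  - unfold e2pi. rewrite <- Cexp_plus. f_equal.
    rewrite (RtoC_mult (2 * PI) M), RtoC_opp.
    generalize (RtoC (PI * M / Im tau * (Re W ^ 2 + Im W ^ 2))). intros G.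
    assert (Hkey : z1 * z2 / tau + (RtoC (IZR a) * z2 - RtoC s * W) = RtoC (IZR p) * (z2 / tau) - - RtoC r * (W / tau)).
    { unfold W. rewrite Hz2. field. easy. }
    transitivity (RtoC (2 * PI) * RtoC M * Ci * (z1 * z2 / tau + (RtoC (IZR a) * z2 - RtoC s * W)) - G); [ring|].
    rewrite Hkey. ring.
Qed.

Lemma lattice_sum_T : csum (lattice_term M (tau + 1) z1 z2) L.
Proof.
  generalize (csum_bij _ _ (fun pa : Z * Z => (fst pa, snd pa + fst pa)%Z) (fun pa : Z * Z => (fst pa, snd pa - fst pa)%Z)
      ltac:(intros [? ?]; cbn [fst snd]; f_equal; lia) ltac:(intros [? ?]; cbn [fst snd]; f_equal; lia) HL).
  apply csum_ext. intros [p a]. unfold lattice_term. cbn [fst snd]. rewrite plus_IZR, RtoC_plus.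
  replace (z1 + RtoC (IZR p) * (tau + 1) + RtoC (IZR a)) with (z1 + RtoC (IZR p) * tau + (RtoC (IZR a) + RtoC (IZR p))) by ring.
  replace (Im (tau + 1)) with (Im tau) by (destruct tau; simpl; ring). easy.
Qed.

Lemma lattice_sum_shift j k a0 b0 :
  csum (lattice_term M tau (z1 + RtoC (IZR j) * tau + RtoC (IZR a0)) (z2 + RtoC (IZR k) * tau + RtoC (IZR b0)))
    (qpow tau (- (M * IZR j * IZR k)) * e2pi (- (RtoC M * (RtoC (IZR k) * z1 + RtoC (IZR j) * z2))) * L).
Proof.
  destruct HMZ as [m Hm].
  generalize (csum_scal _ _ (qpow tau (- (M * IZR j * IZR k)) * e2pi (- (RtoC M * (RtoC (IZR k) * z1 + RtoC (IZR j) * z2))))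
    (csum_bij _ _ (fun pa : Z * Z => (fst pa + j, snd pa + a0)%Z) (fun pa : Z * Z => (fst pa - j, snd pa - a0)%Z)
      ltac:(intros [? ?]; cbn [fst snd]; f_equal; lia) ltac:(intros [? ?]; cbn [fst snd]; f_equal; lia) HL)).
  apply csum_ext. intros [p a]. unfold lattice_term. cbn [fst snd].
  pose proof (Hz (p + j)%Z (a + a0)%Z) as HW0. rewrite !plus_IZR, !RtoC_plus in *.
  replace (z1 + RtoC (IZR j) * tau + RtoC (IZR a0) + RtoC (IZR p) * tau + RtoC (IZR a))
    with (z1 + (RtoC (IZR p) + RtoC (IZR j)) * tau + (RtoC (IZR a) + RtoC (IZR a0))) by ring.
  set (W := z1 + (RtoC (IZR p) + RtoC (IZR j)) * tau + (RtoC (IZR a) + RtoC (IZR a0))) in *.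
  replace (Im (z2 + RtoC (IZR k) * tau + RtoC (IZR b0)) / Im tau)%R with (Im z2 / Im tau + IZR k)%R.
  2:{ destruct z2, tau. cbn [Im snd] in Hy. simpl. field. lra. }
  generalize (RtoC (PI * M / Im tau * (Re W ^ 2 + Im W ^ 2))). intros G.
  rewrite RtoC_plus. set (s := RtoC (Im z2 / Im tau)).
  rewrite <- (Cmult_1_l (Cexp (RtoC (2 * PI * M) * Ci * (RtoC (IZR p) * _ - _) - G))).
  (* Besides the stated automorphy factor, the two exponents differ by this integer multiple of
     [2 PI i], coming from the integer parts of [W] and of the shift of [z2]. *)
  rewrite <- (e2pi_IZR (m * (k * (a + a0) - p * b0))).
  match goal with |- ?A * ?B * (?X / W) = ?Y * ?Z / W => enough (HE : A * B * X = Y * Z) end.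
  { unfold Cdiv. rewrite <- HE. ring. }
  unfold qpow, e2pi. rewrite <- !Cexp_plus. f_equal.
  rewrite !mult_IZR, minus_IZR, !mult_IZR, plus_IZR, <- Hm.
  rewrite RtoC_opp, !RtoC_mult, RtoC_minus, !RtoC_mult, RtoC_plus. unfold W. ring.
Qed.

Lemma lattice_sum_opp : csum (lattice_term M tau (- z1) (- z2)) (- L).
Proof.
  generalize (csum_opp _ _
    (csum_bij _ _ (fun pa : Z * Z => (- fst pa, - snd pa)%Z) (fun pa : Z * Z => (- fst pa, - snd pa)%Z)
      ltac:(intros [? ?]; cbn [fst snd]; f_equal; lia) ltac:(intros [? ?]; cbn [fst snd]; f_equal; lia) HL)).
  apply csum_ext. intros [p a]. unfold lattice_term. cbn [fst snd].
  pose proof (Hz (- p)%Z (- a)%Z) as HW0. rewrite !opp_IZR, !RtoC_opp in *.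
  replace (- z1 + RtoC (IZR p) * tau + RtoC (IZR a))
    with (- (z1 + - RtoC (IZR p) * tau + - RtoC (IZR a))) by ring.
  set (W := z1 + - RtoC (IZR p) * tau + - RtoC (IZR a)) in *.
  replace (Re (- W) ^ 2 + Im (- W) ^ 2)%R with (Re W ^ 2 + Im W ^ 2)%R by (destruct W; simpl; ring).
  replace (Im (- z2) / Im tau)%R with (- (Im z2 / Im tau))%R by (destruct z2; simpl; unfold Rdiv; ring).
  rewrite RtoC_opp.
  replace (RtoC (IZR p) * - z2 - - RtoC (Im z2 / Im tau) * - W)
    with (- RtoC (IZR p) * z2 - RtoC (Im z2 / Im tau) * W) by ring.
  field. easy.
Qed.

End LatticeSum.

Theorem corollary5p10 (m : nat) (tau z1 z2 t : C)
    (Htau : (0 < Im tau)%R) (Hdef : Phi_defined tau z1 z2) :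
  (* (a) *)
  Phi_tilde m (- RtoC 1 / tau) (z1 / tau) (z2 / tau) (t - z1 * z2 / tau)
    = tau * Phi_tilde m tau z1 z2 t
  /\
  (* (b) *)
  (forall a b : Z,
    Phi_tilde m tau (z1 + RtoC (IZR a)) (z2 + RtoC (IZR b)) t
      = Phi_tilde m tau z1 z2 t)
  /\
  (* (c) *)
  (Phi_tilde m tau (- z1) (- z2) t = - Phi_tilde m tau z1 z2 t
   /\ Phi_tilde m tau z2 z1 t = Phi_tilde m tau z1 z2 t)
  /\
  (* (d) *)
  Phi_tilde m (tau + RtoC 1) z1 z2 t = Phi_tilde m tau z1 z2 t
  /\
  (* (e) *)
  (forall j k : Z,
    Phi_tilde m tau (z1 + RtoC (IZR j) * tau) (z2 + RtoC (IZR k) * tau) t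
      = qpow tau (- (INR (m + 1) * IZR j * IZR k))
        * e2pi (- (RtoC (INR (m + 1)) * (RtoC (IZR k) * z1 + RtoC (IZR j) * z2)))
        * Phi_tilde m tau z1 z2 t).
Proof.
  destruct (Phi_defined_off_lattice tau z1 z2 Hdef) as [Hz1 Hz2].
  set (M := INR (m + 1)).
  assert (HMZ : exists n, M = IZR n) by (eexists; apply INR_IZR_INZ).
  (* Stated for any known values of the two lattice sums, which are unique; each transformation then
     only needs these sums at the new point. *)
  assert (Hform : forall tau z1 z2 t L1 L2, (0 < Im tau)%R -> off_lattice tau z1 -> off_lattice tau z2 ->
    csum (lattice_term M tau z1 z2) L1 -> csum (lattice_term M tau (- z2) (- z1)) L2 ->
    Phi_tilde m tau z1 z2 t = - (e2pi (RtoC M * t) / (RtoC (2 * PI) * Ci) * (L1 - L2))).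
  { clear. intros tau z1 z2 t L1 L2 Hy H1 H2 HL1 HL2.
    destruct (Phi_tilde_lattice m tau z1 z2 t Hy) as [L1' [L2' [HL1' [HL2' ->]]]].
    - now apply off_lattice_e2pi.
    - now apply off_lattice_e2pi, off_lattice_opp.
    - fold M in HL1', HL2'. rewrite (csum_unique _ _ _ HL1 HL1'), (csum_unique _ _ _ HL2 HL2'). easy. }
  assert (HM : (0 < M)%R) by (apply lt_0_INR; lia).
  pose proof (off_lattice_opp _ _ Hz1) as Hz1'. pose proof (off_lattice_opp _ _ Hz2) as Hz2'.
  destruct (csum_lattice_term M tau z1 z2 HM Htau Hz1) as [L1 HL1].
  destruct (csum_lattice_term M tau (- z2) (- z1) HM Htau Hz2') as [L2 HL2].
  rewrite (Hform tau z1 z2 t L1 L2) by easy.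
  assert (Ht : tau <> 0) by (intros H; rewrite H in Htau; simpl in Htau; lra).
  assert (H2pi : RtoC (2 * PI) * Ci <> 0).
  { intros H. apply (f_equal Im) in H. simpl in H. pose proof PI_RGT_0. lra. }
  set (q := RtoC (2 * PI) * Ci) in *.
  split; [|split; [|split; [split|split]]].
  - assert (Htau' : (0 < Im (- RtoC 1 / tau))%R).
    { destruct tau as [x y]. cbn [Im snd] in Htau. pose proof (pow2_ge_0 x).
      replace (Im _) with (y / (x ^ 2 + y ^ 2))%R by (simpl; field; nra).
      apply Rdiv_lt_0_compat; nra. }
    pose proof (lattice_sum_S M tau z1 z2 L1 Htau Hz1 HL1) as H1.
    pose proof (lattice_sum_S M tau (- z2) (- z1) L2 Htau Hz2' HL2) as H2.
    replace (- z2 / tau) with (- (z2 / tau)) in H2 by (unfold Cdiv; ring).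
    replace (- z1 / tau) with (- (z1 / tau)) in H2 by (unfold Cdiv; ring).
    replace (- z2 * - z1 / tau) with (z1 * z2 / tau) in H2 by (unfold Cdiv; ring).
    rewrite (Hform _ _ _ _ _ _ Htau' (off_lattice_S _ _ Ht Hz1) (off_lattice_S _ _ Ht Hz2) H1 H2).
    replace (RtoC M * t) with (RtoC M * (t - z1 * z2 / tau) + RtoC M * (z1 * z2 / tau)) by ring.
    rewrite e2pi_plus. field. easy.
  - intros a b.
    pose proof (lattice_sum_shift M tau z1 z2 L1 HMZ Htau Hz1 HL1 0 0 a b) as H1.
    (* In the second sum the roles are exchanged and the signs reversed: its arguments [- z2],
       [- z1] move by [- b], [- a]. *)
    pose proof (lattice_sum_shift M tau (- z2) (- z1) L2 HMZ Htau Hz2' HL2 0 0 (- b) (- a)) as H2.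
    pose proof (off_lattice_plus tau z1 0 a Hz1) as H3. pose proof (off_lattice_plus tau z2 0 b Hz2) as H4.
    rewrite !Rmult_0_r, Ropp_0 in H1, H2.
    assert (Hzero : forall z1 z2, - (RtoC M * (RtoC 0 * z1 + RtoC 0 * z2)) = RtoC 0 * 1) by (intros; ring).
    rewrite Hzero in H1, H2. unfold qpow in H1, H2.
    replace (RtoC 0 * 1) with (RtoC (IZR 0)) in H1, H2 by ring.
    replace (RtoC 0 * tau) with (RtoC (IZR 0)) in * by ring. rewrite e2pi_IZR in H1, H2.
    rewrite !Cmult_1_l, !Cplus_0_r in *. rewrite !opp_IZR, !RtoC_opp, <- !Copp_plus_distr in H2.
    now rewrite (Hform _ _ _ _ _ _ Htau H3 H4 H1 H2).
  - pose proof (lattice_sum_opp M tau z1 z2 L1 Hz1 HL1) as H1.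
    pose proof (lattice_sum_opp M tau (- z2) (- z1) L2 Hz2' HL2) as H2.
    rewrite (Hform _ _ _ _ _ _ Htau Hz1' Hz2' H1 H2). field. easy.
  (* Exchanging the variables calls for the sums at [(z2, z1)] and [(- z1, - z2)]. By oddness these
     are [- L2] and [- L1], whose difference is again [L1 - L2]. *)
  - pose proof (lattice_sum_opp M tau z1 z2 L1 Hz1 HL1) as H1.
    pose proof (lattice_sum_opp M tau (- z2) (- z1) L2 Hz2' HL2) as H2.
    replace (- - z2) with z2 in H2 by ring. replace (- - z1) with z1 in H2 by ring.
    rewrite (Hform _ _ _ _ _ _ Htau Hz2 Hz1 H2 H1). field. easy.
  - apply Hform; auto using off_lattice_T, lattice_sum_T.
    destruct tau. simpl in *. lra.
  - intros j k.
    pose proof (lattice_sum_shift M tau z1 z2 L1 HMZ Htau Hz1 HL1 j k 0 0) as H1.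
    (* The shifts [- k], [- j] of the arguments [- z2], [- z1] give the same automorphy factor as in
       the first sum, since both [j k] and [k z1 + j z2] are unchanged. *)
    pose proof (lattice_sum_shift M tau (- z2) (- z1) L2 HMZ Htau Hz2' HL2 (- k) (- j) 0 0) as H2.
    pose proof (off_lattice_plus tau z1 j 0 Hz1) as H3. pose proof (off_lattice_plus tau z2 k 0 Hz2) as H4.
    rewrite !Cplus_0_r in *.
    rewrite !opp_IZR, !RtoC_opp in H2.
    replace (- z2 + - RtoC (IZR k) * tau) with (- (z2 + RtoC (IZR k) * tau)) in H2 by ring.
    replace (- z1 + - RtoC (IZR j) * tau) with (- (z1 + RtoC (IZR j) * tau)) in H2 by ring.
    replace (- RtoC (IZR j) * - z2 + - RtoC (IZR k) * - z1) with (RtoC (IZR k) * z1 + RtoC (IZR j) * z2) in H2 by ring.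
    replace (M * - IZR k * - IZR j)%R with (M * IZR j * IZR k)%R in H2 by ring.
    rewrite (Hform _ _ _ _ _ _ Htau H3 H4 H1 H2). field. easy.
Qed.
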